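(* Let $m$ be a positive integer and $N>1$ an integer. Let $V'(N,2m,l)$ be the region obtained from the lattice hexagon with side lengths $2m,N,N,2m,N,N$ (clockwise from the top) by deleting the $l$-th lozenge, counted from the top, among the vertical lozenges whose vertical diagonal lies on the vertical line half a unit to the right of the hexagon's vertical symmetry axis (for a positive integer $l$ such that this lozenge exists). Then $$\operatorname{M}(V'(N,2m,l))=\frac{(m+1)_{N}(m)_{N}(N)_{N-1}}{(2m+1)_{N}(2m+N)_{N}(N-1)!}\cdot\sigma_{1}(N,m,l)\cdot\prod_{i=1}^{N}\prod_{j=1}^{N}\prod_{k=1}^{2m}\frac{i+j+k-1}{i+j+k-2},$$ where $$\sigma_1(N,m,l)=(2m+2N-1)\sum_{e=0}^{l-1}(-1)^{e}\binom{N-1}{e}\frac{(N-2e-1)(\frac12)_e}{(m+e)(m+N-e-1)(\frac32-N)_e}+(2m+1)\sum_{e=0}^{l-1}(-1)^{e}\binom{N-1}{e}\frac{(N-2e-1)(\frac12)_e}{(m+e+1)(m+N-e)(\frac32-N)_e}.$$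
   Context: The triangular lattice is drawn with one family of lattice lines horizontal; $\operatorname{M}(R)$ is the number of lozenge tilings of $R$. A vertical lozenge is the union of an up-pointing unit triangle and the down-pointing unit triangle directly below it sharing its horizontal side; its vertical diagonal joins two lattice points. $(a)_0=1$, $(a)_e=a(a+1)\cdots(a+e-1)$. *)

(* Defs.v *)
From mathcomp Require Import all_boot all_order all_algebra finmap zify.

Set Implicit Arguments.
Unset Strict Implicit.
Unset Printing Implicit Defensive.

Import Order.TTheory GRing.Theory Num.Theory.

Local Open Scope fset_scope.
Local Open Scope ring_scope.

(* The lattice point (i, j) stands for i * (1, 0) + j * (1/2, sqrt 3 / 2):
   rows of constant j are horizontal, and j increases upwards. *)
Definition point : Type := (int * int)%type.

Definition double_abscissa (p : point) : int := 2 * p.1 + p.2.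

(* ((i, j), true) is the up-pointing unit triangle with lower left vertex
   (i, j); ((i, j), false) is the down-pointing unit triangle that shares the
   right side of ((i, j), true). *)
Definition triangle : Type := (point * bool)%type.

Definition up (p : point) : triangle := (p, true).
Definition down (p : point) : triangle := (p, false).

Definition vertices (t : triangle) : seq point :=
  let: ((i, j), is_up) := t in
  if is_up then [:: (i, j); (i + 1, j); (i, j + 1)]
  else [:: (i + 1, j); (i, j + 1); (i + 1, j + 1)].

Definition share_side (t u : triangle) : bool :=
  count (mem (vertices u)) (vertices t) == 2.

Definition is_lozenge (R : {fset triangle}) (L : {set R}) : bool :=
  [exists t : R, exists u : R,
     share_side (val t) (val u) && (L == [set t; u])].

Definition is_tiling (R : {fset triangle}) (P : {set {set R}}) : bool :=
  partition P [set: R] && [forall L in P, is_lozenge L].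

Definition M (R : {fset triangle}) : nat :=
  #|[set P : {set {set R}} | is_tiling P]|.

(* The hexagon with side lengths a, b, c, a, b, c clockwise from the top, whose
   bottom side joins (0, 0) to (a, 0); its other vertices are (a, c),
   (a - b, b + c), (- b, b + c) and (- b, b). *)
Definition in_hexagon (a b c : nat) (p : point) : bool :=
  [&& - b%:Z <= p.1 <= a%:Z, 0 <= p.2 <= (b + c)%:Z
    & 0 <= p.1 + p.2 <= (a + c)%:Z].

Definition int_range (x : int) (n : nat) : seq int :=
  [seq x + k%:Z | k <- iota 0 n].

Definition hexagon_box (a b c : nat) : seq point :=
  [seq (i, j) | i <- int_range (- b%:Z) (a + b), j <- int_range 0 (b + c)].

Definition hexagon (a b c : nat) : {fset triangle} :=
  [fset t in [seq (p, s) | p <- hexagon_box a b c, s <- [:: true; false]]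
     | all (in_hexagon a b c) (vertices t)].

Lemma mem_int_range (x y : int) (n : nat) :
  (y \in int_range x n) = (x <= y < x + n%:Z).
Proof.
apply/mapP/idP => [[k]|xy]; first by rewrite mem_iota => ? ->; lia.
by exists `|y - x|%N; [rewrite mem_iota|]; lia.
Qed.

Lemma mem_hexagon_box (a b c : nat) (p : point) :
  (p \in hexagon_box a b c) =
  (- b%:Z <= p.1 < a%:Z) && (0 <= p.2 < (b + c)%:Z).
Proof.
case: p => i j /=; apply/allpairsP/idP => [[[x y] /= []]|ij].
  by rewrite !mem_int_range => ? ? [-> ->]; lia.
by exists (i, j); split=> //=; rewrite mem_int_range; lia.
Qed.

(* The bounding box used to enumerate the hexagon does not truncate it. *)
Lemma mem_hexagon (a b c : nat) (t : triangle) :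
  (t \in hexagon a b c) = all (in_hexagon a b c) (vertices t).
Proof.
rewrite !inE; apply/andP/idP => [[]//|ht]; split=> //.
apply/allpairsP; exists t; case: t ht => [[i j] s] ht; split=> //=.
  by rewrite mem_hexagon_box; case: s ht; rewrite /in_hexagon /=; lia.
by case: s {ht}; rewrite !inE.
Qed.

(* The vertical lozenge whose horizontal diagonal has left endpoint p; its
   vertical diagonal joins top_vertex p to bottom_vertex p. *)
Definition vlozenge (p : point) : {fset triangle} :=
  [fset up p; down (p.1, p.2 - 1)].
Definition top_vertex (p : point) : point := (p.1, p.2 + 1).
Definition bottom_vertex (p : point) : point := (p.1 + 1, p.2 - 1).

(* The vertical symmetry axis of hexagon n N N has abscissa n / 2. *)
Definition on_shifted_axis (n : nat) (p : point) : bool :=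
  (double_abscissa (top_vertex p) == n%:Z + 1) &&
  (double_abscissa (bottom_vertex p) == n%:Z + 1).

Definition shifted_axis_lozenges (N n : nat) : seq point :=
  sort (fun p q : point => q.2 <= p.2)
    [seq p <- hexagon_box n N N
       | (vlozenge p `<=` hexagon n N N) && on_shifted_axis n p].

Definition V' (N n l : nat) : {fset triangle} :=
  hexagon n N N `\` vlozenge (nth (0, 0) (shifted_axis_lozenges N n) l.-1).

Definition poch (a : rat) (e : nat) : rat := \prod_(0 <= i < e) (a + i%:R).

Definition sigma1 (N m l : nat) : rat :=
  (2 * m%:R + 2 * N%:R - 1) *
    (\sum_(0 <= e < l) (-1) ^+ e * 'C(N - 1, e)%:R *
       ((N%:R - 2 * e%:R - 1) * poch (1 / 2) e /
        ((m%:R + e%:R) * (m%:R + N%:R - e%:R - 1) * poch (3 / 2 - N%:R) e)))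
  + (2 * m%:R + 1) *
    (\sum_(0 <= e < l) (-1) ^+ e * 'C(N - 1, e)%:R *
       ((N%:R - 2 * e%:R - 1) * poch (1 / 2) e /
        ((m%:R + e%:R + 1) * (m%:R + N%:R - e%:R) * poch (3 / 2 - N%:R) e))).

(* Main.v *)
Require Import Defs.
From mathcomp Require Import all_boot all_order all_algebra finmap perm zify ring lra.

(** Cutting a tiling along the horizontal lattice lines turns it into an array of
    interlacing rows of vertical lozenges whose top row consists of two blocks of
    [N] consecutive positions separated by a gap of [2 m].  Summing a determinant
    [det (phi_b (y_a))] over the rows [y] interlacing with [x] gives again a
    determinant, with the [phi_b] replaced by [1] and their partial sums.  Hence
    arrays are counted by a determinant of binomial coefficients, and prescribing
    one lozenge replaces a column; by Cramer's rule the resulting quotient [rho]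
    is a difference of order [2 l] of the polynomial of degree [< 2 N] that
    vanishes on the left block and agrees with a binomial coefficient on the right
    block.

    Lagrange interpolation makes [rho] an explicit rational function of [m], odd
    under [m |-> - N - m].  At [m = - e] the two blocks overlap and almost all
    terms of the interpolation formula vanish, so the value of [rho] there is
    elementary; for [2 l <= N] these values, the oddness and the bound
    [0 <= rho <= 1] at positive integers determine [rho].  The case [2 l > N]
    follows by reflection in the horizontal symmetry axis. *)

Set Implicit Arguments.
Unset Strict Implicit.
Unset Printing Implicit Defensive.

Import Order.TTheory GRing.Theory Num.Theory.

Local Open Scope ring_scope.

(** * Limits of rational functions *)

(** Division by zero in [rat] returns zero, so [rho] has no meaningful value at [- e], where its
    denominators may vanish. Identities between rational functions are therefore stated off a finite
    set, and values at [- e] are limits. The factor [2 x + N] is the one that [(2x+1)_N] and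
    [(2x+N)_N] share; it also cancels the pole that [rho] has at the centre [- N / 2] of the
    reflection when [N = 2 l].

    After clearing denominators the difference of the two sides is a polynomial of degree at most
    [2 N], because [rho], being bounded at the positive integers, contributes no growth. Equal
    limits at [- e] give a zero there, and a double zero for [0 < e < N], where the cleared
    denominator [(2x+1)_(2N-1)] vanishes too. This makes [2 N] zeros, one too few to conclude.
    Oddness is therefore used twice: it carries the zeros from [2 e <= N] to all [e <= N], and it
    excludes the even degree [2 N].

    The order [2 l] of the difference is the number of rows above the prescribed lozenge: each of
    them sums the prescribed column once more. *)

Definition almost (P : rat -> Prop) : Prop :=
  exists s : seq rat, forall x, x \notin s -> P x.

Lemma almost_and (P Q : rat -> Prop) :
  almost P -> almost Q -> almost (fun x => P x /\ Q x).
Proof.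
move=> [s Ps] [t Qt]; exists (s ++ t) => x.
by rewrite mem_cat negb_or => /andP[/Ps ? /Qt].
Qed.

Lemma almost_mono (P Q : rat -> Prop) :
  (forall x, P x -> Q x) -> almost P -> almost Q.
Proof. by move=> PQ [s Ps]; exists s => x /Ps /PQ. Qed.

Lemma almost_all (P : rat -> Prop) : (forall x, P x) -> almost P.
Proof. by exists [::]. Qed.

Lemma almost_mono2 (P Q R : rat -> Prop) :
  (forall x, P x -> Q x -> R x) -> almost P -> almost Q -> almost R.
Proof.
move=> PQR Ps Qs; apply: almost_mono (almost_and Ps Qs) => x [? ?]; exact: PQR.
Qed.

Lemma almost_neq (c : rat) : almost (fun x => x != c).
Proof. by exists [:: c] => x; rewrite inE. Qed.

Lemma almost_lin_neq0 (a b : rat) : a != 0 -> almost (fun x => a * x + b != 0).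
Proof.
move=> a0; apply: almost_mono (almost_neq (- b / a)) => x; apply: contra => /eqP h.
have -> : x = (a * x + b - b) / a by rewrite addrK mulrAC mulfV // mul1r.
by rewrite h add0r.
Qed.

Lemma almost_forall (I : finType) (P : I -> rat -> Prop) :
  (forall i, almost (P i)) -> almost (fun x => forall i, P i x).
Proof.
move=> aP.
have: almost (fun x => forall i, i \in enum I -> P i x).
  elim: (enum I) => [|i s IH]; first by apply: almost_all => x i.
  apply: almost_mono2 IH (aP i) => x h1 h2 j.
  by rewrite inE => /orP[/eqP-> //|/h1].
by apply: almost_mono => x h i; apply: h; rewrite mem_enum.
Qed.

Lemma almost_prod_neq0 (I : finType) (P : pred I) (F : I -> rat -> rat) :
  (forall i, P i -> almost (fun x => F i x != 0)) ->
  almost (fun x => \prod_(i | P i) F i x != 0).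
Proof.
move=> aF.
have: almost (fun x => forall i, P i -> F i x != 0).
  apply: almost_forall => i; have [Pi|nPi] := boolP (P i); last exact: almost_all.
  by apply: almost_mono (aF i Pi).
by apply: almost_mono => x h; apply/prodf_neq0 => i /h.
Qed.

Lemma almost_reflect (c : rat) (P : rat -> Prop) :
  almost P -> almost (fun x => P (c - x)).
Proof.
move=> [s Ps]; exists [seq c - y | y <- s] => x xs; apply: Ps.
by apply: contra xs => xs; apply/mapP; exists (c - x) => //; ring.
Qed.

(** A nonzero difference would have too many roots: of the first [size s + size (p - q)] natural
    numbers at most [size s] lie in the exceptional list [s]. *)
Lemma poly_almost_eq (p q : {poly rat}) :
  almost (fun x => p.[x] = q.[x]) -> p = q.
Proof.
move=> [s hs]; apply/eqP; rewrite -subr_eq0; apply/negPn/negP => d0.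
pose t := [seq x <- [seq k%:R : rat | k <- iota 0 (size s + size (p - q))]
              | x \notin s].
have ut : uniq t.
  apply: filter_uniq; rewrite map_inj_uniq ?iota_uniq // => i j /eqP.
  by rewrite eqr_nat => /eqP.
have rt : all (root (p - q)) t.
  apply/allP => x; rewrite mem_filter => /andP[/hs h _].
  by rewrite rootE !hornerE h subrr.
have := max_poly_roots d0 rt ut; rewrite ltnNge => /negP; apply.
set u := [seq k%:R : rat | k <- _] in t ut rt *.
have uu : uniq u.
  by rewrite map_inj_uniq ?iota_uniq // => i j /eqP; rewrite eqr_nat => /eqP.
have: (size u <= size s + size t)%N.
  rewrite -[size u](count_predC [in s] u) leq_add //; last by rewrite size_filter.
  rewrite -size_filter; apply: uniq_leq_size; first exact: filter_uniq.
  by move=> x; rewrite mem_filter => /andP[].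
by rewrite size_map size_iota leq_add2l.
Qed.

(* [rlim f e v]: away from finitely many points [f] is a rational function that
   is regular at [e] with value [v] there; [f e] itself is irrelevant. *)
Definition rlim (f : rat -> rat) (e v : rat) : Prop :=
  exists g h : {poly rat}, [/\ h.[e] != 0, g.[e] = v * h.[e]
    & almost (fun x => f x * h.[x] = g.[x])].

Section Rlim.
Variable e : rat.
Implicit Types (f g : rat -> rat) (u v : rat).

Lemma rlim_almost f f' v :
  almost (fun x => f x = f' x) -> rlim f e v -> rlim f' e v.
Proof.
move=> ff [g [h [h0 gv fg]]]; exists g, h; split=> //.
by apply: almost_mono2 ff fg => x <-.
Qed.

Lemma rlim_horner (p : {poly rat}) : rlim (horner p) e p.[e].
Proof.
exists p, 1; rewrite hornerC oner_eq0 mulr1; split=> //.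
by apply: almost_all => x; rewrite hornerC mulr1.
Qed.

Lemma rlim_lin f (a b : rat) : (forall x, f x = a * x + b) -> rlim f e (f e).
Proof.
move=> fE; have := rlim_horner (a *: 'X + b%:P).
rewrite !hornerE -fE; apply: rlim_almost.
by apply: almost_all => x; rewrite fE !hornerE.
Qed.

Lemma rlim_cst (c : rat) : rlim (fun=> c) e c.
Proof. by apply: (@rlim_lin (fun=> c) 0 c) => x; rewrite mul0r add0r. Qed.

Lemma rlimM f g u v :
  rlim f e u -> rlim g e v -> rlim (fun x => f x * g x) e (u * v).
Proof.
move=> [a [b [b0 au fab]]] [c [d [d0 cv gcd]]].
exists (a * c), (b * d); rewrite !(hornerM, hornerD) mulf_neq0 //; split=> //.
  by rewrite au cv; ring.
by apply: almost_mono2 fab gcd => x h1 h2; rewrite !(hornerM, hornerD) -h1 -h2; ring.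
Qed.

Lemma rlimD f g u v :
  rlim f e u -> rlim g e v -> rlim (fun x => f x + g x) e (u + v).
Proof.
move=> [a [b [b0 au fab]]] [c [d [d0 cv gcd]]].
exists (a * d + b * c), (b * d); rewrite !(hornerM, hornerD) mulf_neq0 //; split=> //.
  by rewrite au cv; ring.
by apply: almost_mono2 fab gcd => x h1 h2; rewrite !(hornerM, hornerD) -h1 -h2; ring.
Qed.

Lemma rlimN f u : rlim f e u -> rlim (fun x => - f x) e (- u).
Proof.
move=> hf; rewrite -mulN1r; apply: rlim_almost (rlimM (rlim_cst (-1)) hf).
by apply: almost_all => x; rewrite mulN1r.
Qed.

Lemma rlimB f g u v :
  rlim f e u -> rlim g e v -> rlim (fun x => f x - g x) e (u - v).
Proof. by move=> hf hg; apply: rlimD hf (rlimN hg). Qed.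

Lemma rlim_sum (I : finType) (P : pred I) (F : I -> rat -> rat) (w : I -> rat) :
  (forall i, P i -> rlim (F i) e (w i)) ->
  rlim (fun x => \sum_(i | P i) F i x) e (\sum_(i | P i) w i).
Proof.
move=> hF.
have: rlim (fun x => \sum_(i <- index_enum I | P i) F i x) e
           (\sum_(i <- index_enum I | P i) w i).
  elim: (index_enum I) => [|i s IH].
    rewrite big_nil; apply: rlim_almost (rlim_cst 0).
    by apply: almost_all => x; rewrite big_nil.
  rewrite big_cons; case: ifP => Pi.
    apply: rlim_almost (rlimD (hF i Pi) IH).
    by apply: almost_all => x; rewrite big_cons Pi.
  by apply: rlim_almost IH; apply: almost_all => x; rewrite big_cons Pi.
by [].
Qed.

Lemma rlim_prod (I : finType) (P : pred I) (F : I -> rat -> rat) (w : I -> rat) :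
  (forall i, P i -> rlim (F i) e (w i)) ->
  rlim (fun x => \prod_(i | P i) F i x) e (\prod_(i | P i) w i).
Proof.
move=> hF.
have: rlim (fun x => \prod_(i <- index_enum I | P i) F i x) e
           (\prod_(i <- index_enum I | P i) w i).
  elim: (index_enum I) => [|i s IH].
    rewrite big_nil; apply: rlim_almost (rlim_cst 1).
    by apply: almost_all => x; rewrite big_nil.
  rewrite big_cons; case: ifP => Pi.
    apply: rlim_almost (rlimM (hF i Pi) IH).
    by apply: almost_all => x; rewrite big_cons Pi.
  by apply: rlim_almost IH; apply: almost_all => x; rewrite big_cons Pi.
by [].
Qed.

(** Two representations [a / b] and [c / d] of [f] satisfy [a d = c b] as polynomials; evaluation at
    [e] compares the two values. *)
Lemma rlim_uniq f u v : rlim f e u -> rlim f e v -> u = v.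
Proof.
move=> [a [b [b0 au fab]]] [c [d [d0 cv fcd]]].
have E : a * d = c * b.
  apply: poly_almost_eq; apply: almost_mono2 fab fcd => x h1 h2.
  by rewrite !(hornerM, hornerD) -h1 -h2; ring.
have := congr1 (horner^~ e) E; rewrite !hornerM au cv => E'.
apply: (mulIf (mulf_neq0 b0 d0)); rewrite !mulrA E'; ring.
Qed.

Lemma rlimV f u : u != 0 -> almost (fun x => f x != 0) ->
  rlim f e u -> rlim (fun x => (f x)^-1) e u^-1.
Proof.
move=> u0 f0 [a [b [b0 au fab]]]; exists b, a; rewrite au mulf_neq0 //; split=> //.
  by rewrite mulrA mulVf // mul1r.
by apply: almost_mono2 f0 fab => x fx <-; rewrite mulrA mulVf // mul1r.
Qed.

(* [rord f e k v]: [f] behaves like [v * (x - e) ^ k] near [e]. *)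
Definition rord f (k : int) v := rlim (fun x => f x / (x - e) ^ k) e v.

Lemma rord0 f v : rord f 0 v <-> rlim f e v.
Proof.
by split; apply: rlim_almost; apply: almost_all => x; rewrite expr0z divr1.
Qed.

Lemma rord_almost f f' k v :
  almost (fun x => f x = f' x) -> rord f k v -> rord f' k v.
Proof. by move=> ff; apply: rlim_almost; apply: almost_mono ff => x ->. Qed.

Lemma rordM f g j k u v :
  rord f j u -> rord g k v -> rord (fun x => f x * g x) (j + k) (u * v).
Proof.
move=> hf hg; apply: rlim_almost (rlimM hf hg).
apply: almost_mono (almost_neq e) => x xe.
by rewrite expfzDr ?subr_eq0 // invfM mulrACA.
Qed.

Lemma rordV f k v : v != 0 -> almost (fun x => f x != 0) ->
  rord f k v -> rord (fun x => (f x)^-1) (- k) v^-1.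
Proof.
move=> v0 f0 hf; have H : almost (fun x => f x / (x - e) ^ k != 0).
  apply: almost_mono2 (almost_neq e) f0 => x xe fx.
  by rewrite mulf_neq0 // invr_eq0 expfz_neq0 // subr_eq0.
apply: rlim_almost (rlimV v0 H hf).
apply: almost_mono (almost_neq e) => x xe.
by rewrite invfM !invr_expz.
Qed.

Lemma rord_gt0 f k v : (0 < k)%R -> rord f k v -> rlim f e 0.
Proof.
case: k => // k; rewrite ltz_nat => k0 hf.
have : rlim (fun x => (x - e) ^+ k) e 0.
  case: k k0 hf => // k _ _.
  have: rlim (fun x => \prod_(i < k.+1) (x - e)) e (\prod_(i < k.+1) (0 : rat)).
    by apply: rlim_prod => i _; have := @rlim_lin (fun x => x - e) 1 (- e);
       rewrite subrr; apply=> x; rewrite mul1r.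
  rewrite prodr_const card_ord expr0n /=; apply: rlim_almost.
  by apply: almost_all => x; rewrite prodr_const card_ord.
move=> hk; rewrite -(mulr0 v); apply: rlim_almost (rlimM hf hk).
apply: almost_mono (almost_neq e) => x xe.
by rewrite mulfVK // expfz_neq0 // subr_eq0.
Qed.

Definition linear_fun f := exists a b : rat, forall x, f x = a * x + b.

Lemma linear_rlim f : linear_fun f -> rlim f e (f e).
Proof. by move=> [a [b]]; exact: rlim_lin. Qed.

Lemma rord_prod_lin (I : finType) (P : pred I) (F : I -> rat -> rat) :
  (forall i, P i -> linear_fun (F i)) ->
  rord (fun x => \prod_(i | P i) F i x) 0 (\prod_(i | P i) F i e).
Proof. by move=> hF; apply/rord0; apply: rlim_prod => i /hF /linear_rlim. Qed.

(** Only the factor of index [j] is known to vanish at [e]. The others enter through their values,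
    which may be zero as well, so in general the order is a lower bound. *)
Lemma rord_prod_lin1 (I : finType) (P : pred I) (F : I -> rat -> rat) j (a : rat) :
  (forall i, P i -> linear_fun (F i)) -> P j -> (forall x, F j x = a * (x - e)) ->
  rord (fun x => \prod_(i | P i) F i x) 1 (a * \prod_(i | P i && (i != j)) F i e).
Proof.
move=> hF Pj Fj.
have hp : rlim (fun x => \prod_(i | P i && (i != j)) F i x) e
               (\prod_(i | P i && (i != j)) F i e).
  by apply: rlim_prod => i /andP[/hF /linear_rlim].
apply: rlim_almost (rlimM (rlim_cst a) hp).
apply: almost_mono (almost_neq e) => x xe.
rewrite [in RHS](bigD1 j) //= Fj expr1z mulrAC -!mulrA; congr (_ * _).
by rewrite mulVKf ?subr_eq0.
Qed.

End Rlim.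

(** * The interpolation sum and its values at negative integers *)

(* Positions are measured from the midpoint of the difference operator, so that
   the interpolation nodes are [x + b] (right block) and [- (x + 1 + b)] (left
   block) for [b < N], and the evaluation points are [s - l] for [s <= 2 l]. *)
Definition qnum (l a : nat) (x : rat) : rat :=
  \prod_(i < (2 * l).-1) (x + a%:R + l%:R - 1 - i%:R).
Definition lnum (N l s : nat) (x : rat) : rat :=
  \prod_(b < N) (x + s%:R - l%:R + 1 + b%:R).
Definition rnum (N l a s : nat) (x : rat) : rat :=
  \prod_(b < N | b != a :> nat) (s%:R - l%:R - x - b%:R).
Definition lden (N a : nat) (x : rat) : rat :=
  \prod_(b < N) (2 * x + 1 + a%:R + b%:R).
Definition rden (N a : nat) : rat := \prod_(b < N | b != a :> nat) (a%:R - b%:R).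

Definition rho_term (N l a s : nat) (x : rat) : rat :=
  (-1) ^+ s * 'C(2 * l, s)%:R / ((2 * l).-1`!%:R * rden N a) *
  (qnum l a x * lnum N l s x * rnum N l a s x * (lden N a x)^-1).

Definition rho (N l : nat) (x : rat) : rat :=
  \sum_(a < N) \sum_(s < (2 * l).+1) rho_term N l a s x.

(** Most nonvanishing conditions below concern rationals that differ by an integer; this moves them
    to [nat], where [lia] applies. *)
Lemma natr_neq (i j : nat) (y z : rat) :
  y - z = i%:R - j%:R -> i != j -> y != z.
Proof.
move=> h; apply: contra => /eqP yz; rewrite -(eqr_nat rat).
by rewrite -subr_eq0 -h yz subrr.
Qed.

Lemma rden_neq0 N a : rden N a != 0.
Proof.
apply/prodf_neq0 => b; rewrite eq_sym => ba.
by apply: (@natr_neq a b) => //; rewrite subr0.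
Qed.

Lemma almost_lden_neq0 N a : almost (fun x => lden N a x != 0).
Proof.
apply: almost_prod_neq0 => b _.
apply: almost_mono (@almost_lin_neq0 2 (1 + a%:R + b%:R) _) => //.
by move=> x; rewrite !addrA.
Qed.

Section Orders.
Variables (N l e : nat).
Let me : rat := - e%:R.

(** In this and the next three lemmas at most one linear factor vanishes at [- e], and the boolean
    says that its index lies in the range of the product. Here the index is [a + l - 1 - e]. Only
    the order matters, so [v] is left unspecified. *)
Lemma rord_qnum a : exists v,
  rord me (qnum l a) ((e < a + l)%N && (a < e + l)%N : nat)%:Z v.
Proof.
have lin (i : 'I_(2 * l).-1) : linear_fun (fun x => x + a%:R + l%:R - 1 - i%:R).
  by exists 1, (a%:R + l%:R - 1 - i%:R) => x; ring.
have [/andP[h1 h2]|_] := boolP (_ && _); last first.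
  by eexists; apply: rord_prod_lin.
have hi : (a + l - 1 - e < (2 * l).-1)%N by lia.
eexists; apply: (rord_prod_lin1 (j := Ordinal hi) (a := 1)) => // x /=.
by rewrite /me -subnDA natrB ?natrD; [ring|lia].
Qed.

Lemma rord_lnum s : (e + l <= N)%N -> exists v,
  rord me (lnum N l s) ((s < e + l)%N : nat)%:Z v.
Proof.
move=> elN.
have lin (b : 'I_N) : linear_fun (fun x => x + s%:R - l%:R + 1 + b%:R).
  by exists 1, (s%:R - l%:R + 1 + b%:R) => x; ring.
have [h|_] := boolP (_ < _)%N; last by eexists; apply: rord_prod_lin.
have hi : (e + l - (1 + s) < N)%N by lia.
eexists; apply: (rord_prod_lin1 (j := Ordinal hi) (a := 1)) => // x /=.
by rewrite /me natrB ?natrD; [ring|lia].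
Qed.

Lemma rord_rnum a s : exists v, rord me (rnum N l a s)
  ([&& l <= s + e, s + e - l < N & a != s + e - l]%N : nat)%:Z v.
Proof.
have lin (b : 'I_N) : (b != a :> nat) -> linear_fun (fun x => s%:R - l%:R - x - b%:R).
  by exists (-1), (s%:R - l%:R - b%:R) => x; ring.
have [/and3P[h1 h2 h3]|_] := boolP [&& _, _ & _]; last first.
  by eexists; apply: rord_prod_lin.
eexists; apply: (rord_prod_lin1 (j := Ordinal h2) (a := -1)) => // [|x] /=.
  by rewrite eq_sym.
by rewrite /me natrB ?natrD; [ring|lia].
Qed.

Lemma rord_lden a : (2 * e <= N)%N -> exists v,
  rord me (fun x => (lden N a x)^-1) (- ((a < 2 * e)%N : nat)%:Z) v.
Proof.
move=> eN.
have lin (b : 'I_N) : linear_fun (fun x => 2 * x + 1 + a%:R + b%:R).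
  by exists 2, (1 + a%:R + b%:R) => x; ring.
have nz (b : 'I_N) : (1 + a + b != 2 * e)%N -> 2 * me + 1 + a%:R + b%:R != 0.
  move=> h; apply: (@natr_neq (1 + a + b) (2 * e)) => //.
  by rewrite /me natrM !natrD; ring.
have [h|h] := boolP (_ < _)%N.
  have hi : (2 * e - (1 + a) < N)%N by lia.
  have /rordV : rord me (lden N a) 1
    (2 * \prod_(b < N | b != Ordinal hi) (2 * me + 1 + a%:R + b%:R)).
    apply: (rord_prod_lin1 (j := Ordinal hi) (a := 2)) => // x /=.
    by rewrite /me natrB ?natrM ?natrD; [ring|lia].
  move=> /(_ _ (almost_lden_neq0 N a)) H; eexists; apply: H.
  rewrite mulf_neq0 //; apply/prodf_neq0 => b bi; apply: nz.
  by apply: contra bi => /eqP hb; rewrite -val_eqE /=; lia.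
have /rordV : rord me (lden N a) 0 (\prod_(b < N) (2 * me + 1 + a%:R + b%:R)).
  exact: rord_prod_lin.
move=> /(_ _ (almost_lden_neq0 N a)) H; eexists; apply: H.
by apply/prodf_neq0 => b _; apply: nz; lia.
Qed.

Lemma rord_term a s : (e + l <= N)%N -> (2 * e <= N)%N -> exists v,
  rord me (rho_term N l a s)
    (((e < a + l)%N && (a < e + l)%N : nat)%:Z + ((s < e + l)%N : nat)%:Z
     + ([&& l <= s + e, s + e - l < N & a != s + e - l]%N : nat)%:Z
     - ((a < 2 * e)%N : nat)%:Z) v.
Proof.
move=> elN eN.
have [v1 h1] := rord_qnum a; have [v2 h2] := rord_lnum s elN.
have [v3 h3] := rord_rnum a s; have [v4 h4] := rord_lden a eN.
have hc := (rord0 me (fun=> (-1) ^+ s * 'C(2 * l, s)%:R /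
                        ((2 * l).-1`!%:R * rden N a)) _).2 (rlim_cst _ _).
have H := rordM hc (rordM (rordM (rordM h1 h2) h3) h4).
by rewrite add0r in H; eexists; apply: H.
Qed.

(** Booleans are read as orders: the pole of the inverse of [lden] stands on the left, the zeros of
    [2 x + N], [qnum], [lnum] and [rnum] on the right. More zeros than poles force the limit
    zero. *)
Lemma rlim_term_eq0 a s : (e + l <= N)%N -> (2 * e <= N)%N ->
  ((a < 2 * e) < (2 * e == N) + ((e < a + l) && (a < e + l))
    + (s < e + l) + [&& l <= s + e, s + e - l < N & a != s + e - l])%N ->
  rlim (fun x => (2 * x + N%:R) * rho_term N l a s x) me 0.
Proof.
move=> elN eN h; have [v hv] := rord_term a s elN eN.
have [w hw] : exists w, rord me (fun x => 2 * x + N%:R) ((2 * e == N)%N : nat)%:Z w.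
  have [<-|_] := eqVneq.
    exists 2; apply: rlim_almost (rlim_cst _ 2).
    apply: almost_mono (almost_neq me) => x; rewrite -addr_eq0 => xe.
    by rewrite expr1z natrM -mulrDr /me opprK mulfK //; rewrite opprK in xe.
  by eexists; apply/rord0; apply: (@rlim_lin _ _ 2 N%:R).
by apply: rord_gt0 (rordM hw hv); lia.
Qed.

End Orders.

Lemma prod_natr_fact n : \prod_(i < n) (i.+1%:R : rat) = n`!%:R.
Proof.
by elim: n => [|n IH]; rewrite ?big_ord0 // big_ord_recr /= IH factS natrM mulrC.
Qed.

Lemma prod_oppr_fact n : \prod_(i < n) (- i.+1%:R : rat) = (-1) ^+ n * n`!%:R.
Proof. by rewrite prodrN prod_natr_fact card_ord. Qed.

Lemma prod_rev_fact n : \prod_(i < n) (n%:R - i%:R : rat) = n`!%:R.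
Proof.
rewrite -prod_natr_fact (reindex_inj rev_ord_inj) /=; apply: eq_bigr => i _.
by rewrite -natrB ?leq_subr //; congr _%:R; have := ltn_ord i; lia.
Qed.

(** The factors with [b < k] give [(-1)^k k!] and those with [b > k] give [(N - k - 1)!]. Leading
    coefficients of products with one vanishing factor are computed from this. *)
Lemma prod_skip (N k : nat) : (k < N)%N ->
  \prod_(b < N | b != k :> nat) (b%:R - k%:R : rat) =
  (-1) ^+ k * k`!%:R * (N - k.+1)`!%:R.
Proof.
move=> kN; rewrite -(big_mkord (fun b => b != k) (fun b => b%:R - k%:R : rat)).
rewrite (big_cat_nat _ (n := k)) ?(ltnW kN) //= [X in _ * X]big_ltn_cond // eqxx /=.
congr (_ * _).
  rewrite big_nat_cond (eq_bigl (fun b => (0 <= b < k)%N)) => [|b]; last by lia.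
  rewrite -big_nat big_mkord (reindex_inj rev_ord_inj) /= -prod_oppr_fact.
  by apply: eq_bigr => i _; have := ltn_ord i => ik; rewrite natrB // addrAC subrr add0r.
rewrite big_nat_cond (eq_bigl (fun b => (k.+1 <= b < N)%N)) => [|b]; last by lia.
rewrite -big_nat -{1}[k.+1]add0n big_addn big_mkord -prod_natr_fact.
by apply: eq_bigr => i _; rewrite -natrB; [congr _%:R; lia|lia].
Qed.

Lemma sum_delta2 (A B a b : nat) (v : rat) : (a < A)%N -> (b < B)%N ->
  \sum_(i < A) \sum_(j < B) ((i == a :> nat) && (j == b :> nat))%:R * v = v.
Proof.
move=> aA bB; rewrite (bigD1 (Ordinal aA)) //= (bigD1 (Ordinal bB)) //= !eqxx mul1r.
rewrite !big1 ?addr0 // => i.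
  move=> ia; apply: big1 => j _.
  have -> : (i == a :> nat) = false by apply: negbTE; apply: contra ia => /eqP h; apply/eqP/val_inj.
  by rewrite mul0r.
move=> ib; have -> : (i == b :> nat) = false by apply: negbTE; apply: contra ib => /eqP h; apply/eqP/val_inj.
by rewrite mul0r.
Qed.

Lemma rlim_qnum (c : rat) l a : rlim (qnum l a) c (qnum l a c).
Proof.
apply: rlim_prod => i _; apply: linear_rlim.
by exists 1, (a%:R + l%:R - 1 - i%:R) => x; ring.
Qed.

Lemma rlim_rnum (c : rat) N l a s : rlim (rnum N l a s) c (rnum N l a s c).
Proof.
apply: rlim_prod => b _; apply: linear_rlim.
by exists (-1), (s%:R - l%:R - b%:R) => x; ring.
Qed.

Lemma rlim_lden (c : rat) N a : rlim (lden N a) c (lden N a c).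
Proof.
apply: rlim_prod => b _; apply: linear_rlim.
by exists 2, (1 + a%:R + b%:R) => x; ring.
Qed.

Lemma rlim_lnum (c : rat) N l s : rlim (lnum N l s) c (lnum N l s c).
Proof.
apply: rlim_prod => b _; apply: linear_rlim.
by exists 1, (s%:R - l%:R + 1 + b%:R) => x; ring.
Qed.

Section Values.
Variables (N l e : nat).
Let me : rat := - e%:R.

(** [lnum] and [lden] stay together, because a zero of [lden] may be cancelled by one of [lnum]. *)
Lemma rlim_term a s (w1 w2 w3 : rat) :
  rlim (qnum l a) me w1 -> rlim (fun x => lnum N l s x / lden N a x) me w2 ->
  rlim (rnum N l a s) me w3 ->
  rlim (rho_term N l a s) me
    ((-1) ^+ s * 'C(2 * l, s)%:R / ((2 * l).-1`!%:R * rden N a) * (w1 * w3 * w2)).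
Proof.
move=> h1 h2 h3; apply: rlimM; first exact: rlim_cst.
apply: rlim_almost (rlimM (rlimM h1 h3) h2); apply: almost_all => x; ring.
Qed.

Lemma lden_factor_neq0 a b : (1 + a + b != 2 * e)%N -> 2 * me + 1 + a%:R + b%:R != 0.
Proof.
move=> h; apply: (@natr_neq (1 + a + b) (2 * e)) => //.
by rewrite /me natrM !natrD; ring.
Qed.

(** Numerator and denominator vanish at [- e] through the factor of the same index [b0], with slopes
    [1] and [2]; the ratio of the slopes is the source of every [1/2] below. *)
Lemma rlim_lnum_lden a s (b0 : 'I_N) (w : rat) :
  (s + b0 + 1 = e + l)%N -> (a + b0 + 1 = 2 * e)%N ->
  w = (\prod_(b < N | b != b0) (me + s%:R - l%:R + 1 + b%:R))
      / (2 * \prod_(b < N | b != b0) (2 * me + 1 + a%:R + b%:R)) ->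
  rlim (fun x => lnum N l s x / lden N a x) me w.
Proof.
move=> h1 h2 ->.
have E1 : s%:R + b0%:R + 1 = e%:R + l%:R :> rat by rewrite -[RHS]natrD -h1 !natrD.
have E2 : a%:R + b0%:R + 1 = 2 * e%:R :> rat by rewrite -natrM -h2 !natrD.
have H1 : rord me (lnum N l s) 1
    (1 * \prod_(b < N | b != b0) (me + s%:R - l%:R + 1 + b%:R)).
  apply: (rord_prod_lin1 (j := b0) (a := 1)) => // [b|x].
    by exists 1, (s%:R - l%:R + 1 + b%:R) => x; ring.
  by rewrite /me; lra.
have H2 : rord me (lden N a) 1
    (2 * \prod_(b < N | b != b0) (2 * me + 1 + a%:R + b%:R)).
  apply: (rord_prod_lin1 (j := b0) (a := 2)) => // [b|x].
    by exists 2, (1 + a%:R + b%:R) => x; ring.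
  by rewrite /me; lra.
have nz : 2 * \prod_(b < N | b != b0) (2 * me + 1 + a%:R + b%:R) != 0.
  rewrite mulf_neq0 //; apply/prodf_neq0 => b bi; apply: lden_factor_neq0.
  by apply: contra bi => /eqP hb; rewrite -val_eqE /=; lia.
rewrite mul1r in H1; have := rordM H1 (rordV nz (almost_lden_neq0 N a) H2).
by rewrite subrr => H; apply/rord0.
Qed.

(* The term in which the evaluation point of the difference operator
   collides with the interpolation node. *)
Lemma rlim_term_direct a s : (e + l <= N)%N -> (2 * e <= N)%N -> (a < N)%N ->
  (a + l = s + e)%N ->
  rlim (rho_term N l a s) me
    ((-1) ^+ s * 'C(2 * l, s)%:R *
     (\prod_(i < (2 * l).-1) (s%:R - 1 - i%:R)) / (2 * l).-1`!%:R *
     (if (s < e + l)%N then 2^-1 else 1)).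
Proof.
move=> elN eN aN alse.
have E : a%:R + l%:R = s%:R + e%:R :> rat by rewrite -!natrD alse.
have H2 : rlim (fun x => lnum N l s x / lden N a x) me (if (s < e + l)%N then 2^-1 else 1).
  (* By [a + l = s + e] the factors of [lnum] and [lden] agree one by one at [- e], so the quotient
     is [1], or [1/2] if a common factor vanishes. *)
  case: ifP => h.
    have hb : (e + l - (1 + s) < N)%N by lia.
    apply: (@rlim_lnum_lden a s (Ordinal hb)) => /=; [lia|lia|].
    have -> : \prod_(b < N | b != Ordinal hb) (me + s%:R - l%:R + 1 + b%:R) =
              \prod_(b < N | b != Ordinal hb) (2 * me + 1 + a%:R + b%:R).
      by apply: eq_bigr => b _; rewrite /me; lra.
    rewrite invfM mulrCA divff ?mulr1 //.
    apply/prodf_neq0 => b bi; apply: lden_factor_neq0.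
    by apply: contra bi => /eqP hh; rewrite -val_eqE /=; lia.
  have nz : lden N a me != 0.
    by apply/prodf_neq0 => b _; apply: lden_factor_neq0; lia.
  have -> : 1 = lnum N l s me / lden N a me.
    rewrite -(divff nz); congr (_ / _).
    by apply: eq_bigr => b _; rewrite /me; lra.
  apply: rlimM; first exact: rlim_lnum.
  by apply: rlimV => //; [exact: almost_lden_neq0|exact: rlim_lden].
have := rlim_term (rlim_qnum me l a) H2 (rlim_rnum me N l a s).
have -> : rnum N l a s me = rden N a.
  by apply: eq_bigr => b _; rewrite /me; lra.
have -> : qnum l a me = \prod_(i < (2 * l).-1) (s%:R - 1 - i%:R).
  by apply: eq_bigr => b _; rewrite /me; lra.
set w := if _ then _ else _ => H; congr (rlim _ _ _): H.
rewrite invfM; field; rewrite rden_neq0 /=.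
by rewrite pnatr_eq0 -lt0n fact_gt0.
Qed.

Lemma rlim_term_last a : (0 < l)%N -> (e + l <= N)%N -> (2 * e <= N)%N ->
  (a < N)%N -> a = (e + l)%N ->
  rlim (rho_term N l a (2 * l)) me (if (l < e)%N then 2^-1 else 1).
Proof.
move=> l0 elN eN aN ael; have := @rlim_term_direct a (2 * l) elN eN aN.
rewrite binn exprM sqrrN !expr1n mulr1 mul1r => H.
have -> : (l < e)%N = (2 * l < e + l)%N by lia.
have {}H := H ltac:(lia).
rewrite (_ : \prod_(i < _) _ = (2 * l).-1`!%:R) in H; last first.
  rewrite -prod_rev_fact; apply: eq_bigr => i _.
  by rewrite -{1}(prednK (n := 2 * l)) ?muln_gt0 // -natr1 addrK.
by rewrite divff ?mul1r // in H; rewrite pnatr_eq0 -lt0n fact_gt0.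
Qed.

Lemma rlim_term_first a : (0 < l)%N -> (e + l <= N)%N -> (2 * e <= N)%N ->
  (a < N)%N -> (a + l = e)%N ->
  rlim (rho_term N l a 0) me (- 2^-1).
Proof.
move=> l0 elN eN aN ael; have := @rlim_term_direct a 0 elN eN aN ael.
rewrite bin0 expr0 !mul1r addn_gt0 l0 orbT /=.
rewrite (_ : \prod_(i < _) _ = - (2 * l).-1`!%:R); last first.
  have -> : - (2 * l).-1`!%:R = (-1) ^+ (2 * l).-1 * (2 * l).-1`!%:R :> rat.
    by case: l l0 => // k _; rewrite mulnS /= exprS exprM sqrrN !expr1n mulr1 mulN1r.
  rewrite -prod_oppr_fact; apply: eq_bigr => i _.
  by rewrite sub0r -opprD nat1r.
by rewrite mulNr divff ?mulN1r // pnatr_eq0 -lt0n fact_gt0.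
Qed.

End Values.

Lemma fact_neq0 n : n`!%:R != 0 :> rat.
Proof. by rewrite pnatr_eq0 -lt0n fact_gt0. Qed.

Lemma fact_predn n : (0 < n)%N -> n`!%:R = n%:R * n.-1`!%:R :> rat.
Proof. by case: n => // n _; rewrite factS natrM. Qed.

Lemma rdenE (N k : nat) : (k < N)%N ->
  rden N k = (-1) ^+ N.-1 * (-1) ^+ k * k`!%:R * (N - k.+1)`!%:R.
Proof.
move=> kN; rewrite -!mulrA [_ ^+ k * _]mulrA -prod_skip //.
rewrite /rden (eq_bigr (fun b : 'I_N => - (b%:R - k%:R))) => [|b _]; last by rewrite opprB.
rewrite prodrN; congr (_ ^+ _ * _).
by rewrite -[in RHS](card_ord N) -(cardC1 (Ordinal kN)); apply: eq_card => b.
Qed.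

Lemma sign_double k : (-1) ^+ (2 * k) = 1 :> rat.
Proof. by rewrite exprM sqrrN !expr1n. Qed.

Lemma qnum_0_opp l : (0 < l)%N -> qnum l 0 (- l%:R) = - (2 * l).-1`!%:R.
Proof.
move=> l0.
have -> : - (2 * l).-1`!%:R = (-1) ^+ (2 * l).-1 * (2 * l).-1`!%:R :> rat.
  by case: l l0 => // k _; rewrite mulnS /= exprS sign_double mulr1 mulN1r.
rewrite -prod_oppr_fact; apply: eq_bigr => i _.
by rewrite -nat1r; ring.
Qed.

Lemma lnum_2l_opp N l : lnum N l (2 * l) (- l%:R) = N`!%:R.
Proof.
rewrite -prod_natr_fact; apply: eq_bigr => i _.
by rewrite -nat1r natrM; ring.
Qed.

Lemma rord_lden_0 N l : (0 < l)%N -> (2 * l <= N)%N ->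
  rord (- l%:R) (fun x => (lden N 0 x)^-1) (-1)
    (2 * - ((2 * l).-1`!%:R * (N - 2 * l)`!%:R))^-1.
Proof.
move=> l0 lN; apply: rordV; last 2 first.
- exact: almost_lden_neq0.
- have hb : ((2 * l).-1 < N)%N by lia.
  have -> : - ((2 * l).-1`!%:R * (N - 2 * l)`!%:R) =
            \prod_(b < N | b != Ordinal hb) (2 * - l%:R + 1 + 0%:R + b%:R) :> rat.
    transitivity ((-1) ^+ (2 * l).-1 * (2 * l).-1`!%:R * (N - (2 * l).-1.+1)`!%:R : rat).
      rewrite prednK ?muln_gt0 // -mulNr; congr (_ * _).
      by case: l l0 {lN hb} => // k _; rewrite mulnS /= exprS sign_double mulr1 mulN1r.
    rewrite -prod_skip //; apply: eq_bigr => b _.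
    have -> : ((2 * l).-1%:R = 2 * l%:R - 1 :> rat).
      by rewrite -natrM -{2}(prednK (n := 2 * l)) ?muln_gt0 // -natr1 addrK.
    by ring.
  apply: (rord_prod_lin1 (j := Ordinal hb) (a := 2)) => // [b|x] /=.
    by exists 2, (1 + 0%:R + b%:R) => x; ring.
  have -> : ((2 * l).-1%:R = 2 * l%:R - 1 :> rat).
    by rewrite -natrM -{2}(prednK (n := 2 * l)) ?muln_gt0 // -natr1 addrK.
  by ring.
by rewrite mulf_neq0 // oppr_eq0 mulf_neq0 ?fact_neq0.
Qed.

(** At [e = l] the term [a = 0], [s = 2 l] survives without a collision of node and evaluation
    point: the zero of [rnum] at the index [2 l] cancels the pole coming from [lden]. *)
Lemma rlim_term_critical N l : (0 < l)%N -> (2 * l < N)%N ->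
  rlim (rho_term N l 0 (2 * l)) (- l%:R) (- N%:R / (2 * (N%:R - 2 * l%:R))).
Proof.
move=> l0 lN; have lN' := ltnW lN.
have H3 : rord (- l%:R) (rnum N l 0 (2 * l)) 1 (- rden N (2 * l) / (2 * l)%:R).
  have -> : - rden N (2 * l) / (2 * l)%:R =
    -1 * \prod_(b < N | (b != 0%N :> nat) && (b != Ordinal lN))
           ((2 * l)%:R - l%:R - (- l%:R) - b%:R).
    have h0 : (0 < N)%N by lia.
    rewrite /rden (bigD1 (Ordinal h0)) /=; last by lia.
    rewrite subr0.
    have nz : (2 * l)%:R != 0 :> rat by rewrite pnatr_eq0; lia.
    rewrite mulN1r mulNr; congr (- _). rewrite /= mulrAC mulfV // mul1r.
    apply: eq_big => b; first by rewrite andbC -!val_eqE.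
    by move=> _; ring.
  apply: (rord_prod_lin1 (j := Ordinal lN) (a := -1)) => [b _||x] /=.
  - by exists (-1), ((2 * l)%:R - l%:R - b%:R) => x; ring.
  - by lia.
  - by rewrite natrM; ring.
have H1 := (rord0 _ _ _).2 (rlim_qnum (- l%:R) l 0).
have H2 := (rord0 _ _ _).2 (rlim_lnum (- l%:R) N l (2 * l)).
have := rordM (rordM (rordM H1 H2) H3) (rord_lden_0 l0 lN').
rewrite qnum_0_opp // lnum_2l_opp => /rord0 H.
have := rlimM (rlim_cst _ ((-1) ^+ (2 * l) * 'C(2 * l, 2 * l)%:R /
                          ((2 * l).-1`!%:R * rden N 0))) H.
congr (rlim _ _ _).
rewrite binn sign_double !rdenE ?sign_double //; last by lia.
rewrite expr0 subn1 (fact_predn (n := 2 * l)) ?muln_gt0 // (fact_predn (n := N)); last by lia.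
rewrite (fact_predn (n := N - 2 * l)); last by lia.
rewrite -subnS fact0 natrB // natrM; field.
rewrite !fact_neq0 !pnatr_eq0 -!natrM -?natrB // ?subr_eq0 ?signr_eq0 /=.
by rewrite pnatr_eq0; lia.
Qed.

(** For [N = 2 l] the index [2 l] is out of the range of [rnum], so nothing inside the term cancels
    the pole; the factor [2 x + N] does. *)
Lemma rlim_term_middle l : (0 < l)%N ->
  rlim (fun x => (2 * x + (2 * l)%:R) * rho_term (2 * l) l 0 (2 * l) x)
    (- l%:R) (- (2 * l)%:R).
Proof.
move=> l0; have l20 : (0 < 2 * l)%N by lia.
have H0 : rord (- l%:R) (fun x : rat => 2 * x + (2 * l)%:R) 1 2.
  apply: rlim_almost (rlim_cst _ 2); apply: almost_mono (almost_neq (- l%:R)) => x xl.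
  by rewrite expr1z natrM -mulrDr opprK mulfK // addr_eq0.
have H3 := (rord0 _ _ _).2 (rlim_rnum (- l%:R) (2 * l) l 0 (2 * l)).
have H1 := (rord0 _ _ _).2 (rlim_qnum (- l%:R) l 0).
have H2 := (rord0 _ _ _).2 (rlim_lnum (- l%:R) (2 * l) l (2 * l)).
have := rordM H0 (rordM (rordM (rordM H1 H2) H3) (rord_lden_0 l0 (leqnn _))).
rewrite qnum_0_opp // lnum_2l_opp => /rord0 H.
have := rlimM (rlim_cst _ ((-1) ^+ (2 * l) * 'C(2 * l, 2 * l)%:R /
                          ((2 * l).-1`!%:R * rden (2 * l) 0))) H.
have -> : rnum (2 * l) l 0 (2 * l) (- l%:R) = (2 * l).-1`!%:R.
  apply: (@mulfI _ (2 * l)%:R); first by rewrite pnatr_eq0; lia.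
  rewrite -fact_predn // -prod_rev_fact (bigD1 (Ordinal l20)) //= subr0; congr (_ * _).
  by apply: eq_big => b // _; rewrite natrM; ring.
move=> {}H; have {}H := rlim_almost (f' := fun x => (2 * x + (2 * l)%:R) * rho_term (2 * l) l 0 (2 * l) x) (almost_all _) H.
have := H ltac:(by move=> x; rewrite /rho_term; ring).
congr (rlim _ _ _).
rewrite binn sign_double !rdenE //.
have -> : (-1) ^+ (2 * l).-1 = -1 :> rat.
  by case: l l0 {l20 H0 H1 H2 H3 H} => // k _; rewrite mulnS /= exprS sign_double mulr1.
rewrite expr0 subn1 subnn fact0 (fact_predn l20); field.
by rewrite !fact_neq0.
Qed.

(** For [2 e < N], division by the value [N - 2 e] of [2 x + N] shows that [rho] itself tends to [1]
    if [e < l] and to [0] if [e > l]. *)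
Definition rho_limit (N l e : nat) : rat :=
  if (e < l)%N then N%:R - 2 * e%:R
  else if e == l then (if N == (2 * l)%N then - (2 * l)%:R else - l%:R) else 0.

(** For [e + l < N] the terms [(a, s)] that survive are [(e + l, 2 l)], also [(e - l, 0)] if
    [e >= l], and also [(0, 2 l)] if [e = l]. For [e > l] the two contributions [1/2] and [- 1/2]
    cancel; for [e = l] the three contributions, multiplied by [N - 2 l], add up to [- l]. *)
Lemma rlim_rho N l e : (0 < l)%N -> (2 * l <= N)%N -> (2 * e <= N)%N ->
  rlim (fun x => (2 * x + N%:R) * rho N l x) (- e%:R) (rho_limit N l e).
Proof.
move=> l0 lN eN.
have linN : rlim (fun x : rat => 2 * x + N%:R) (- e%:R) (N%:R - 2 * e%:R).
  have -> : N%:R - 2 * e%:R = 2 * - e%:R + N%:R :> rat by ring.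
  by apply: (@rlim_lin _ (fun x : rat => 2 * x + N%:R) 2 N%:R).
suff reduce (w : nat -> nat -> rat) :
    (forall a s, (a < N)%N -> (s <= 2 * l)%N ->
       rlim (fun x => (2 * x + N%:R) * rho_term N l a s x) (- e%:R) (w a s)) ->
    rlim (fun x => (2 * x + N%:R) * rho N l x) (- e%:R)
         (\sum_(a < N) \sum_(s < (2 * l).+1) w a s).
  (* Under [2 l <= N] and [2 e <= N] the only case left out is [N = 2 l = 2 e]. *)
  have generic : (e + l < N)%N ->
      rlim (fun x => (2 * x + N%:R) * rho N l x) (- e%:R) (rho_limit N l e).
    move=> elN; have elN' := ltnW elN.
    have [el|le|el] := ltngtP e l.
    - have -> : rho_limit N l e =
          \sum_(a < N) \sum_(s < (2 * l).+1)
            ((a == (e + l)%N :> nat) && (s == (2 * l)%N :> nat))%:R * (N%:R - 2 * e%:R).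
        by rewrite sum_delta2 ?/rho_limit ?el.
      apply: (reduce (fun a s => ((a == (e + l)%N) && (s == (2 * l)%N))%:R * _)) => a s aN sl.
      have [/andP[/eqP ae /eqP->]|h] := boolP (_ && _).
        rewrite mul1r -[X in rlim _ _ X]mulr1; apply: rlimM => //.
        have := rlim_term_last l0 elN' eN aN ae.
        by have -> : (l < e)%N = false by lia.
      by rewrite mul0r; apply: rlim_term_eq0; lia.
    - have -> : rho_limit N l e =
          \sum_(a < N) \sum_(s < (2 * l).+1)
            (((a == (e + l)%N :> nat) && (s == (2 * l)%N :> nat))%:R
                * ((N%:R - 2 * e%:R) * (2^-1))
             + ((a == (e - l)%N :> nat) && (s == 0%N :> nat))%:R
                * ((N%:R - 2 * e%:R) * (- 2^-1))).
        under eq_bigr do rewrite big_split /=.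
        rewrite big_split /= !sum_delta2 // ?/rho_limit; last by lia.
        have [-> ->] : (e < l)%N = false /\ (e == l) = false by split; lia.
        by ring.
      apply: (reduce (fun a s => ((a == (e + l)%N) && (s == (2 * l)%N))%:R * _ +
                                 ((a == (e - l)%N) && (s == 0%N))%:R * _)) => a s aN sl.
      have [/andP[/eqP ae /eqP->]|h] := boolP (_ && _).
        have -> : (2 * l == 0)%N = false by lia.
        rewrite andbF mul0r addr0 mul1r; apply: rlimM => //.
        by have := rlim_term_last l0 elN' eN aN ae; rewrite le.
      have [/andP[/eqP ae /eqP->]|h'] := boolP (_ && _).
        rewrite mul0r add0r mul1r; apply: rlimM => //.
        by apply: rlim_term_first => //; lia.
      by rewrite !mul0r addr0; apply: rlim_term_eq0; lia.
    - subst e; have h2 : (2 * l < N)%N by lia.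
      have Nl0 : N%:R - 2 * l%:R != 0 :> rat.
        by apply: (@natr_neq N (2 * l)); [rewrite natrM subr0|lia].
      have -> : rho_limit N l l =
          \sum_(a < N) \sum_(s < (2 * l).+1)
            (((a == (l + l)%N :> nat) && (s == (2 * l)%N :> nat))%:R
                * ((N%:R - 2 * l%:R) * 1)
             + (((a == 0%N :> nat) && (s == (2 * l)%N :> nat))%:R
                * ((N%:R - 2 * l%:R) * (- N%:R / (2 * (N%:R - 2 * l%:R))))
             + ((a == 0%N :> nat) && (s == 0%N :> nat))%:R
                * ((N%:R - 2 * l%:R) * (- 2^-1)))).
        under eq_bigr do rewrite !big_split /=.
        have N0 : (0 < N)%N by lia.
        rewrite !big_split /= !sum_delta2 // /rho_limit.
        rewrite ltnn eqxx; have -> : (N == 2 * l)%N = false by lia.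
        by field.
      apply: (reduce (fun a s =>
        ((a == (l + l)%N) && (s == (2 * l)%N))%:R * ((N%:R - 2 * l%:R) * 1)
        + (((a == 0%N) && (s == (2 * l)%N))%:R
             * ((N%:R - 2 * l%:R) * (- N%:R / (2 * (N%:R - 2 * l%:R))))
           + ((a == 0%N) && (s == 0%N))%:R
             * ((N%:R - 2 * l%:R) * (- 2^-1))))) => a s aN sl.
      have [/andP[/eqP ae /eqP->]|h] := boolP (_ && _).
        have -> : (a == 0)%N = false by lia.
        rewrite !mul0r !addr0 mul1r; apply: rlimM => //.
        by have := rlim_term_last l0 elN' eN aN ae; rewrite ltnn.
      have [/andP[/eqP-> /eqP->]|h'] := boolP (_ && _).
        have -> : (2 * l == 0)%N = false by lia.
        rewrite andbF !mul0r mul1r addr0 add0r; apply: rlimM => //.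
        exact: rlim_term_critical.
      have [/andP[/eqP-> /eqP->]|h''] := boolP (_ && _).
        rewrite !mul0r !add0r mul1r; apply: rlimM => //.
        by apply: rlim_term_first => //; lia.
      by rewrite !mul0r !addr0; apply: rlim_term_eq0; lia.
  have [nN|neN] := eqVneq N (2 * l)%N.
    have [el|nel] := eqVneq e l.
      subst N e.
      have -> : rho_limit (2 * l) l l =
          \sum_(a < 2 * l) \sum_(s < (2 * l).+1)
            ((a == 0%N :> nat) && (s == (2 * l)%N :> nat))%:R * - (2 * l)%:R.
        by rewrite sum_delta2 ?/rho_limit ?ltnn ?eqxx //; lia.
      apply: (reduce (fun a s => ((a == 0%N) && (s == (2 * l)%N))%:R * _)) => a s aN sl.
      have [/andP[/eqP-> /eqP->]|h] := boolP (_ && _).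
        by rewrite mul1r; exact: rlim_term_middle.
      by rewrite mul0r; apply: rlim_term_eq0; lia.
    apply: generic; lia.
  apply: generic; lia.
move=> hw; apply: rlim_almost (rlim_sum _); last first.
  by move=> a _; apply: rlim_sum => s _; apply: hw => //; rewrite -ltnS.
apply: almost_all => x; rewrite /rho mulr_sumr; apply: eq_bigr => a _.
by rewrite mulr_sumr.
Qed.

(** * The hypergeometric side *)

Lemma poch0 a : poch a 0 = 1.
Proof. by rewrite /poch big_geq. Qed.

Lemma pochS a e : poch a e.+1 = poch a e * (a + e%:R).
Proof. by rewrite /poch big_nat_recr. Qed.

Lemma pochE a e : poch a e = \prod_(i < e) (a + i%:R).
Proof. by rewrite /poch big_mkord. Qed.

Lemma pochD a j k : poch a (j + k) = poch a j * poch (a + j%:R) k.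
Proof.
elim: k => [|k IH]; first by rewrite addn0 poch0 mulr1.
by rewrite addnS !pochS IH natrD -mulrA addrA.
Qed.

Lemma poch_natS n k : poch n.+1%:R k * n`!%:R = (n + k)`!%:R.
Proof.
elim: k => [|k IH]; first by rewrite poch0 mul1r addn0.
by rewrite pochS mulrAC IH addnS factS mulrC -natrD -natrM addSn.
Qed.

(** For [e < N], multiplication by [centbin N] turns this into [C(2e, e) C(2(N-e-1), N-e-1)], which
    is the content of [halfbinE] and makes the symmetry under [e |-> N - 1 - e] visible. *)
Definition halfbin (N e : nat) : rat :=
  (-1) ^+ e * 'C(N - 1, e)%:R * poch (1 / 2) e / poch (3 / 2 - N%:R) e.

Definition sigma (N l : nat) (x : rat) : rat :=
  (2 * x + 2 * N%:R - 1) *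
    (\sum_(e < l) halfbin N e *
       ((N%:R - 2 * e%:R - 1) / ((x + e%:R) * (x + N%:R - e%:R - 1))))
  + (2 * x + 1) *
    (\sum_(e < l) halfbin N e *
       ((N%:R - 2 * e%:R - 1) / ((x + e%:R + 1) * (x + N%:R - e%:R)))).

Lemma sigmaE (N m l : nat) : sigma1 N m l = sigma N l m%:R.
Proof.
rewrite /sigma1 /sigma !big_mkord; congr (_ * _ + _ * _); apply: eq_bigr => e _;
  by rewrite /halfbin !invfM; ring.
Qed.

(** For positive [N] this is the central binomial coefficient [C(2N-2, N-1)], in the form in which
    it enters the theorem. *)
Definition centbin (N : nat) : rat := poch N%:R (N - 1) / (N - 1)`!%:R.

Lemma centbinE N : (0 < N)%N -> centbin N = (2 * (N - 1))`!%:R / (N - 1)`!%:R ^+ 2.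
Proof.
case: N => // n _; rewrite /centbin subn1 /= mul2n -addnn -poch_natS.
by field; rewrite fact_neq0.
Qed.

Lemma halfbinE N e : (e < N)%N -> halfbin N e * centbin N =
  (2 * e)`!%:R * (2 * (N - e.+1))`!%:R / (e`!%:R ^+ 2 * (N - e.+1)`!%:R ^+ 2).
Proof.
elim: e => [|e IH] eN.
  have -> : halfbin N 0 = 1 by rewrite /halfbin bin0 !poch0 expr0 !mul1r.
  by rewrite centbinE // mul1r muln0 fact0 expr1n !mul1r.
have -> : halfbin N e.+1 = halfbin N e *
    (- (N - 1 - e)%:R * (1 / 2 + e%:R) / ((e%:R + 1) * (3 / 2 - N%:R + e%:R))).
  have bE : 'C(N - 1, e.+1)%:R = (N - 1 - e)%:R * 'C(N - 1, e)%:R / (e%:R + 1) :> rat.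
    by rewrite -natrM -mul_bin_left natrM -natr1 mulrAC mulfV ?mul1r // natr1 pnatr_eq0.
  rewrite /halfbin !pochS exprS bE !invfM; ring.
rewrite mulrAC IH; last exact: ltnW.
have [k kE] : exists k, (N - e.+1 = k.+1)%N by exists (N - e.+2)%N; lia.
have -> : (N - e.+2 = k)%N by lia.
have -> : (N - 1 - e = k.+1)%N by lia.
have NE : N%:R = k%:R + e%:R + 2 :> rat by rewrite -!natrD; congr _%:R; lia.
rewrite kE !mulnS !addSn !add0n !factS !natrM -!natr1 natrM NE.
field; rewrite !fact_neq0 !natr1 !pnatr_eq0 /=.
rewrite andbT; apply: (@natr_neq 0 (2 * k + 1)); last by rewrite addn1.
by rewrite natrD natrM; ring.
Qed.

(** In partial fractions [(N-2i-1) / ((x+i)(x+N-i-1))] is [1/(x+i) - 1/(x+N-i-1)], and the second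
    sum of [sigma] has the same shape with [x + 1] for [x]. Collecting the coefficients of [1/(x+e)]
    and evaluating the linear prefactors at [- e] gives this expression. *)
Definition residue (N l e : nat) : rat :=
  (2 * N%:R - 1 - 2 * e%:R) *
    (\sum_(i < l) halfbin N i * ((i == e :> nat)%:R - (i + e + 1 == N)%N%:R))
  + (1 - 2 * e%:R) *
    (\sum_(i < l) halfbin N i * ((i.+1 == e)%N%:R - (i + e == N)%N%:R)).

Lemma rlim_simple_pole e (j : nat) (f : rat -> rat) :
  (forall x, f x = x + j%:R) ->
  rlim (fun x => (x + e%:R) / f x) (- e%:R) (j == e)%:R.
Proof.
move=> fE; have f0 : almost (fun x => f x != 0).
  apply: almost_mono (@almost_lin_neq0 1 j%:R _) => // x.
  by rewrite mul1r fE.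
have [je|je] := eqVneq j e.
  apply: rlim_almost (rlim_cst _ 1); apply: almost_mono f0 => x fx.
  by rewrite -je -fE mulfV.
have -> : false%:R = (- e%:R + e%:R) / f (- e%:R) by rewrite addNr mul0r.
apply: rlimM; first by apply: (@rlim_lin _ (fun x => x + e%:R) 1 e%:R) => x; rewrite mul1r.
apply: rlimV => //.
  by apply: (@natr_neq j e) => //; rewrite fE; ring.
by apply: (@rlim_lin _ f 1 j%:R) => x; rewrite mul1r fE.
Qed.

Lemma rord_sigma N l e : (l < N)%N ->
  rord (- e%:R) (sigma N l) (-1) (residue N l e).
Proof.
move=> lN.
have H (i j : nat) (f g : rat -> rat) (c : rat) :
    (forall x, f x = x + i%:R) -> (forall x, g x = x + j%:R) -> c = j%:R - i%:R ->
    rlim (fun x => (x + e%:R) * (c / (f x * g x))) (- e%:R) ((i == e)%:R - (j == e)%:R).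
  move=> fE gE ->.
  apply: rlim_almost (rlimB (rlim_simple_pole e fE) (rlim_simple_pole e gE)).
  have n0 k : almost (fun x => x + k%:R != 0 :> rat).
    by apply: almost_mono (@almost_lin_neq0 1 k%:R _) => // x; rewrite mul1r.
  apply: almost_mono2 (n0 i) (n0 j) => x h1 h2; rewrite fE gE; field.
  by rewrite h1 h2.
have R1 : rlim (fun x => \sum_(i < l) halfbin N i *
      ((x + e%:R) * ((N%:R - 2 * i%:R - 1) / ((x + i%:R) * (x + N%:R - i%:R - 1)))))
    (- e%:R) (\sum_(i < l) halfbin N i * ((i == e :> nat)%:R - (i + e + 1 == N)%N%:R)).
  apply: rlim_sum => i _; apply: rlimM (rlim_cst _ _) _.
  have -> : (i + e + 1 == N)%N = (N - i.+1 == e)%N by have := ltn_ord i; lia.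
  have ji : (N - i.+1)%:R = N%:R - i%:R - 1 :> rat.
    by rewrite natrB -?natr1; [ring|have := ltn_ord i; lia].
  by apply: H => // [x|]; rewrite ji; ring.
have R2 : rlim (fun x => \sum_(i < l) halfbin N i *
      ((x + e%:R) * ((N%:R - 2 * i%:R - 1) / ((x + i%:R + 1) * (x + N%:R - i%:R)))))
    (- e%:R) (\sum_(i < l) halfbin N i * ((i.+1 == e)%N%:R - (i + e == N)%N%:R)).
  apply: rlim_sum => i _; apply: rlimM (rlim_cst _ _) _.
  have -> : (i + e == N)%N = (N - i == e)%N by have := ltn_ord i; lia.
  have ji : (N - i)%:R = N%:R - i%:R :> rat.
    by rewrite natrB //; have := ltn_ord i; lia.
  by apply: H => [x|x|]; rewrite ?ji -?natr1; ring.
have L1 : rlim (fun x => 2 * x + 2 * N%:R - 1) (- e%:R) (2 * N%:R - 1 - 2 * e%:R).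
  have -> : 2 * N%:R - 1 - 2 * e%:R = 2 * (- e%:R) + 2 * N%:R - 1 :> rat by ring.
  by apply: (@rlim_lin _ (fun x => 2 * x + 2 * N%:R - 1) 2 (2 * N%:R - 1)) => x; ring.
have L2 : rlim (fun x => 2 * x + 1) (- e%:R) (1 - 2 * e%:R).
  have -> : 1 - 2 * e%:R = 2 * (- e%:R) + 1 :> rat by ring.
  by apply: (@rlim_lin _ (fun x => 2 * x + 1) 2 1) => x; ring.
apply: rlim_almost (rlimD (rlimM L1 R1) (rlimM L2 R2)).
apply: almost_all => x; rewrite /sigma opprK -invr_expz expr1z invrK [RHS]mulrDl.
by congr (_ + _); rewrite -mulrA; congr (_ * _); rewrite mulr_suml;
  apply: eq_bigr => i _; ring.
Qed.

(** A common multiple of the denominators [lden N a] for [a < N]. *)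
Definition pochden (N : nat) (x : rat) : rat := poch (2 * x + 1) (2 * N).-1.

Lemma almost_pochden_neq0 N : almost (fun x => pochden N x != 0).
Proof.
have : almost (fun x => \prod_(b < (2 * N).-1) (2 * x + 1 + b%:R) != 0).
  apply: almost_prod_neq0 => b _.
  apply: almost_mono (@almost_lin_neq0 2 (1 + b%:R) _) => // x.
  by rewrite addrA.
by apply: almost_mono => x; rewrite /pochden pochE.
Qed.

Lemma rord_poch N e : (e < N)%N ->
  rord (- e%:R) (fun x => poch x N) 1 ((-1) ^+ e * e`!%:R * (N - e.+1)`!%:R).
Proof.
move=> eN; rewrite -prod_skip // -[X in rord _ _ _ X]mul1r.
rewrite (eq_bigr (fun b : 'I_N => - e%:R + b%:R)) => [|b _]; last by rewrite addrC.
apply: (@rord_almost _ (fun x => \prod_(b < N) (x + b%:R))).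
  by apply: almost_all => x; rewrite pochE.
apply: (rord_prod_lin1 (j := Ordinal eN) (a := 1)) => // [b _|x] /=.
  by exists 1, b%:R => x; rewrite mul1r.
by rewrite mul1r opprK.
Qed.

Lemma rord_pochS N e : (0 < e <= N)%N -> rord (- e%:R) (fun x => poch (x + 1) N) 1
  ((-1) ^+ e.-1 * e.-1`!%:R * (N - e)`!%:R).
Proof.
case: e => // e /= eN; rewrite -prod_skip // -[X in rord _ _ _ X]mul1r.
rewrite (eq_bigr (fun b : 'I_N => - e.+1%:R + 1 + b%:R)) => [|b _]; last first.
  by rewrite -nat1r; ring.
apply: (@rord_almost _ (fun x => \prod_(b < N) (x + 1 + b%:R))).
  by apply: almost_all => x; rewrite pochE.
apply: (rord_prod_lin1 (j := Ordinal eN) (a := 1)) => // [b _|x] /=.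
  by exists 1, (1 + b%:R) => x; ring.
by rewrite mul1r opprK -nat1r; ring.
Qed.

Lemma rord_pochden N e : (0 < e < N)%N -> rord (- e%:R) (pochden N) 1
  (2 * (- (2 * e).-1`!%:R * (2 * (N - e)).-1`!%:R)).
Proof.
move=> eN; have hb : ((2 * e).-1 < (2 * N).-1)%N by lia.
have s1 : (-1) ^+ (2 * e).-1 = -1 :> rat.
  by case: e eN {hb} => // k _; rewrite mulnS /= exprS sign_double mulr1.
have <- : (-1) ^+ (2 * e).-1 * (2 * e).-1`!%:R * ((2 * N).-1 - (2 * e).-1.+1)`!%:R
    = - (2 * e).-1`!%:R * (2 * (N - e)).-1`!%:R :> rat.
  by rewrite s1 mulN1r; congr (_ * _`!%:R); lia.
have eE : (2 * e).-1%:R = 2 * e%:R - 1 :> rat.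
  by rewrite -natrM -[in RHS](prednK (n := 2 * e)) -?natr1 ?addrK //; lia.
rewrite -prod_skip //.
rewrite (eq_bigr (fun b : 'I_(2 * N).-1 => 2 * - e%:R + 1 + b%:R)) => [|b _]; last first.
  by rewrite eE; ring.
apply: (@rord_almost _ (fun x => \prod_(b < (2 * N).-1) (2 * x + 1 + b%:R))).
  by apply: almost_all => x; rewrite /pochden pochE.
apply: (rord_prod_lin1 (j := Ordinal hb) (a := 2)) => // [b _|x] /=.
  by exists 2, (1 + b%:R) => x; ring.
by rewrite eE opprK; ring.
Qed.

Lemma sum_delta (l : nat) (F : nat -> rat) (P : nat -> bool) (e : nat) :
  (forall i, (i < l)%N -> P i = (i == e)) ->
  \sum_(i < l) F i * (P i)%:R = if (e < l)%N then F e else 0.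
Proof.
move=> PE; case: ifP => el.
  rewrite (bigD1 (Ordinal el)) //= PE // eqxx mulr1 big1 ?addr0 // => i ie.
  have -> : P i = false by rewrite PE //; apply/negbTE.
  by rewrite mulr0.
apply: big1 => i _; have := ltn_ord i => il.
by rewrite PE // (_ : (i == e :> nat) = false) ?mulr0 //; lia.
Qed.

Lemma residueE N l e : (0 < l)%N -> (2 * l <= N)%N -> (2 * e <= N)%N ->
  residue N l e =
   (2 * N%:R - 1 - 2 * e%:R) * ((if (e < l)%N then halfbin N e else 0) -
                        (if (N - e.+1 < l)%N then halfbin N (N - e.+1) else 0))
  + (1 - 2 * e%:R) * (if (0 < e <= l)%N then halfbin N e.-1 else 0).
Proof.
move=> l0 lN eN; rewrite /residue; congr (_ * _ + _ * _).
  under eq_bigr do rewrite mulrBr.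
  rewrite sumrB; congr (_ - _); first exact: (@sum_delta _ _ (fun i => i == e)).
  by apply: (@sum_delta _ _ (fun i => i + e + 1 == N)%N) => i il; lia.
under eq_bigr do rewrite mulrBr.
rewrite sumrB (@sum_delta _ _ (fun i => i + e == N)%N (N - e)); last by move=> i il; lia.
have -> : (N - e < l)%N = false by lia.
rewrite subr0; case: e eN => [|e] eN /=.
  by apply: big1 => i _; rewrite mulr0.
by rewrite (@sum_delta _ _ (fun i => i.+1 == e.+1)%N e).
Qed.

(** The claimed value of [(2 x + N) rho], multiplied by [pochden]. *)
Definition sigma_fun (N l : nat) (x : rat) : rat :=
  centbin N * (poch x N * poch (x + 1) N * sigma N l x).

(** For [e > 0] the zeros of the two Pochhammer symbols balance the pole of [sigma] and the zero of
    [pochden]. For [e = 0] only [poch x N] and [sigma] contribute orders, [1] and [-1]. The limit is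
    then a product of leading coefficients. *)
Lemma rlim_sigma N l e : (0 < l)%N -> (2 * l <= N)%N -> (2 * e <= N)%N ->
  rlim (fun x => sigma_fun N l x / pochden N x) (- e%:R) (rho_limit N l e).
Proof.
move=> l0 lN eN; have l_lt_N : (l < N)%N by lia.
have eN' : (e < N)%N by lia.
have H1 := rord_poch eN'; have H2 := rord_sigma e l_lt_N.
have H0 := (rord0 (- e%:R) _ _).2 (rlim_cst _ (centbin N)).
have [e0|e0] := posnP e.
  subst e; rewrite oppr0 in H1 H2 H0 *.
  have H3 : rord 0 (fun x => poch (x + 1) N) 0 N`!%:R.
    apply/rord0; rewrite -prod_natr_fact.
    apply: (@rlim_almost _ (fun x => \prod_(b < N) (x + 1 + b%:R))).
      by apply: almost_all => x; rewrite pochE.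
    apply: rlim_prod => b _; have := @rlim_lin 0 (fun x => x + 1 + b%:R) 1 (1 + b%:R).
    by rewrite add0r nat1r; apply=> x; ring.
  have H4 : rord 0 (fun x => (pochden N x)^-1) (- 0) ((2 * N).-1`!%:R)^-1.
    apply: rordV; [exact: fact_neq0|exact: almost_pochden_neq0|apply/rord0].
    rewrite -prod_natr_fact.
    apply: (@rlim_almost _ (fun x => \prod_(b < (2 * N).-1) (2 * x + 1 + b%:R))).
      by apply: almost_all => x; rewrite /pochden pochE.
    apply: rlim_prod => b _; have := @rlim_lin 0 (fun x => 2 * x + 1 + b%:R) 2 (1 + b%:R).
    by rewrite mulr0 add0r nat1r; apply=> x; ring.
  have /rord0 := rordM (rordM H0 (rordM (rordM H1 H3) H2)) H4.
  congr (rlim _ _ _).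
  rewrite residueE //= mulr0 subr0 l0 (_ : (N - 1 < l)%N = false); last by lia.
  have -> : halfbin N 0 = 1 by rewrite /halfbin bin0 !poch0 expr0 !mul1r.
  rewrite /rho_limit l0 mulr0 centbinE // (fact_predn (n := N)) //.
  have -> : ((2 * N).-1 = (2 * (N - 1)).+1)%N by lia.
  rewrite -subn1 factS natrM fact0 expr0.
  have -> : (2 * (N - 1)).+1%:R = 2 * N%:R - 1 :> rat.
    by rewrite -addn1 natrD natrM natrB //; ring.
  field; rewrite !fact_neq0 /=.
  have h : 2 * N%:R - 1 != 0 :> rat by apply: (@natr_neq (2 * N) 1); [rewrite natrM; ring|lia].
  by rewrite h.
have H3 : rord (- e%:R) (fun x => poch (x + 1) N) 1
    ((-1) ^+ e.-1 * e.-1`!%:R * (N - e)`!%:R).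
  by apply: rord_pochS; lia.
have H4 : rord (- e%:R) (fun x => (pochden N x)^-1) (- 1)
    (2 * (- (2 * e).-1`!%:R * (2 * (N - e)).-1`!%:R))^-1.
  apply: rordV; last by apply: rord_pochden; lia.
    by rewrite mulf_neq0 // mulf_neq0 ?oppr_eq0 ?fact_neq0.
  exact: almost_pochden_neq0.
have /rord0 := rordM (rordM H0 (rordM (rordM H1 H3) H2)) H4.
congr (rlim _ _ _).
case: e e0 eN eN' {H0 H1 H2 H3 H4} => // k _ eN eN'.
have [j NE] : exists j, N = (k + j).+2 by exists (N - k.+2)%N; lia.
have b1 := halfbinE eN'; have b2 := halfbinE (ltnW eN').
have NkE : (N - k.+2 = j)%N by lia.
have NkE' : (N - k.+1 = j.+1)%N by lia.
rewrite NkE in b1; rewrite NkE' in b2; rewrite NkE NkE'.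
(* With [e = k + 1] and [N = k + j + 2], [A] is the product of the leading coefficients of the two
   Pochhammer symbols divided by that of [pochden]. It reduces the two kinds of summands in the
   residue to [j + 1] and [k + 1], whose difference is [N - 2 e]. *)
set A := (k.+1`!%:R * j`!%:R * k`!%:R * j.+1`!%:R) /
         (2 * (2 * k).+1`!%:R * (2 * j).+1`!%:R) : rat.
have nk : 1 + k%:R != 0 :> rat by rewrite nat1r pnatr_eq0.
have nj : 1 + j%:R != 0 :> rat by rewrite nat1r pnatr_eq0.
have n2k : 1 + 2 * k%:R != 0 :> rat by rewrite -natrM nat1r pnatr_eq0.
have n2j : 1 + 2 * j%:R != 0 :> rat by rewrite -natrM nat1r pnatr_eq0.
have A1 : A * ((2 * j%:R + 1) * (halfbin N k.+1 * centbin N)) = j%:R + 1.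
  rewrite b1 /A !mulnS !addSn !add0n !factS !natrM -?[in _.+2%:R]nat1r -!nat1r !natrM.
  by field; rewrite ?fact_neq0 ?nk ?nj ?n2k ?n2j.
have A2 : A * ((2 * k%:R + 1) * (halfbin N k * centbin N)) = k%:R + 1.
  rewrite b2 /A !mulnS !addSn !add0n !factS !natrM -!nat1r !natrM.
  by field; rewrite ?fact_neq0 ?nk ?nj ?n2k ?n2j.
transitivity (A * (centbin N * residue N l k.+1)).
  have -> : ((2 * k.+1).-1 = (2 * k).+1)%N by lia.
  have -> : ((2 * j.+1).-1 = (2 * j).+1)%N by lia.
  have sk : (-1) ^+ k * (-1) ^+ k = 1 :> rat by rewrite -exprD addnn -mul2n sign_double.
  transitivity ((-1) ^+ k * (-1) ^+ k * (A * (centbin N * residue N l k.+1))).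
    by rewrite exprS /A /=; field; rewrite !fact_neq0.
  by rewrite sk mul1r.
rewrite residueE // NkE /= mulrDr mulrDr.
have -> : 2 * N%:R - 1 - 2 * k.+1%:R = 2 * j%:R + 1 :> rat.
  by rewrite NE -!natr1 natrD; ring.
have -> : 1 - 2 * k.+1%:R = - (2 * k%:R + 1) :> rat by rewrite -natr1; ring.
rewrite /rho_limit; have [kl|lk|kl] := ltngtP k.+1 l.
- have -> : (j < l)%N = false by lia.
  have -> : N%:R - 2 * k.+1%:R = j%:R + 1 - (k%:R + 1) :> rat.
    by rewrite NE -!natr1 natrD; ring.
  by rewrite -A1 -A2 subr0; ring.
- have -> : (j < l)%N = false by lia.
  by rewrite subrr; ring.
- subst l; case: (N =P (2 * k.+1)%N) => N2.
    have jk : j = k by lia.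
    rewrite jk ltnSn; rewrite jk in A1 A2.
    have -> : - (2 * k.+1)%:R = - (k%:R + 1) - (k%:R + 1) :> rat.
      by rewrite natrM -natr1; ring.
    by rewrite -A2; ring.
  have -> : (j < k.+1)%N = false by lia.
  have -> : k.+1%:R = k%:R + 1 :> rat by rewrite natr1.
  by rewrite -A2 subrr; ring.
Qed.

(** * Determination of the interpolation sum *)

Section Lagrange.
Variables (I : finType) (t : I -> rat).
Hypothesis t_inj : injective t.

Definition lagrange_poly (u : I -> rat) : {poly rat} :=
  \sum_i (u i / \prod_(j | j != i) (t i - t j)) *: \prod_(j | j != i) ('X - (t j)%:P).

Lemma size_lagrange_poly u : (size (lagrange_poly u) <= #|I|)%N.
Proof.
apply: (leq_trans (size_sum _ _ _)); apply/bigmax_leqP => i _.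
apply: (leq_trans (size_scale_leq _ _)).
rewrite -big_filter size_prod_XsubC size_filter -sum1_count sum1_card.
by rewrite cardC1; have := max_card (pred1 i); rewrite card1; case: #|I|.
Qed.

Lemma horner_lagrange_poly u w : (lagrange_poly u).[w] =
  \sum_i u i * \prod_(j | j != i) ((w - t j) / (t i - t j)).
Proof.
rewrite horner_sum; apply: eq_bigr => i _; rewrite hornerZ horner_prod.
have -> : \prod_(j | j != i) ('X - (t j)%:P).[w] = \prod_(j | j != i) (w - t j).
  by apply: eq_bigr => j _; rewrite hornerXsubC.
by rewrite prodf_div; ring.
Qed.

Lemma lagrange_poly_node u i : (lagrange_poly u).[t i] = u i.
Proof.
rewrite horner_lagrange_poly (bigD1 i) //= big1 ?mulr1 => [|j ji]; last first.
  by rewrite divff // subr_eq0 (inj_eq t_inj) eq_sym.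
rewrite big1 ?addr0 // => k ki; rewrite (bigD1 i) 1?eq_sym //=.
by rewrite subrr !mul0r mulr0.
Qed.

Lemma poly_eq_nodes (p q : {poly rat}) : (size p <= #|I|)%N -> (size q <= #|I|)%N ->
  (forall i, p.[t i] = q.[t i]) -> p = q.
Proof.
move=> sp sq pq; apply/eqP; rewrite -subr_eq0; apply/negPn/negP => d0.
have rt : all (root (p - q)) [seq t i | i <- enum I].
  by apply/allP => _ /mapP[i _ ->]; rewrite rootE !hornerE pq subrr.
have := max_poly_roots d0 rt; rewrite map_inj_uniq ?enum_uniq // size_map -cardE.
move=> /(_ isT); rewrite ltnNge => /negP; apply.
by rewrite (leq_trans (size_polyD _ _)) // geq_max sp size_polyN.
Qed.

Lemma lagrange_interpolation (q : {poly rat}) w : (size q <= #|I|)%N ->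
  q.[w] = \sum_i q.[t i] * \prod_(j | j != i) ((w - t j) / (t i - t j)).
Proof.
move=> sq; rewrite -(horner_lagrange_poly (fun i => q.[t i])); congr horner.
apply: poly_eq_nodes => // [|i]; first exact: size_lagrange_poly.
by rewrite lagrange_poly_node.
Qed.

End Lagrange.

Lemma dvdp_prod_coprime (n : nat) (F : nat -> {poly rat}) (p : {poly rat}) :
  (forall i j, (i < j < n)%N -> coprimep (F i) (F j)) ->
  (forall i, (i < n)%N -> F i %| p) -> \prod_(i < n) F i %| p.
Proof.
elim: n p => [|n IH] p cF dF; first by rewrite big_ord0 dvd1p.
have /dvdpP [q pE] := dF n (ltnSn n).
rewrite big_ord_recr /= pE dvdp_mul // IH // => [i j ij|i iltn].
  by apply: cF; lia.
have := dF i (ltnW iltn); rewrite pE Gauss_dvdpl //.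
by apply: cF; rewrite iltn /=.
Qed.

(** If the degree [D] exceeded [d], division by [m^(D-1)] would bound the leading coefficient times
    [m] by a constant for all large [m]. *)
Lemma poly_growth_size (p : {poly rat}) (C : rat) (M d : nat) :
  (forall m : nat, (M <= m)%N -> `|p.[m%:R]| <= C * m%:R ^+ d) ->
  (size p <= d.+1)%N.
Proof.
move=> hp; rewrite leqNgt; apply/negP => dp.
have p0 : p != 0 by rewrite -size_poly_gt0; case: (size p) dp.
set D := (size p).-1; have DE : size p = D.+1 by rewrite /D prednK // size_poly_gt0.
have dD : (d < D)%N by lia.
have C0 : 0 <= C.
  have := hp M.+1 (leqnSn M); have m0 : 0 < M.+1%:R ^+ d :> rat by rewrite exprn_gt0 ?ltr0n.
  by move=> h; rewrite -(pmulr_lge0 _ m0); apply: le_trans h.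
pose K := \sum_(i < D) `|p`_i|.
have K0 : 0 <= K by apply: sumr_ge0 => i _; apply: normr_ge0.
have bound (m : nat) : (M <= m)%N -> (0 < m)%N -> `|lead_coef p| * m%:R <= K + C.
  move=> Mm m0; have mp : 0 < m%:R :> rat by rewrite ltr0n.
  have m1 : 1 <= m%:R :> rat by rewrite ler1n.
  have pE : p.[m%:R] = (\sum_(i < D) p`_i * m%:R ^+ i) + lead_coef p * m%:R ^+ D.
    by rewrite horner_coef DE big_ord_recr /= lead_coefE DE.
  have le1 : `|\sum_(i < D) p`_i * m%:R ^+ i| <= K * m%:R ^+ D.-1.
    apply: le_trans (ler_norm_sum _ _ _) _; rewrite mulr_suml; apply: ler_sum => i _.
    rewrite normrM ler_wpM2l // ger0_norm ?exprn_ge0 ?ler0n //.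
    by apply: ler_weXn2l => //; have := ltn_ord i; lia.
  have le2 : C * m%:R ^+ d <= C * m%:R ^+ D.-1.
    by rewrite ler_wpM2l // ler_weXn2l //; lia.
  have := hp m Mm; rewrite pE => h.
  have h3 : `|lead_coef p * m%:R ^+ D| <= (K + C) * m%:R ^+ D.-1.
    rewrite mulrDl -[lead_coef p * _](addKr (\sum_(i < D) p`_i * m%:R ^+ i)).
    apply: le_trans (ler_normD _ _) _; rewrite normrN; apply: lerD => //.
    exact: le_trans h le2.
  rewrite -(ler_pM2r (exprn_gt0 D.-1 mp)) -mulrA -exprS prednK; last by lia.
  by move: h3; rewrite normrM (ger0_norm (exprn_ge0 _ (ler0n _ _))).
have l0 : 0 < `|lead_coef p| by rewrite normr_gt0 lead_coef_eq0.
have [m hm] : exists m : nat, (K + C) / `|lead_coef p| < m%:R.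
  exists (Num.bound ((K + C) / `|lead_coef p|)).
  by apply: archi_boundP; rewrite divr_ge0 // addr_ge0.
have := bound (maxn M m.+1) (leq_maxl _ _) ltac:(lia).
rewrite leNgt => /negP; apply; rewrite mulrC -ltr_pdivrMr //.
by apply: lt_le_trans hm _; rewrite ler_nat; lia.
Qed.

(** * Growth along the natural numbers *)

Definition growth (f : rat -> rat) (d : nat) :=
  exists (C : rat) (M : nat),
    forall m : nat, (M <= m)%N -> `|f m%:R| <= C * m%:R ^+ d.

Lemma growth_C0 f d : growth f d -> exists (C : rat) (M : nat), 0 <= C /\
    forall m : nat, (M <= m)%N -> `|f m%:R| <= C * m%:R ^+ d.
Proof.
move=> [C [M h]]; exists `|C|, M; split=> [|m Mm]; first exact: normr_ge0.
apply: le_trans (h m Mm) _; rewrite ler_wpM2r ?exprn_ge0 ?ler0n //.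
exact: ler_norm.
Qed.

Lemma growthM f g c d : growth f c -> growth g d ->
  growth (fun x => f x * g x) (c + d).
Proof.
move=> /growth_C0[C [M [C0 h]]] /growth_C0[D [L [D0 k]]].
exists (C * D), (maxn M L) => m; rewrite geq_max => /andP[Mm Lm].
rewrite normrM exprD mulrACA; apply: ler_pM; rewrite ?normr_ge0 //.
  exact: h.
exact: k.
Qed.

Lemma growthD f g d : growth f d -> growth g d -> growth (fun x => f x + g x) d.
Proof.
move=> [C [M h]] [D [L k]].
exists (C + D), (maxn M L) => m; rewrite geq_max => /andP[Mm Lm].
by rewrite mulrDl; apply: le_trans (ler_normD _ _) _; apply: lerD; [apply: h|apply: k].
Qed.

Lemma growth_cst (a : rat) : growth (fun=> a) 0.
Proof. by exists `|a|, 0%N => m _; rewrite mulr1. Qed.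

Lemma growth_lin (a b : rat) (f : rat -> rat) :
  (forall x, f x = a * x + b) -> growth f 1.
Proof.
move=> fE; exists (`|a| + `|b|), 1%N => m m0; rewrite fE expr1 mulrDl.
apply: le_trans (ler_normD _ _) _; apply: lerD.
  by rewrite normrM (ger0_norm (ler0n _ _)).
by rewrite ler_peMr ?normr_ge0 // ler1n.
Qed.

Lemma growth_ext f g d : (forall x, f x = g x) -> growth f d -> growth g d.
Proof. by move=> fg [C [M h]]; exists C, M => m Mm; rewrite -fg; apply: h. Qed.

Lemma growth_sum (I : finType) (F : I -> rat -> rat) d :
  (forall i, growth (F i) d) -> growth (fun x => \sum_i F i x) d.
Proof.
move=> hF.
have: growth (fun x => \sum_(i <- index_enum I) F i x) d.
  elim: (index_enum I) => [|i s IH].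
    by exists 0, 0%N => m _; rewrite big_nil normr0 mul0r.
  by apply: growth_ext (growthD (hF i) IH) => x; rewrite big_cons.
by [].
Qed.

Lemma growth_poch a b n : growth (fun x => poch (a * x + b) n) n.
Proof.
elim: n => [|n IH]; first by exists 1, 0%N => m _; rewrite poch0 normr1 mulr1.
have gl : growth (fun x => a * x + b + n%:R) 1 by apply: (@growth_lin a (b + n%:R)) => x; ring.
by rewrite -addn1; apply: growth_ext (growthM IH gl) => x; rewrite addn1 pochS.
Qed.

Lemma growth_quotient (c : rat) (f : rat -> rat) (i : nat) :
  (forall x, f x = x + i%:R) -> growth (fun x => (2 * x + c) / f x) 0.
Proof.
move=> fE; exists (2 + `|c|), 1%N => m m0; rewrite expr0 mulr1 fE.
have m1 : 1 <= m%:R :> rat by rewrite ler1n.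
have i0 : 0 <= i%:R :> rat by rewrite ler0n.
have mi : 0 < m%:R + i%:R :> rat by lra.
rewrite normrM normfV (gtr0_norm mi) ler_pdivrMr //.
apply: le_trans (ler_normD _ _) _; rewrite normrM ger0_norm // ger0_norm ?ler0n //.
have := normr_ge0 c; nra.
Qed.

Lemma growth_inv (f : rat -> rat) (i : nat) :
  (forall x, f x = x + i%:R) -> growth (fun x => (f x)^-1) 0.
Proof.
move=> fE; exists 1, 1%N => m m0; rewrite expr0 mulr1 fE.
have m1 : 1 <= m%:R :> rat by rewrite ler1n.
have i0 : 0 <= i%:R :> rat by rewrite ler0n.
have mi : 0 < m%:R + i%:R :> rat by lra.
rewrite normfV (gtr0_norm mi) invf_le1 //; lra.
Qed.

Lemma growth_sigma_fun N l : (l < N)%N -> growth (sigma_fun N l) (2 * N).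
Proof.
move=> lN; rewrite mul2n -addnn -[(N + N)%N]add0n; apply: growthM; first exact: growth_cst.
rewrite -[(N + N)%N]addn0; apply: growthM; first apply: growthM.
- by apply: growth_ext (growth_poch 1 0 N) => x; rewrite mul1r addr0.
- by apply: growth_ext (growth_poch 1 1 N) => x; rewrite mul1r.
have sgn i : (i < N)%N -> (forall x : rat, x + N%:R - i%:R - 1 = x + (N - i.+1)%:R).
  by move=> iN x; rewrite natrB // -natr1; ring.
have sgn' i : (i < N)%N -> (forall x : rat, x + N%:R - i%:R = x + (N - i)%:R).
  by move=> iN x; rewrite natrB ?(ltnW iN) //; ring.
apply: growthD.
- have H (i : 'I_l) : growth (fun x => halfbin N i * (N%:R - 2 * i%:R - 1) *
     ((2 * x + (2 * N%:R - 1)) / (x + i%:R) * (x + N%:R - i%:R - 1)^-1)) 0.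
    rewrite -[0%N]addn0; apply: growthM; first exact: growth_cst.
    rewrite -[0%N]addn0; apply: growthM; first exact: (@growth_quotient _ _ i).
    by apply: (@growth_inv _ (N - i.+1)) => x; rewrite sgn // (ltn_trans _ lN).
  apply: growth_ext (growth_sum H) => x; rewrite mulr_sumr; apply: eq_bigr => i _.
  by rewrite invfM; ring.
- have H (i : 'I_l) : growth (fun x => halfbin N i * (N%:R - 2 * i%:R - 1) *
     ((2 * x + 1) / (x + i%:R + 1) * (x + N%:R - i%:R)^-1)) 0.
    rewrite -[0%N]addn0; apply: growthM; first exact: growth_cst.
    rewrite -[0%N]addn0; apply: growthM.
      by apply: (@growth_quotient _ _ i.+1) => x; rewrite -natr1 addrA.
    by apply: (@growth_inv _ (N - i)) => x; rewrite sgn' // (ltn_trans _ lN).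
  apply: growth_ext (growth_sum H) => x; rewrite mulr_sumr; apply: eq_bigr => i _.
  by rewrite invfM; ring.
Qed.

(** * Functions that agree with a polynomial off a finite set *)

Definition polyfun (f : rat -> rat) :=
  exists p : {poly rat}, almost (fun x => f x = p.[x]).

Lemma polyfun_almost f g : almost (fun x => f x = g x) -> polyfun f -> polyfun g.
Proof.
by move=> fg [p fp]; exists p; apply: almost_mono2 fg fp => x -> <-.
Qed.

Lemma polyfunM f g : polyfun f -> polyfun g -> polyfun (fun x => f x * g x).
Proof.
move=> [p fp] [q gq]; exists (p * q); apply: almost_mono2 fp gq => x -> ->.
by rewrite hornerM.
Qed.

Lemma polyfunD f g : polyfun f -> polyfun g -> polyfun (fun x => f x + g x).
Proof.
move=> [p fp] [q gq]; exists (p + q); apply: almost_mono2 fp gq => x -> ->.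
by rewrite hornerD.
Qed.

Lemma polyfun_lin a b f : (forall x, f x = a * x + b) -> polyfun f.
Proof.
move=> fE; exists (a *: 'X + b%:P); apply: almost_all => x.
by rewrite fE hornerD hornerZ hornerX hornerC.
Qed.

Lemma polyfun_cst c : polyfun (fun=> c).
Proof. by apply: (@polyfun_lin 0 c) => x; rewrite mul0r add0r. Qed.

Lemma polyfun_sum (I : finType) (F : I -> rat -> rat) :
  (forall i, polyfun (F i)) -> polyfun (fun x => \sum_i F i x).
Proof.
move=> hF.
have: polyfun (fun x => \sum_(i <- index_enum I) F i x).
  elim: (index_enum I) => [|i s IH].
    by apply: polyfun_almost (polyfun_cst 0); apply: almost_all => x; rewrite big_nil.
  by apply: polyfun_almost (polyfunD (hF i) IH); apply: almost_all => x; rewrite big_cons.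
by [].
Qed.

Lemma polyfun_prod (I : finType) (P : pred I) (F : I -> rat -> rat) :
  (forall i, polyfun (F i)) -> polyfun (fun x => \prod_(i | P i) F i x).
Proof.
move=> hF.
have: polyfun (fun x => \prod_(i <- index_enum I | P i) F i x).
  elim: (index_enum I) => [|i s IH].
    by apply: polyfun_almost (polyfun_cst 1); apply: almost_all => x; rewrite big_nil.
  case: (boolP (P i)) => Pi.
    apply: polyfun_almost (polyfunM (hF i) IH).
    by apply: almost_all => x; rewrite big_cons Pi.
  by apply: polyfun_almost IH; apply: almost_all => x; rewrite big_cons (negbTE Pi).
by [].
Qed.

Lemma polyfun_poch a b n : polyfun (fun x => poch (a * x + b) n).
Proof.
have H (i : 'I_n) : polyfun (fun x => a * x + b + i%:R).
  by apply: (@polyfun_lin a (b + i%:R)) => x; rewrite addrA.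
by apply: polyfun_almost (polyfun_prod xpredT H); apply: almost_all => x; rewrite pochE.
Qed.

Lemma polyfun_poch_div (c : rat) (f : rat -> rat) (n i : nat) : (i < n)%N ->
  (forall x, f x = x + c + i%:R) -> polyfun (fun x => poch (x + c) n / f x).
Proof.
move=> iN fE.
have H (j : 'I_n) : polyfun (fun x => x + c + j%:R).
  by apply: (@polyfun_lin 1 (c + j%:R)) => x; ring.
apply: polyfun_almost (polyfun_prod (fun j => j != Ordinal iN) H).
apply: almost_mono (@almost_lin_neq0 1 (c + i%:R) _) => // x; rewrite mul1r addrA => h.
by rewrite fE pochE [in RHS](bigD1 (Ordinal iN)) //= mulrAC mulfV // mul1r.
Qed.

(** [pochden N] splits into runs of [a], [N] and [N - a - 1] consecutive factors, and the middle run
    is [lden N a]. *)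
Lemma polyfun_rho N l : polyfun (fun x => pochden N x * ((2 * x + N%:R) * rho N l x)).
Proof.
have T (a : 'I_N) (s : 'I_(2 * l).+1) :
    polyfun (fun x => (2 * x + N%:R) * (pochden N x * rho_term N l a s x)).
  apply: polyfunM; first exact: polyfun_lin.
  pose r := ((-1) ^+ s * 'C(2 * l, s)%:R / ((2 * l).-1`!%:R * rden N a)).
  have P1 : polyfun (qnum l a).
    apply: polyfun_prod => i; apply: (@polyfun_lin 1 (a%:R + l%:R - 1 - i%:R)) => x; ring.
  have P2 : polyfun (lnum N l s).
    apply: polyfun_prod => i; apply: (@polyfun_lin 1 (s%:R - l%:R + 1 + i%:R)) => x; ring.
  have P3 : polyfun (rnum N l a s).
    apply: polyfun_prod => i; apply: (@polyfun_lin (-1) (s%:R - l%:R - i%:R)) => x; ring.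
  have P4 := polyfunM (polyfun_poch 2 1 a)
                      (polyfun_poch 2 (1 + a%:R + N%:R) (N - a.+1)).
  apply: polyfun_almost (polyfunM (polyfun_cst r) (polyfunM (polyfunM (polyfunM P1 P2) P3) P4)).
  apply: almost_mono (almost_lden_neq0 N a) => x lx.
  have -> : pochden N x = poch (2 * x + 1) a *
      poch (2 * x + (1 + a%:R + N%:R)) (N - a.+1) * lden N a x.
    have -> : lden N a x = poch (2 * x + 1 + a%:R) N by rewrite pochE.
    rewrite mulrAC -pochD /pochden.
    have -> : ((2 * N).-1 = a + N + (N - a.+1))%N by have := ltn_ord a; lia.
    by rewrite pochD natrD !addrA.
  rewrite /rho_term -/r.
  transitivity (r * (qnum l a x * lnum N l s x * rnum N l a s x *
    (poch (2 * x + 1) a * poch (2 * x + (1 + a%:R + N%:R)) (N - a.+1)))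
     * (lden N a x / lden N a x)); first by rewrite divff // mulr1.
  by ring.
apply: polyfun_almost (polyfun_sum (fun a => polyfun_sum (T a))).
apply: almost_all => x; rewrite /rho mulrCA mulr_sumr mulr_sumr; apply: eq_bigr => a _.
by rewrite !mulr_sumr.
Qed.

(** Of the two linear factors in each denominator of [sigma], one is cancelled by [poch x N] and the
    other by [poch (x + 1) N]; [2 l <= N] keeps both indices in range. *)
Lemma polyfun_sigma_fun N l : (2 * l <= N)%N -> polyfun (sigma_fun N l).
Proof.
move=> lN; apply: polyfunM; first exact: polyfun_cst.
have S1 (i : 'I_l) : polyfun (fun x => halfbin N i * (N%:R - 2 * i%:R - 1) *
    (poch (x + 0) N / (x + i%:R) * (poch (x + 1) N / (x + N%:R - i%:R - 1)))).
  have il := ltn_ord i.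
  apply: polyfunM; first exact: polyfun_cst.
  apply: polyfunM.
    by apply: (@polyfun_poch_div _ _ _ i) => [|x]; [lia|rewrite addr0].
  apply: (@polyfun_poch_div _ _ _ (N - i.+2)) => [|x]; first by lia.
  by rewrite natrB; [rewrite -addn2 natrD; ring|lia].
have S2 (i : 'I_l) : polyfun (fun x => halfbin N i * (N%:R - 2 * i%:R - 1) *
    (poch (x + 0) N / (x + i%:R + 1) * (poch (x + 1) N / (x + N%:R - i%:R)))).
  have il := ltn_ord i.
  apply: polyfunM; first exact: polyfun_cst.
  apply: polyfunM.
    by apply: (@polyfun_poch_div _ _ _ i.+1) => [|x]; [lia|rewrite addr0 -natr1 addrA].
  apply: (@polyfun_poch_div _ _ _ (N - i.+1)) => [|x]; first by lia.
  by rewrite natrB; [rewrite -addn1 natrD; ring|lia].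
have L1 : polyfun (fun x => 2 * x + 2 * N%:R - 1).
  by apply: (@polyfun_lin 2 (2 * N%:R - 1)) => x; ring.
have L2 : polyfun (fun x => 2 * x + 1) by apply: polyfun_lin.
apply: polyfun_almost (polyfunD (polyfunM L1 (polyfun_sum S1))
                                (polyfunM L2 (polyfun_sum S2))).
apply: almost_all => x; rewrite addr0 /sigma mulrDr.
by congr (_ + _); rewrite mulrCA; congr (_ * _); rewrite mulr_sumr;
  apply: eq_bigr => i _; rewrite !invfM; ring.
Qed.

(** * Oddness of both sides under the reflection *)

Lemma pochden_reflect N x : (0 < N)%N -> pochden N (- N%:R - x) = - pochden N x.
Proof.
move=> N0; rewrite /pochden !pochE (reindex_inj rev_ord_inj) /=.
have -> : - \prod_(i < (2 * N).-1) (2 * x + 1 + i%:R) =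
    (-1) ^+ (2 * N).-1 * \prod_(i < (2 * N).-1) (2 * x + 1 + i%:R).
  by case: N N0 => // n _; rewrite mulnS /= exprS sign_double mulr1 mulN1r.
have -> : (-1) ^+ (2 * N).-1 = (-1) ^+ #|'I_(2 * N).-1| :> rat by rewrite card_ord.
rewrite -prodrN; apply: eq_bigr => i _; have := ltn_ord i => il.
rewrite (_ : ((2 * N).-1 - i.+1)%:R = 2 * N%:R - 2 - i%:R :> rat); first by ring.
rewrite (_ : ((2 * N).-1 - i.+1 = 2 * N - 2 - i)%N); last by lia.
by rewrite natrB ?natrB ?natrM //; lia.
Qed.

Lemma poch_reflect N x : poch (- N%:R - x) N = (-1) ^+ N * poch (x + 1) N.
Proof.
rewrite !pochE (reindex_inj rev_ord_inj) /= -[X in (-1) ^+ X](card_ord N) -prodrN.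
apply: eq_bigr => i _; rewrite natrB // -natr1; ring.
Qed.

Lemma sigma_fun_reflect N l x : (2 * l <= N)%N ->
  sigma_fun N l (- N%:R - x) = - sigma_fun N l x.
Proof.
move=> lN; rewrite /sigma_fun.
have -> : poch (- N%:R - x + 1) N = (-1) ^+ N * poch x N.
  have -> : - N%:R - x + 1 = - N%:R - (x - 1) by ring.
  by rewrite poch_reflect subrK.
have -> : sigma N l (- N%:R - x) = - sigma N l x.
  rewrite /sigma opprD addrC; congr (_ + _).
    rewrite -mulNr; congr (_ * _); first by ring.
    apply: eq_bigr => i _; congr (_ * (_ / _)); ring.
  rewrite -mulNr; congr (_ * _); first by ring.
  apply: eq_bigr => i _; congr (_ * (_ / _)); ring.
rewrite poch_reflect.
have s2 : (-1) ^+ N * (-1) ^+ N = 1 :> rat by rewrite -exprD addnn -mul2n sign_double.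
transitivity (- ((-1) ^+ N * (-1) ^+ N * (centbin N * (poch x N * poch (x + 1) N * sigma N l x)))).
  by ring.
by rewrite s2 mul1r.
Qed.

(** [(2l-1)!] times the binomial coefficient prescribed on the right block, as a polynomial in the
    centred position: [qnum l a x] is its value at the node [x + a]. *)
Definition qpoly (l : nat) : {poly rat} :=
  \prod_(i < (2 * l).-1) ('X - (1 + i%:R - l%:R)%:P).

Lemma size_qpoly l : (0 < l)%N -> size (qpoly l) = (2 * l)%N.
Proof.
move=> l0; rewrite size_prod_XsubC -count_predT -sum1_count sum1_card card_ord prednK //; lia.
Qed.

Lemma horner_qpoly l z : (qpoly l).[z] = \prod_(i < (2 * l).-1) (z + l%:R - 1 - i%:R).
Proof.
rewrite horner_prod; apply: eq_bigr => i _; rewrite hornerXsubC; ring.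
Qed.

(** A difference of order [2 l] annihilates polynomials of degree [2 l - 1]. Here it is immediate:
    the points [s - l] with [0 < s < 2 l] are the roots of [qpoly l], and the two end terms are
    opposite. *)
Lemma sum_qpoly l : (0 < l)%N ->
  \sum_(s < (2 * l).+1) (-1) ^+ s * 'C(2 * l, s)%:R * (qpoly l).[s%:R - l%:R] = 0.
Proof.
move=> l0; have l2 : (0 < 2 * l)%N by lia.
rewrite big_ord_recr /= sign_double binn mul1r.
rewrite (bigD1 (Ordinal l2)) //= big1 => [|i i0]; last first.
  have i1 : (i.-1 < (2 * l).-1)%N.
    by have := ltn_ord i; have : (i : nat) != 0%N by []; lia.
  have i2 : (0 < i)%N by have : (i : nat) != 0%N by []; lia.
  have iE : i%:R = i.-1%:R + 1 :> rat by rewrite natr1 prednK.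
  rewrite horner_qpoly (bigD1 (Ordinal i1)) //= iE.
  have -> : i.-1%:R + 1 - l%:R + l%:R - 1 - i.-1%:R = 0 :> rat by ring.
  by rewrite mul0r mulr0.
rewrite bin0 expr0 !mul1r addr0 !horner_qpoly.
have -> : \prod_(i < (2 * l).-1) ((2 * l)%:R - l%:R + l%:R - 1 - i%:R) = (2 * l).-1`!%:R :> rat.
  rewrite -prod_rev_fact; apply: eq_bigr => i _; rewrite subrK; congr (_ - _).
  by rewrite -[in LHS](prednK l2) -natr1 addrK.
have -> : \prod_(i < (2 * l).-1) (0 - l%:R + l%:R - 1 - i%:R) =
    (-1) ^+ (2 * l).-1 * (2 * l).-1`!%:R :> rat.
  by rewrite -prod_oppr_fact; apply: eq_bigr => i _; rewrite -nat1r; ring.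
have -> : (-1) ^+ (2 * l).-1 = -1 :> rat.
  by case: l l0 {l2} => // k _; rewrite mulnS /= exprS sign_double mulr1.
by ring.
Qed.

(** The map [x |-> - N - x] exchanges the two blocks of nodes. Hence the sum of both values of [rho]
    is, up to the factor [(2l-1)!], the difference of order [2 l] of the Lagrange interpolant of
    [qpoly l] on all [2 N] nodes. That interpolant is [qpoly l] itself, whose difference is zero. *)
Lemma rho_reflect N l : (0 < l)%N -> (l <= N)%N ->
  almost (fun x => rho N l (- N%:R - x) = - rho N l x).
Proof.
move=> l0 lN.
have: almost (fun x => forall a : 'I_N, lden N a x != 0).
  by apply: almost_forall => a; apply: almost_lden_neq0.
apply: almost_mono => x ld0.
pose t (i : 'I_N + 'I_N) : rat :=
  match i with inl a => x + a%:R | inr b => - (x + 1 + b%:R) end.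
have t_inj : injective t.
  have nz (a b : 'I_N) : 2 * x + 1 + a%:R + b%:R != 0.
    by have /prodf_neq0/(_ b isT) := ld0 a.
  move=> [a|a] [b|b] /= h.
  - by congr inl; apply/val_inj/eqP; rewrite -(eqr_nat rat); apply/eqP; lra.
  - by have /eqP[] := nz a b; lra.
  - by have /eqP[] := nz b a; lra.
  - by congr inr; apply/val_inj/eqP; rewrite -(eqr_nat rat); apply/eqP; lra.
have szq : (size (qpoly l) <= #|{: 'I_N + 'I_N}|)%N.
  by rewrite size_qpoly // card_sum card_ord; lia.
pose c (s : nat) : rat := (-1) ^+ s * 'C(2 * l, s)%:R.
have E : \sum_(s < (2 * l).+1) c s * \sum_i (qpoly l).[t i] *
    \prod_(j | j != i) ((s%:R - l%:R - t j) / (t i - t j)) = 0.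
  rewrite -[RHS](sum_qpoly l0); apply: eq_bigr => s _; congr (_ * _).
  by rewrite -(lagrange_interpolation t_inj).
have R1 : rho N l x = (2 * l).-1`!%:R^-1 * \sum_(s < (2 * l).+1) c s *
    \sum_(a < N) (qpoly l).[t (inl a)] *
    \prod_(j | j != inl a) ((s%:R - l%:R - t j) / (t (inl a) - t j)).
  rewrite /rho exchange_big mulr_sumr; apply: eq_bigr => s _.
  rewrite 2!mulr_sumr; apply: eq_bigr => a _.
  rewrite big_sumType /= !prodf_div /rho_term -/(c s) /= horner_qpoly -/(qnum l a x).
  have -> : \prod_(i < N | inl i != inl a :> 'I_N + 'I_N) (s%:R - l%:R - (x + i%:R)) =
            rnum N l a s x.
    by apply: eq_big => // b _; ring.
  have -> : \prod_(i < N | inl i != inl a :> 'I_N + 'I_N) (x + a%:R - (x + i%:R)) = rden N a.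
    by apply: eq_big => // b _; ring.
  have -> : \prod_(i < N) (s%:R - l%:R - - (x + 1 + i%:R)) = lnum N l s x.
    by apply: eq_bigr => // b _; ring.
  have -> : \prod_(i < N) (x + a%:R - - (x + 1 + i%:R)) = lden N a x.
    by apply: eq_bigr => // b _; ring.
  by rewrite invfM; ring.
have R2 : rho N l (- N%:R - x) = (2 * l).-1`!%:R^-1 * \sum_(s < (2 * l).+1) c s *
    \sum_(a < N) (qpoly l).[t (inr a)] *
    \prod_(j | j != inr a) ((s%:R - l%:R - t j) / (t (inr a) - t j)).
  rewrite /rho exchange_big mulr_sumr; apply: eq_bigr => s _.
  rewrite 2!mulr_sumr (reindex_inj rev_ord_inj) /=; apply: eq_bigr => a _.
  have rE (i : 'I_N) : (N - i.+1)%:R = N%:R - i%:R - 1 :> rat by rewrite natrB // -natr1; ring.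
  have rneq (i : 'I_N) : ((N - i.+1 != N - a.+1)%N) = (inr i != inr a :> 'I_N + 'I_N).
    rewrite -[RHS]/(i != a) -val_eqE /=; have := ltn_ord i; have := ltn_ord a; lia.
  rewrite big_sumType /= !prodf_div /rho_term -/(c s) /= horner_qpoly.
  have -> : qnum l (N - a.+1) (- N%:R - x) =
            \prod_(i < (2 * l).-1) (- (x + 1 + a%:R) + l%:R - 1 - i%:R).
    by apply: eq_bigr => i _; rewrite rE; ring.
  have -> : rnum N l (N - a.+1) s (- N%:R - x) =
     \prod_(i < N | inr i != inr a :> 'I_N + 'I_N) (s%:R - l%:R - - (x + 1 + i%:R)).
    rewrite /rnum (reindex_inj rev_ord_inj) /=; apply: eq_big => // i _.
    by rewrite rE; ring.
  have -> : rden N (N - a.+1) =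
     \prod_(i < N | inr i != inr a :> 'I_N + 'I_N) (- (x + 1 + a%:R) - - (x + 1 + i%:R)).
    rewrite /rden (reindex_inj rev_ord_inj) /=; apply: eq_big => // i _.
    by rewrite !rE; ring.
  have -> : lnum N l s (- N%:R - x) = \prod_(i < N) (s%:R - l%:R - (x + i%:R)).
    rewrite /lnum (reindex_inj rev_ord_inj) /=; apply: eq_big => // i _.
    by rewrite rE; ring.
  have -> : lden N (N - a.+1) (- N%:R - x) = \prod_(i < N) (- (x + 1 + a%:R) - (x + i%:R)).
    rewrite /lden (reindex_inj rev_ord_inj) /=; apply: eq_big => // i _.
    by rewrite !rE; ring.
  by rewrite invfM; ring.
apply/eqP; rewrite -addr_eq0 addrC R1 R2 -mulrDr -big_split /=; apply/eqP.
rewrite -[RHS](mulr0 (2 * l).-1`!%:R^-1) -[in RHS]E; congr (_ * _).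
by apply: eq_bigr => s _; rewrite -mulrDr big_sumType.
Qed.

Lemma rlim_rho_cont N l (m : nat) : (0 < m)%N ->
  rlim (rho N l) m%:R (rho N l m%:R).
Proof.
move=> m0; apply: rlim_sum => a _; apply: rlim_sum => s _.
apply: rlimM; first exact: rlim_cst.
apply: rlimM; first apply: rlimM; first apply: rlimM.
- exact: rlim_qnum.
- exact: rlim_lnum.
- exact: rlim_rnum.
apply: rlimV; [|exact: almost_lden_neq0|exact: rlim_lden].
apply/prodf_neq0 => b _.
by rewrite -natrM natr1 -!natrD pnatr_eq0.
Qed.

Section DoubleRoot.
Variables (p r : {poly rat}) (f : rat -> rat) (e : rat).
Hypotheses (prf : almost (fun x => p.[x] = r.[x] * f x)) (f0 : rlim f e 0).

Lemma rlim0_factor : exists g h : {poly rat}, h.[e] != 0 /\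
  p * h = r * ('X - e%:P) * g.
Proof.
have [g [h [h0 ge fgh]]] := f0.
have /factor_theorem [g' gE] : root g e by rewrite rootE ge mul0r.
exists g', h; split=> //; rewrite mulrAC -mulrA -gE.
apply: poly_almost_eq; apply: almost_mono2 prf fgh => x h1 h2.
by rewrite !hornerM h1 -h2; ring.
Qed.

Lemma rlim0_dvd : 'X - e%:P %| p.
Proof.
have [g [h [h0 E]]] := rlim0_factor.
have : 'X - e%:P %| p * h by rewrite E -mulrA dvdp_mull // dvdp_mulr.
by rewrite Gauss_dvdpl // coprimep_sym coprimep_XsubC rootE.
Qed.

(** One factor comes from the root of [r], the other from the vanishing limit of [f]. *)
Lemma rlim0_dvd_sqr : root r e -> ('X - e%:P) ^+ 2 %| p.
Proof.
move=> /factor_theorem [r' rE]; have [g [h [h0 E]]] := rlim0_factor.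
have : ('X - e%:P) ^+ 2 %| p * h.
  by rewrite E rE -[r' * _ * _]mulrA -expr2 -mulrA dvdp_mull // dvdp_mulr.
by rewrite Gauss_dvdpl // coprimep_expl // coprimep_sym coprimep_XsubC rootE.
Qed.

End DoubleRoot.

Lemma almost_nat (P : rat -> Prop) : almost P ->
  exists M, forall m : nat, (M <= m)%N -> P m%:R.
Proof.
move=> [s Ps].
suff [M hM] : exists M, forall m : nat, (M <= m)%N -> m%:R \notin s by exists M => m /hM/Ps.
elim: s {Ps} => [|y s [M hM]]; first by exists 0%N.
exists (maxn M (Num.bound y)) => m; rewrite geq_max => /andP[/hM ms my].
rewrite inE negb_or ms andbT; apply/eqP => mE.
have := archi_boundP (ler0n rat m); rewrite ltNge => /negP; apply.
by rewrite ler_nat mE.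
Qed.

Lemma rlim_poch (c a b : rat) n :
  rlim (fun x => poch (a * x + b) n) c (poch (a * c + b) n).
Proof.
apply: (@rlim_almost _ (fun x => \prod_(i < n) (a * x + b + i%:R))).
  by apply: almost_all => x; rewrite pochE.
rewrite pochE; apply: rlim_prod => i _.
by apply: (@rlim_lin _ (fun x => a * x + b + i%:R) a (b + i%:R)) => x; rewrite addrA.
Qed.

Lemma rlim_inv_nat (m i : nat) (f : rat -> rat) : (0 < m)%N ->
  (forall x, f x = x + i%:R) -> rlim (fun x => (f x)^-1) m%:R (f m%:R)^-1.
Proof.
move=> m0 fE; apply: rlimV.
- by rewrite fE -natrD pnatr_eq0; lia.
- apply: almost_mono (@almost_lin_neq0 1 i%:R _) => // x.
  by rewrite mul1r fE.
- by apply: (@rlim_lin _ f 1 i%:R) => x; rewrite mul1r fE.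
Qed.

Lemma rlim_sigma_fun N l (m : nat) : (0 < m)%N -> (l < N)%N ->
  rlim (sigma_fun N l) m%:R (sigma_fun N l m%:R).
Proof.
move=> m0 lN; apply: rlimM; first exact: rlim_cst.
apply: rlimM; first apply: rlimM.
- have := rlim_poch m%:R 1 0 N; rewrite mul1r addr0; apply: rlim_almost.
  by apply: almost_all => x; rewrite mul1r addr0.
- have := rlim_poch m%:R 1 1 N; rewrite mul1r; apply: rlim_almost.
  by apply: almost_all => x; rewrite mul1r.
apply: rlimD; apply: rlimM.
- by apply: (@rlim_lin _ (fun x => 2 * x + 2 * N%:R - 1) 2 (2 * N%:R - 1)) => x; ring.
- apply: rlim_sum => i _; have il := ltn_ord i.
  apply: rlimM; first exact: rlim_cst.
  apply: rlimM; first exact: rlim_cst.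
  rewrite invfM.
  apply: (@rlim_almost _ (fun x => (x + i%:R)^-1 * (x + N%:R - i%:R - 1)^-1)).
    by apply: almost_all => x; rewrite invfM.
  apply: rlimM; first exact: (@rlim_inv_nat m i (fun x => x + i%:R)).
  apply: (@rlim_inv_nat m (N - i.+1) (fun x => x + N%:R - i%:R - 1)) => // x.
  by rewrite natrB -?natr1; [ring|lia].
- by apply: (@rlim_lin _ (fun x => 2 * x + 1) 2 1).
- apply: rlim_sum => i _; have il := ltn_ord i.
  apply: rlimM; first exact: rlim_cst.
  apply: rlimM; first exact: rlim_cst.
  rewrite invfM.
  apply: (@rlim_almost _ (fun x => (x + i%:R + 1)^-1 * (x + N%:R - i%:R)^-1)).
    by apply: almost_all => x; rewrite invfM.
  apply: rlimM.
    by apply: (@rlim_inv_nat m i.+1 (fun x => x + i%:R + 1)) => // x; rewrite -natr1 addrA.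
  apply: (@rlim_inv_nat m (N - i) (fun x => x + N%:R - i%:R)) => // x.
  by rewrite natrB; [ring|lia].
Qed.

Lemma rho_closed_form N l : (0 < l)%N -> (2 * l <= N)%N ->
  (forall m : nat, (0 < m)%N -> `|rho N l m%:R| <= 1) ->
  forall m : nat, (0 < m)%N ->
  pochden N m%:R * ((2 * m%:R + N%:R) * rho N l m%:R) = sigma_fun N l m%:R.
Proof.
move=> l0 lN bound m m0; have N0 : (0 < N)%N by lia.
have [p1 p1E] := polyfun_rho N l; have [p2 p2E] := polyfun_sigma_fun lN.
have [D DE] := polyfun_poch 2 1 (2 * N).-1.
pose f x := (2 * x + N%:R) * rho N l x - sigma_fun N l x / pochden N x.
have [p pE] : exists p : {poly rat}, almost (fun x =>
    p.[x] = pochden N x * ((2 * x + N%:R) * rho N l x) - sigma_fun N l x).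
  exists (p1 - p2).
  by apply: almost_mono2 p1E p2E => x h1 h2; rewrite hornerD hornerN -h1 -h2.
have pf : almost (fun x => p.[x] = D.[x] * f x).
  apply: almost_mono2 (almost_and pE DE) (almost_pochden_neq0 N) => x [-> <-] d0.
  by rewrite /f -/(pochden N x) mulrBr [pochden N x * (_ / _)]mulrCA mulfV // mulr1.
have fe e : (2 * e <= N)%N -> rlim f (- e%:R) 0.
  move=> eN; rewrite -(subrr (rho_limit N l e)).
  by apply: rlimB; [exact: rlim_rho|exact: rlim_sigma].
have p_odd : p \Po (- N%:R%:P - 'X) = - p.
  have lN' : (l <= N)%N by lia.
  apply: poly_almost_eq; apply: almost_mono2
     (almost_and (almost_reflect (- N%:R) pE) pE) (rho_reflect l0 lN').
  move=> x [h1 h2] h3; rewrite horner_comp hornerN hornerD !hornerN hornerC hornerX.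
  by rewrite h1 h2 h3 pochden_reflect // sigma_fun_reflect //; ring.
have Droot e : (0 < e < N)%N -> root D (- e%:R).
  move=> eN; suff -> : D = \prod_(i < (2 * N).-1) (2%:P * 'X + 1 + i%:R%:P).
    have hb : ((2 * e).-1 < (2 * N).-1)%N by lia.
    rewrite rootE horner_prod (bigD1 (Ordinal hb)) //= !(hornerD, hornerM, hornerC, hornerX).
    have -> : (2 * e).-1%:R = 2 * e%:R - 1 :> rat.
      by rewrite -natrM -[in RHS](prednK (n := 2 * e)) -?natr1 ?addrK //; lia.
    by apply/eqP; ring.
  apply: poly_almost_eq; apply: almost_mono DE => x <-.
  rewrite pochE horner_prod; apply: eq_bigr => i _.
  by rewrite !(hornerD, hornerM, hornerC, hornerX).
have reflect_dvd (q : {poly rat}) : q %| p -> q \Po (- N%:R%:P - 'X) %| p.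
  move=> /(dvdp_comp_poly (- N%:R%:P - 'X)); rewrite p_odd.
  by rewrite dvdpNr.
(* The root of the cleared denominator that doubles a zero is available for [0 < e < N] only; the
   multiplicities add up to [2 (N - 1) + 2 = 2 N]. *)
pose k e := if (0 < e < N)%N then 2%N else 1%N.
have half e : (2 * e <= N)%N -> ('X - (- e%:R)%:P) ^+ k e %| p.
  move=> eN; rewrite /k; case: ifP => h.
    by apply: rlim0_dvd_sqr pf (fe e eN) (Droot e h).
  by rewrite expr1; apply: rlim0_dvd pf (fe e eN).
have full e : (e < N.+1)%N -> ('X - (- e%:R)%:P) ^+ k e %| p.
  move=> eN; have [/half //|h] := leqP (2 * e) N.
  have /half/reflect_dvd : (2 * (N - e) <= N)%N by lia.
  have -> : k (N - e)%N = k e by rewrite /k; congr (if _ then _ else _); lia.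
  rewrite rmorphXn /= comp_polyB comp_polyX comp_polyC.
  have -> : - N%:R%:P - 'X - (- (N - e)%:R)%:P = - ('X - (- e%:R)%:P) :> {poly rat}.
    by rewrite natrB // !polyCN polyCB; ring.
  by rewrite /k; case: ifP => _; rewrite ?sqrrN // !expr1 dvdpNl.
have dvdE : \prod_(e < N.+1) ('X - (- e%:R)%:P) ^+ k e %| p.
  apply: dvdp_prod_coprime (fun e => ('X - (- e%:R)%:P) ^+ k e) _ _ full => i j ij.
  rewrite coprimep_expl // coprimep_expr // coprimep_XsubC2 //.
  by apply: (@natr_neq i j); [ring|lia].
have sizeE : size (\prod_(e < N.+1) ('X - (- e%:R : rat)%:P) ^+ k e) = (2 * N).+1.
  rewrite size_prod => [|e _]; last by rewrite expf_neq0 // polyXsubC_eq0.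
  under eq_bigr do rewrite size_exp_XsubC -addn1.
  rewrite big_split /= sum_nat_const !card_ord muln1 addnC -addnS addKn.
  suff -> : (\sum_(e < N.+1) k e = 2 * N)%N by [].
  have NE : N = N.-1.+1 by rewrite prednK.
  rewrite NE big_ord_recl big_ord_recr /=.
  rewrite (eq_bigr (fun=> 2%N)) => [|i _]; last first.
    by rewrite /k /bump /=; have := ltn_ord i => il; rewrite ifT //; lia.
  by rewrite sum_nat_const card_ord /k /bump /=; rewrite ifF; lia.
have p_growth : (size p <= (2 * N).+1)%N.
  have [C [M h]] : growth (fun x => pochden N x * ((2 * x + N%:R) * rho N l x) - sigma_fun N l x) (2 * N).
    apply: growthD.
      rewrite (_ : 2 * N = (2 * N).-1 + 1)%N; last by lia.
      apply: growthM; first exact: growth_poch.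
      rewrite -[1%N]addn0; apply: growthM; first exact: growth_lin.
      by exists 1, 1%N => n n1; rewrite mulr1; apply: bound.
    have lN' : (l < N)%N by lia.
    have [C [M h]] := growth_sigma_fun lN'.
    by exists C, M => n hn; rewrite normrN; apply: h.
  have [M' h'] := almost_nat pE.
  apply: (@poly_growth_size p C (maxn M M')) => n; rewrite geq_max => /andP[h1 h2].
  by rewrite h' //; apply: h.
(* A nonzero [p] would have degree exactly [2 N]. Substituting [- N - X] then preserves the leading
   coefficient, while oddness changes its sign. *)
have p0 : p = 0.
  apply/eqP/negPn/negP => pn0.
  have sp : size p = (2 * N).+1.
    by apply/eqP; rewrite eqn_leq p_growth -sizeE dvdp_leq.
  have := congr1 lead_coef p_odd; rewrite lead_coefN lead_coef_comp; last first.
    by rewrite addrC -opprD size_polyN size_XaddC.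
  have -> : lead_coef (- N%:R%:P - 'X : {poly rat}) = -1.
    by rewrite addrC -opprD lead_coefN lead_coefXaddC.
  rewrite sp sign_double mulr1 => /eqP; rewrite -addr_eq0 -mulr2n mulrn_eq0 /=.
  by rewrite lead_coef_eq0 (negbTE pn0).
have E : almost (fun x => pochden N x * ((2 * x + N%:R) * rho N l x) = sigma_fun N l x).
  by apply: almost_mono pE => x; rewrite p0 horner0 => /esym/eqP; rewrite subr_eq0 => /eqP.
(* The identity is known off a finite set only; both sides are regular at [m > 0], so comparing
   limits there covers every positive integer. *)
apply: rlim_uniq (rlim_sigma_fun m0 _); last by lia.
apply: rlim_almost E _; apply: rlimM; first exact: (rlim_poch m%:R 2 1).
apply: rlimM; last exact: rlim_rho_cont.
exact: (@rlim_lin _ (fun x => 2 * x + N%:R) 2 N%:R).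
Qed.

(** * Interlacing rows *)

Section NatRows.
Local Open Scope nat_scope.

Lemma sorted_count_leq (s : seq nat) (c a : nat) : sorted ltn s -> a < size s ->
  (nth 0 s a <= c) = (a < count (fun x => x <= c) s).
Proof.
elim: s a => // x s IH a /= ps; have [xc|cx] := leqP x c.
  by case: a => [|a] /= h; rewrite ?xc // IH // (path_sorted ps).
have h0 : count (fun y => y <= c) s = 0.
  apply/eqP; rewrite -leqn0 leqNgt -has_count; apply/hasPn => y ys.
  rewrite -ltnNge; apply: ltn_trans cx _.
  by move/(order_path_min ltn_trans)/allP: ps; apply.
rewrite h0 => h; rewrite ltn0; apply/negbTE; rewrite -ltnNge.
case: a h => //= a h; apply: ltn_trans cx _.
by move/(order_path_min ltn_trans)/allP: ps; apply; apply: mem_nth.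
Qed.

Section Rows.
Variable w : nat.
Implicit Types S : {set 'I_w}.

Definition entries S : seq nat := [seq val i | i <- enum S].
Definition entry S (a : nat) : nat := nth 0 (entries S) a.
Definition cnt S (c : nat) : nat := #|[set x in S | x <= c]|.

(** Counting functions are used because they meet the tilings directly: the difference
    [cnt S c - cnt S' c] will tell whether the triangle at position [c] is paired to its right.
    [interlacesP] recovers the usual inequalities between entries. *)
Definition interlaces S' S : bool :=
  [forall c : 'I_w, [&& cnt S' c <= cnt S c, cnt S c <= (cnt S' c).+1
                      & (c \in S') ==> (cnt S c == cnt S' c)]].

Lemma size_entries S : size (entries S) = #|S|.
Proof. by rewrite size_map -cardE. Qed.

Lemma sorted_entries S : sorted ltn (entries S).
Proof.
rewrite sorted_map /enum_mem.
apply: sorted_filter; first by move=> y x z /=; apply: ltn_trans.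
by rewrite -sorted_map -enumT val_enum_ord iota_ltn_sorted.
Qed.

Lemma entries_uniq S : uniq (entries S).
Proof. by rewrite map_inj_uniq ?enum_uniq //; apply: val_inj. Qed.

Lemma mem_entries S (c : 'I_w) : (val c \in entries S) = (c \in S).
Proof. by rewrite mem_map ?mem_enum //; apply: val_inj. Qed.

Lemma cntE S c : cnt S c = count (fun x => x <= c) (entries S).
Proof.
rewrite count_map /cnt -size_filter cardE; apply/perm_size.
apply: uniq_perm => [||i]; [exact: enum_uniq|exact/filter_uniq/enum_uniq|].
by rewrite mem_enum inE mem_filter mem_enum andbC.
Qed.

Lemma cnt_leq S c : cnt S c <= #|S|.
Proof. by apply: subset_leq_card; apply/subsetP => x; rewrite inE => /andP[]. Qed.

Lemma entry_leq S a c : a < #|S| -> (entry S a <= c) = (a < cnt S c).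
Proof.
by move=> aS; rewrite cntE sorted_count_leq ?sorted_entries ?size_entries.
Qed.

Lemma entry_lt S a : a < #|S| -> entry S a < w.
Proof.
move=> aS; have : entry S a \in entries S by rewrite mem_nth ?size_entries.
by case/mapP => i _ ->; apply: ltn_ord.
Qed.

Lemma entry_mono S a b : b < #|S| -> a < b -> entry S a < entry S b.
Proof.
move=> bS ab; apply: (sorted_ltn_nth ltn_trans 0 (sorted_entries S)) => //;
  by rewrite inE size_entries //; apply: ltn_trans bS.
Qed.

Lemma cnt_entry S a : a < #|S| -> cnt S (entry S a) = a.+1.
Proof.
move=> aS; apply/eqP; rewrite eqn_leq -entry_leq // leqnn andbT.
rewrite leqNgt; apply/negP => h; have h2 := leq_trans h (cnt_leq _ _).
by move: h; rewrite -entry_leq // leqNgt entry_mono.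
Qed.

Lemma entry_index S (c : 'I_w) : c \in S -> exists2 a, a < #|S| & entry S a = c.
Proof.
rewrite -mem_entries => cS; exists (index (val c) (entries S)).
  by rewrite -size_entries index_mem.
exact: nth_index.
Qed.

Lemma interlacesP S' S : #|S| = #|S'|.+1 ->
  reflect (forall a, a < #|S'| -> entry S a <= entry S' a < entry S a.+1)
          (interlaces S' S).
Proof.
move=> SS'; apply: (iffP forallP) => [h a aS'|h c].
  have aS : a < #|S| by rewrite SS' ltnS ltnW.
  have /and3P[_ _ /implyP] := h (Ordinal (entry_lt aS')).
  rewrite -mem_entries mem_nth ?size_entries // => /(_ isT) /eqP /=.
  rewrite cnt_entry // => E.
  rewrite entry_leq // E leqnn /= ltnNge entry_leq ?SS' ?ltnS // E.
  by rewrite ltnn.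
apply/and3P; split.
- case E : (cnt S' c) => [|r] //.
  have rS' : r < #|S'| by rewrite -E cnt_leq.
  have /andP[h1 h2] := h r rS'; rewrite -entry_leq ?SS' ?ltnS; last exact: ltnW.
  by apply: leq_trans h1 _; rewrite entry_leq // E.
- rewrite leqNgt; apply/negP => lt.
  have lt2 : (cnt S' c).+1 < #|S| by apply: leq_trans lt (cnt_leq _ _).
  have lt3 : cnt S' c < #|S'| by rewrite -ltnS -SS'.
  have /andP[h1 h2] := h _ lt3.
  have : entry S' (cnt S' c) <= c.
    by apply: ltnW; apply: leq_trans h2 _; rewrite entry_leq.
  by rewrite entry_leq // ltnn.
- apply/implyP => /entry_index [a aS' aE]; rewrite -aE cnt_entry //.
  have /andP[h1 h2] := h a aS'.
  rewrite eqn_leq -entry_leq ?SS' ?ltnS ?(ltnW aS') // h1 andbT.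
  by rewrite leqNgt -entry_leq ?SS' ?ltnS // -ltnNge.
Qed.

Lemma entries_imset k (y : {ffun 'I_k -> 'I_w}) :
  (forall a b : 'I_k, a < b -> y a < y b) ->
  entries (y @: setT) = [seq val (y a) | a <- enum 'I_k].
Proof.
move=> mono; apply: (irr_sorted_eq ltn_trans ltnn); first exact: sorted_entries.
  have srt : sorted (relpre val ltn) (enum 'I_k).
    by rewrite -sorted_map val_enum_ord iota_ltn_sorted.
  by rewrite sorted_map; apply: sub_sorted srt => a b /mono.
move=> c; apply/mapP/mapP => [[i]|[a _ ->]].
  by rewrite mem_enum => /imsetP[a _ ->] ->; exists a => //; rewrite mem_enum.
by exists (y a) => //; rewrite mem_enum imset_f.
Qed.

End Rows.

End NatRows.

(** * Summing determinants over interlacing rows *)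

Definition psum (f : nat -> rat) (x : nat) : rat := \sum_(0 <= c < x) f c.

Definition lift_cols (phi : nat -> nat -> rat) (b : nat) : nat -> rat :=
  if b is b'.+1 then psum (phi b') else fun=> 1.

(** Subtracting from each row its predecessor, which is multiplication by the unitriangular [E],
    clears the column of ones below its first entry; expansion along that column leaves the
    differences. *)
Lemma det_lift_cols k (phi : nat -> nat -> rat) (x : nat -> nat) :
  \det (\matrix_(a < k.+1, b < k.+1) lift_cols phi b (x a)) =
  \det (\matrix_(a < k, b < k) (psum (phi b) (x a.+1) - psum (phi b) (x a))).
Proof.
set A := (X in \det X = _).
pose E : 'M[rat]_k.+1 := \matrix_(i, j) ((i == j)%:R - (i == j.+1 :> nat)%:R).
have dE : \det E = 1.
  rewrite det_trig; last first.
    apply/is_trig_mxP => i j ij; rewrite mxE.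
    have -> : (i == j) = false by apply/negbTE; rewrite -val_eqE /=; lia.
    by have -> : (i == j.+1 :> nat) = false by lia.
  by apply: big1 => i _; rewrite mxE eqxx (_ : (i == i.+1 :> nat) = false) ?subr0 //; lia.
have EA i j : (E *m A) i j = A i j - (if unlift ord0 i is Some i' then A (widen_ord (leqnSn k) i') j else 0).
  rewrite mxE; under eq_bigr do rewrite mxE mulrBl.
  rewrite sumrB; congr (_ - _).
    by rewrite (bigD1 i) //= eqxx mul1r big1 ?addr0 // => l li; rewrite eq_sym (negbTE li) mul0r.
  case: unliftP => [i'|] ->.
    rewrite (bigD1 (widen_ord (leqnSn k) i')) //= /bump /= add1n eqxx mul1r big1 ?addr0 //.
    move=> l li; rewrite (_ : (i'.+1 == l.+1) = false) ?mul0r //.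
    by apply/negbTE; apply: contra li => /eqP[h]; apply/eqP/val_inj.
  by apply: big1 => l _; rewrite mul0r.
rewrite -[LHS]mul1r -dE -det_mulmx (expand_det_col _ ord0) big_ord_recl /=.
rewrite [X in _ + X]big1 => [|i _]; last first.
  by rewrite EA liftK /A !mxE /= subrr mul0r.
rewrite addr0 EA unlift_none subr0 /A mxE /= mul1r /cofactor expr0 mul1r.
congr (\det _); apply/matrixP => i j; rewrite !mxE.
have := EA (lift ord0 i) (lift ord0 j); rewrite mxE => ->.
by rewrite liftK !mxE /= /bump /= !add1n.
Qed.

Lemma psum_diff f x y : (x <= y)%N -> psum f y - psum f x = \sum_(x <= c < y) f c.
Proof. by move=> xy; rewrite /psum (big_cat_nat _ xy) //= addrAC subrr add0r. Qed.

Section Push.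
Variable w : nat.
Implicit Types S : {set 'I_w}.

Definition rowdet k (phi : nat -> nat -> rat) S : rat :=
  \det (\matrix_(a < k, b < k) phi b (entry S a)).

(** An interlacing row is a free choice of one entry in each interval from [entry S a] to
    [entry S a.+1], right end excluded. These intervals follow one another, so the choices increase
    strictly of themselves. *)
Lemma sum_interlacing k (F : {set 'I_w} -> rat) (G : {ffun 'I_k -> 'I_w} -> rat) S :
  #|S| = k.+1 ->
  (forall S' (y : {ffun 'I_k -> 'I_w}), #|S'| = k -> (forall a : 'I_k, entry S' a = y a) -> F S' = G y) ->
  \sum_(S' : {set 'I_w} | (#|S'| == k) && interlaces S' S) F S' =
  \sum_(y in family (fun (a : 'I_k) (c : 'I_w) => (entry S a <= c < entry S a.+1)%N)) G y.
Proof.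
move=> cS FG.
case: w S F G cS FG => [|w'] S F G cS FG.
  by have := max_card (mem S); rewrite cS card_ord.
pose h (y : {ffun 'I_k -> 'I_w'.+1}) : {set 'I_w'.+1} := y @: setT.
pose h' (S' : {set 'I_w'.+1}) : {ffun 'I_k -> 'I_w'.+1} := [ffun a : 'I_k => inord (entry S' a)].
have h'E (S' : {set 'I_w'.+1}) (a : 'I_k) : #|S'| = k -> h' S' a = entry S' a :> nat.
  by move=> cS'; rewrite ffunE inordK // entry_lt // cS'.
have hmono (y : {ffun 'I_k -> 'I_w'.+1}) : (forall a b : 'I_k, (a < b)%N -> (y a < y b)%N) ->
    #|h y| = k /\ (forall a : 'I_k, entry (h y) a = y a).
  move=> mono; have E := entries_imset mono; split.
    by rewrite -size_entries E size_map size_enum_ord.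
  move=> a; rewrite /entry E (nth_map a) ?size_enum_ord //.
  by rewrite nth_ord_enum.
rewrite (reindex_onto h h') /= => [|S' /andP[/eqP cS' _]]; last first.
  apply/setP => c; apply/imsetP/idP => [[a _ ->]|/entry_index [a]].
    by rewrite -mem_entries /= h'E // mem_nth // size_entries cS'.
  rewrite cS' => ak ac; exists (Ordinal ak) => //.
  by apply: val_inj; rewrite /= h'E.
apply: eq_big => y.
  apply/andP/familyP => [[/andP[/eqP cy iy] /eqP hy] a|fy].
    have /interlacesP := iy; rewrite cS cy => /(_ erefl a (ltn_ord a)).
    by rewrite -(h'E _ _ cy) hy.
  have mono (a b : 'I_k) : (a < b)%N -> (y a < y b)%N.
    move=> ab; have /andP[_ h1] := fy a; have /andP[h2 _] := fy b.
    apply: leq_trans h1 (leq_trans _ h2).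
    move: ab; rewrite leq_eqVlt => /orP[/eqP-> //|ab].
    by apply/ltnW/entry_mono; rewrite // cS ltnW // ltnS.
  have [cy ey] := hmono y mono; rewrite cy eqxx; split.
    apply/interlacesP; rewrite ?cS ?cy // => a ak.
    have : (entry S a <= y (Ordinal ak) < entry S a.+1)%N := fy (Ordinal ak).
    by rewrite -ey.
  by apply/eqP/ffunP => a; apply: val_inj; rewrite /= h'E ?ey.
move=> /andP[/andP[/eqP cy iy] /eqP hy]; apply: FG => // a.
by rewrite -(h'E _ _ cy) hy.
Qed.

(** Each entry runs through an interval of its own, so the sum over rows distributes over the
    product in every term of the Leibniz expansion, and each single sum is a difference of partial
    sums. *)
Lemma rowdet_push k phi S : #|S| = k.+1 ->
  \sum_(S' : {set 'I_w} | (#|S'| == k) && interlaces S' S) rowdet k phi S' =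
  rowdet k.+1 (lift_cols phi) S.
Proof.
move=> cS.
rewrite (sum_interlacing (G := fun y => \det (\matrix_(a < k, b < k) phi b (y a)))) //; last first.
  by move=> S' y _ ey; congr (\det _); apply/matrixP => a b; rewrite !mxE ey.
rewrite /rowdet det_lift_cols /determinant exchange_big /=; apply: eq_bigr => s _.
rewrite -mulr_sumr; congr (_ * _).
have -> : \prod_(i < k) (\matrix_(a < k, b < k) (psum (phi b) (entry S a.+1) - psum (phi b) (entry S a))) i (s i)
   = \prod_(i < k) \sum_(c < w | (entry S i <= c < entry S i.+1)%N) phi (s i) c.
  apply: eq_bigr => i _; rewrite mxE.
  have ik : (i.+1 < #|S|)%N by rewrite cS ltnS.
  rewrite psum_diff; last by apply: ltnW; apply: entry_mono.
  rewrite -(big_mkord (fun c => entry S i <= c < entry S i.+1)%N (fun c => phi (s i) c)).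
  rewrite [RHS](big_cat_nat _ (n := entry S i.+1)) //=; last by apply: ltnW; apply: entry_lt.
  rewrite [X in _ = _ + X]big_nat_cond [X in _ = _ + X]big_pred0 ?addr0 => [|c]; last by lia.
  rewrite [RHS](big_cat_nat _ (n := entry S i)) //=; last by apply: ltnW; apply: entry_mono.
  rewrite [X in _ = X + _]big_nat_cond [X in _ = X + _]big_pred0 ?add0r => [|c]; last by lia.
  rewrite [RHS]big_nat_cond [LHS]big_nat_cond; apply: eq_bigl => c; lia.
rewrite bigA_distr_big_dep /=.
apply: eq_bigr => y _; apply: eq_bigr => i _; by rewrite mxE.
Qed.

End Push.

Definition binom (b x : nat) : rat := 'C(x, b)%:R.

Lemma eq_psum f g : f =1 g -> psum f =1 psum g.
Proof. by move=> fg x; apply: eq_bigr. Qed.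

Lemma psum_step (f g : nat -> rat) :
  g 0%N = 0 -> (forall x, g x.+1 = g x + f x) -> psum f =1 g.
Proof.
move=> g0 gS; elim=> [|x IH]; first by rewrite /psum big_geq.
by rewrite /psum big_nat_recr //= -/(psum f x) IH gS.
Qed.

Lemma psum_binom b : psum (binom b) =1 binom b.+1.
Proof. by apply: psum_step => // x; rewrite /binom binS natrD. Qed.

Lemma iter_psum_binom r b : iter r psum (binom b) =1 binom (r + b).
Proof.
elim: r => [|r IH] x //; rewrite iterS (eq_psum IH) psum_binom.
by rewrite addSn.
Qed.

(* The [r]-fold partial sum of the indicator function of [x0]. *)
Definition bump_sum (x0 r x : nat) : rat :=
  if (x0 < x)%N then 'C(x - x0.+1, r.-1)%:R else 0.

Lemma iter_psum_delta x0 (c : rat) r : (0 < r)%N ->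
  iter r psum (fun x => (x == x0)%:R * c) =1 (fun x => bump_sum x0 r x * c).
Proof.
case: r => // r _; elim: r => [|r IH] x.
  move: x; apply: psum_step => [|x]; first by rewrite /bump_sum /= mul0r.
  rewrite /bump_sum /= !bin0; have [xx|xx|->] := ltngtP x x0.
  - by rewrite ltnS leqNgt xx /= !mul0r addr0.
  - by rewrite ltnS (ltnW xx) mul0r addr0.
  - by rewrite ltnSn mul0r add0r.
rewrite iterS (eq_psum IH); move: x; apply: psum_step => [|x].
  by rewrite /bump_sum /= mul0r.
rewrite /bump_sum /=; have [xx|xx|->] := ltngtP x x0.
- by rewrite ltnS leqNgt xx /= !mul0r addr0.
- have -> : (x.+1 - x0.+1 = (x - x0.+1).+1)%N by lia.
  by rewrite ltnS (ltnW xx) binS natrD mulrDl.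
- by rewrite ltnSn subnn bin0n !mul0r addr0.
Qed.

Lemma iter_lift_cols r phi b : iter r lift_cols phi b =1
  if (b < r)%N then binom b else iter r psum (phi (b - r)%N).
Proof.
elim: r b => [|r IH] [|b] x; rewrite ?subn0 //=.
  by rewrite /binom bin0.
rewrite (eq_psum (IH b)) ltnS subSS; case: ifP => _ //.
exact: psum_binom.
Qed.

Section Weights.
Variable w : nat.
Implicit Types S : {set 'I_w}.

(** The number of arrays of interlacing rows [0, ..., j] with last row [S] in which row [i]
    satisfies [ok i]; see [weight_patterns]. *)
Fixpoint weight (ok : nat -> {set 'I_w} -> bool) (j : nat) S : nat :=
  (ok j S * (if j is j'.+1
             then \sum_(S' : {set 'I_w} | interlaces S' S) weight ok j' S'
             else 1))%N.

Definition free_row (j : nat) S := #|S| == j.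
Definition pinned_row (k : nat) (x0 : 'I_w) (j : nat) S :=
  (#|S| == j) && ((j == k) ==> (x0 \in S)).

Lemma leq_weight (ok ok' : nat -> {set 'I_w} -> bool) j S : (forall i S', ok i S' -> ok' i S') ->
  (weight ok j S <= weight ok' j S)%N.
Proof.
move=> h; have hok i S' : (ok i S' <= ok' i S')%N.
  by case: (ok i S') (h i S') => // /(_ isT) ->.
elim: j S => [|j IH] S /=; first by rewrite leq_mul.
by rewrite leq_mul // leq_sum.
Qed.

Lemma eq_rowdet k phi psi S : (forall b, (b < k)%N -> phi b =1 psi b) ->
  rowdet k phi S = rowdet k psi S.
Proof.
by move=> h; congr (\det _); apply/matrixP => a b; rewrite !mxE h.
Qed.

Lemma weight_step (ok : nat -> {set 'I_w} -> bool) j S : ok j.+1 S -> (forall S', ok j S' -> #|S'| = j) ->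
  (weight ok j.+1 S)%:R =
  \sum_(S' : {set 'I_w} | (#|S'| == j) && interlaces S' S) (weight ok j S')%:R :> rat.
Proof.
move=> okS cS /=; rewrite okS mul1n natr_sum big_mkcond [RHS]big_mkcond /=.
apply: eq_bigr => S' _; case: (interlaces S' S); last by rewrite andbF.
rewrite andbT; case: eqP => // cS'.
have -> : weight ok j S' = 0%N; last by [].
by case: j cS cS' {okS} => [|j] cS cS' /=; case E : (ok _ _) => //; have := cS _ E.
Qed.

(** [lift_cols] fixes the family [binom]: its first member is constantly [1], and partial summation
    raises the index by one. *)
Lemma weight_free j S : #|S| = j -> (weight free_row j S)%:R = rowdet j binom S.
Proof.
elim: j S => [|j IH] S cS.
  by rewrite /rowdet det_mx00 /= /free_row cS.
rewrite weight_step /free_row; [|by rewrite cS|by move=> S' /eqP].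
rewrite (eq_bigr (rowdet j binom)) => [|S' /andP[/eqP cS' _]]; last exact: IH.
rewrite rowdet_push //; apply: eq_rowdet => -[|b] _ x /=.
  by rewrite /binom bin0.
exact: psum_binom.
Qed.

Lemma mem_entrysum k S (x0 : 'I_w) : #|S| = k ->
  (x0 \in S)%:R = \sum_(a < k) (entry S a == x0)%:R :> rat.
Proof.
move=> cS; have [x0S|x0S] := boolP (x0 \in S).
  have [a] := entry_index x0S; rewrite cS => ak ax0.
  rewrite (bigD1 (Ordinal ak)) //= ax0 eqxx big1 ?addr0 // => b ba.
  rewrite -ax0 /entry nth_uniq ?size_entries ?cS ?entries_uniq //.
  by move: ba; rewrite -val_eqE /= => /negbTE ->.
rewrite big1 // => a _; case: eqP => // h; case/negP: x0S.
by rewrite -mem_entries /= -h mem_nth // size_entries cS.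
Qed.

Definition pin_col (x0 c : nat) (phi : nat -> nat -> rat) (b x : nat) : rat :=
  if b == c then (x == x0)%:R * phi b x else phi b x.

(** In each term of the Leibniz expansion the permutation turns the choice of the matrix row whose
    entry is [x0] into the choice of a column; the indicator of [x0] is then absorbed into that
    column. *)
Lemma rowdet_pin k phi S (x0 : 'I_w) : #|S| = k ->
  (x0 \in S)%:R * rowdet k phi S = \sum_(c < k) rowdet k (pin_col x0 c phi) S.
Proof.
move=> cS; rewrite (mem_entrysum _ cS) /rowdet /determinant exchange_big /=.
rewrite mulr_sumr; apply: eq_bigr => s _.
rewrite -mulr_sumr mulrCA; congr (_ * _).
rewrite [RHS](reindex_inj (@perm_inj _ s)) /= mulr_suml; apply: eq_bigr => a _.
rewrite (bigD1 a) //= [RHS](bigD1 a) //= !mxE /pin_col eqxx mulrA; congr (_ * _).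
apply: eq_bigr => b ba; rewrite !mxE.
by rewrite val_eqE (inj_eq perm_inj) (negbTE ba).
Qed.

Lemma weight_pinned_lt k x0 j S : (j < k)%N ->
  weight (pinned_row k x0) j S = weight free_row j S.
Proof.
elim: j S => [|j IH] S jk /=; rewrite /pinned_row /free_row.
  by rewrite (ltn_eqF jk) andbT.
rewrite (ltn_eqF jk) andbT; congr (_ * _)%N; apply: eq_bigr => S' _.
by rewrite IH // ltnW.
Qed.

Lemma weight_pinned k x0 r S : #|S| = (k + r)%N ->
  (weight (pinned_row k x0) (k + r) S)%:R =
  \sum_(c < k) rowdet (k + r) (iter r lift_cols (pin_col x0 c binom)) S.
Proof.
elim: r S => [|r IH] S cS.
  rewrite addn0 in cS *; rewrite -rowdet_pin // -weight_free //.
  case: k cS => [|k] cS.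
    by rewrite /= /pinned_row /free_row cS /= muln1 mulr1.
  rewrite /= /pinned_row /free_row cS eqxx /= mul1n -natrM; congr _%:R.
  congr (_ * _)%N; apply: eq_bigr => S' _; exact: weight_pinned_lt.
rewrite addnS in cS *.
rewrite weight_step; last 2 first.
- rewrite /pinned_row cS eqxx /=; have -> : ((k + r).+1 == k) = false by lia.
  by [].
- by move=> S' /andP[/eqP].
rewrite (eq_bigr (fun S' => \sum_(c < k)
    rowdet (k + r) (iter r lift_cols (pin_col x0 c binom)) S')); last first.
  by move=> S' /andP[/eqP cS' _]; apply: IH.
by rewrite exchange_big; apply: eq_bigr => c _; rewrite rowdet_push.
Qed.

(** Cramer's rule as a product: the matrix on the left is the binomial matrix times [Z], the
    identity with column [c] replaced by [beta]. *)
Lemma rowdet_cramer k (beta : nat -> rat) (v : nat -> rat) S (c : 'I_k) :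
  (forall a, (a < k)%N -> v (entry S a) = \sum_(b < k) beta b * binom b (entry S a)) ->
  rowdet k (fun b x => if b == c then v x else binom b x) S =
  beta c * rowdet k binom S.
Proof.
move=> hv.
pose Z : 'M[rat]_k := \matrix_(i, j) (if j == c then beta i else (i == j)%:R).
have dZ : \det Z = beta c.
  rewrite (expand_det_row _ c) (bigD1 c) //= big1 => [|j jc]; last first.
    by rewrite mxE (negbTE jc) eq_sym (negbTE jc) mul0r.
  rewrite mxE eqxx addr0 /cofactor -signr_odd oddD addbb expr0 mul1r.
  suff -> : row' c (col' c Z) = 1%:M by rewrite det1 mulr1.
  apply/matrixP => i j; rewrite !mxE eq_sym (negbTE (neq_lift _ _)).
  by rewrite (inj_eq lift_inj).
rewrite mulrC -dZ -det_mulmx; congr (\det _); apply/matrixP => a b; rewrite !mxE.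
have [bc|bc] := eqVneq b c.
  subst b; rewrite eqxx hv //; apply: eq_bigr => i _.
  by rewrite !mxE eqxx mulrC.
have -> : (b == c :> nat) = false by apply/negbTE.
rewrite (bigD1 b) //= big1 => [|i ib]; rewrite !mxE (negbTE bc).
  by rewrite eqxx mulr1 addr0.
by rewrite (negbTE ib) mulr0.
Qed.

(** After [r] lifts the pinned column [c] stands at position [r + c] and equals [binom c x0] times
    [bump_sum x0 r], while all other columns are binomial again, so Cramer's rule applies. *)
Lemma weight_pinned_interpolation k r (x0 : 'I_w) S (beta : nat -> rat) :
  (0 < r)%N -> #|S| = (k + r)%N ->
  (forall a, (a < k + r)%N ->
     bump_sum x0 r (entry S a) = \sum_(b < k + r) beta b * binom b (entry S a)) ->
  (weight (pinned_row k x0) (k + r) S)%:R =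
  (\sum_(c < k) binom c x0 * beta (r + c)%N) * rowdet (k + r) binom S.
Proof.
move=> r0 cS hb; rewrite weight_pinned // mulr_suml; apply: eq_bigr => c _.
have rc : (r + c < k + r)%N by have := ltn_ord c; lia.
have /= <- := @rowdet_cramer (k + r) (fun b => binom c x0 * beta b)
  (fun x => bump_sum x0 r x * binom c x0) S (Ordinal rc); last first.
  move=> a ak; rewrite hb // mulr_suml; apply: eq_bigr => b _; ring.
apply: eq_rowdet => b bk x; rewrite iter_lift_cols /=.
case: (ltnP b r) => br.
  by have -> : (b == r + c)%N = false by lia.
have -> : (b == r + c)%N = (b - r == c)%N by lia.
have E : pin_col x0 c binom (b - r) =1
    (if (b - r == c)%N then (fun y : nat => (y == x0)%:R * binom c x0) else binom (b - r)).
  move=> y; rewrite /pin_col; case: eqP => [->|//].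
  by case: eqP => [->|_]; rewrite ?mul0r.
have eq_iter f g n : f =1 g -> iter n psum f =1 iter n psum g.
  by move=> fg; elim: n => // n IHn y; rewrite !iterS; apply: eq_psum.
rewrite (eq_iter _ _ r E); case: eqP => _; first exact: iter_psum_delta.
by rewrite iter_psum_binom subnKC.
Qed.

End Weights.

(** * Newton expansion, finite differences and the Vandermonde determinant *)

Lemma prod_ffact (x b : nat) : \prod_(i < b) (x%:R - i%:R : rat) = (x ^_ b)%:R.
Proof.
elim: b => [|b IH]; first by rewrite big_ord0 ffactn0.
rewrite big_ord_recr /= IH ffactnSr natrM.
have [bx|xb] := leqP b x; first by rewrite natrB.
by rewrite ffact_small // !mul0r.
Qed.

Lemma binom_prod (b x : nat) : binom b x = \prod_(i < b) (x%:R - i%:R) / b`!%:R.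
Proof.
rewrite prod_ffact -bin_ffact natrM mulfK // pnatr_eq0 -lt0n; exact: fact_gt0.
Qed.

Definition binom_poly (b : nat) : {poly rat} :=
  b`!%:R^-1 *: \prod_(i < b) ('X - i%:R%:P).

Lemma horner_binom_poly b (x : nat) : (binom_poly b).[x%:R] = binom b x.
Proof.
rewrite hornerZ horner_prod binom_prod mulrC; congr (_ / _).
by apply: eq_bigr => i _; rewrite hornerXsubC.
Qed.

Lemma size_binom_poly b : size (binom_poly b) = b.+1.
Proof.
rewrite size_scale; last by rewrite invr_eq0 pnatr_eq0 -lt0n fact_gt0.
by rewrite size_prod_XsubC -count_predT -sum1_count sum1_card card_ord.
Qed.

Lemma newton_expansion (k : nat) (p : {poly rat}) : (size p <= k)%N ->
  exists beta : nat -> rat, forall x : nat,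
    p.[x%:R] = \sum_(b < k) beta b * binom b x.
Proof.
elim: k p => [|k IH] p szp.
  exists (fun=> 0) => x; rewrite big_ord0.
  by move: szp; rewrite leqn0 size_poly_eq0 => /eqP->; rewrite horner0.
pose c := p`_k / (binom_poly k)`_k.
have nz : (binom_poly k)`_k != 0.
  have -> : (binom_poly k)`_k = lead_coef (binom_poly k).
    by rewrite lead_coefE size_binom_poly.
  by rewrite lead_coef_eq0 -size_poly_eq0 size_binom_poly.
have [|beta hb] := IH (p - c *: binom_poly k).
  apply/leq_sizeP => j; rewrite leq_eqVlt => /orP[/eqP<-|kj].
    by rewrite coefB coefZ /c mulfVK // subrr.
  rewrite coefB coefZ !nth_default ?mulr0 ?subrr ?size_binom_poly //.
  exact: leq_trans szp kj.
exists (fun b => if b == k then c else beta b) => x.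
rewrite big_ord_recr /= eqxx -horner_binom_poly.
rewrite (eq_bigr (fun b : 'I_k => beta b * binom b x)) => [|b _]; last first.
  by rewrite (ltn_eqF (ltn_ord b)).
by rewrite -hb hornerD hornerN hornerZ subrK.
Qed.

Definition diff_sum (r : nat) (f : nat -> rat) (x : nat) : rat :=
  \sum_(s < r.+1) (-1) ^+ (r + s) * 'C(r, s)%:R * f (x + s)%N.

Lemma diff_sumS r f x :
  diff_sum r.+1 f x = diff_sum r f x.+1 - diff_sum r f x.
Proof.
rewrite /diff_sum big_ord_recl /= bin0.
under eq_bigr => s _ do rewrite /bump /= add1n binS natrD mulrDr mulrDl.
rewrite big_split /= addrA addrC; congr (_ + _).
  apply: eq_bigr => s _.
  have -> : (r.+1 + s.+1 = (r + s).+2)%N by lia.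
  by rewrite addnS -addSn !exprS; ring.
rewrite big_ord_recr /= bin_small // mulr0 mul0r addr0.
rewrite [in RHS]big_ord_recl /= bin0 opprD addSn exprS; congr (_ + _).
  by ring.
rewrite -sumrN; apply: eq_bigr => s _.
by rewrite /bump /= add1n addSn exprS; ring.
Qed.

Lemma diff_sum_binom r b x :
  diff_sum r (binom b) x = if (r <= b)%N then binom (b - r) x else 0.
Proof.
elim: r x => [|r IH] x.
  by rewrite /diff_sum big_ord1 /= subn0 !addn0 bin0 expr0 !mul1r.
rewrite diff_sumS !IH; case: (ltngtP r b) => [rb|br|->].
- have -> : (b - r = (b - r.+1).+1)%N by lia.
  by rewrite /binom binS natrD addrAC subrr add0r.
- by rewrite subrr.
- by rewrite subnn /binom !bin0 subrr.
Qed.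

(** A difference of order [r] lowers the index of [binom b] by [r] and kills it for [b < r]. This
    identifies the sum produced by Cramer's rule as a finite difference of the interpolant. *)
Lemma diff_sum_expansion k r (beta : nat -> rat) (f : nat -> rat) x0 :
  (forall x, f x = \sum_(b < k + r) beta b * binom b x) ->
  \sum_(c < k) binom c x0 * beta (r + c)%N = diff_sum r f x0.
Proof.
move=> fE; transitivity (\sum_(b < k + r) beta b * diff_sum r (binom b) x0); last first.
  rewrite /diff_sum; under [RHS]eq_bigr do rewrite fE mulr_sumr.
  rewrite exchange_big; apply: eq_bigr => b _; rewrite mulr_sumr.
  by apply: eq_bigr => s _; rewrite mulrCA.
rewrite (addnC k r) big_split_ord /= [X in _ = X + _]big1 ?add0r => [|b _].
  by apply: eq_bigr => c _; rewrite diff_sum_binom leq_addr addKn mulrC.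
by rewrite diff_sum_binom leqNgt ltn_ord /= mulr0.
Qed.

(** [binom b] is a polynomial of degree [b], so the determinant is a Vandermonde product times the
    constant [det U]. The constant is found from the identity sequence, for which the matrix is
    unitriangular. *)
Lemma det_binom k (x : nat -> nat) :
  \det (\matrix_(a < k, b < k) binom b (x a)) =
  \prod_(i < k) \prod_(j < k | (i < j)%N) (((x j)%:R - (x i)%:R) / (j%:R - i%:R)).
Proof.
pose U : 'M[rat]_k := \matrix_(c, b) (binom_poly b)`_c.
have E (y : nat -> nat) : \det (\matrix_(a < k, b < k) binom b (y a)) =
    (\prod_(i < k) \prod_(j < k | (i < j)%N) ((y j)%:R - (y i)%:R)) * \det U.
  have := det_Vandermonde (\row_(a < k) ((y a)%:R : rat)).
  under [in X in _ = X -> _]eq_bigr do under eq_bigr do rewrite !mxE.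
  move=> <-; rewrite -det_tr -det_mulmx; congr (\det _).
  apply/matrixP => a b; rewrite !mxE -horner_binom_poly.
  rewrite (@horner_coef_wide _ k); last by rewrite size_binom_poly.
  by apply: eq_bigr => c _; rewrite !mxE mulrC.
have U1 : (\prod_(i < k) \prod_(j < k | (i < j)%N) (j%:R - i%:R)) * \det U = 1.
  rewrite -(E id) det_trig; last first.
    by apply/is_trig_mxP => i j ij; rewrite mxE /binom bin_small.
  by apply: big1 => i _; rewrite mxE /binom binn.
rewrite (E x).
have -> : \det U = (\prod_(i < k) \prod_(j < k | (i < j)%N) (j%:R - i%:R))^-1.
  by apply: (mulfI (x := \prod_(i < k) \prod_(j < k | (i < j)%N) (j%:R - i%:R)));
    [apply: contra_eq_neq U1 => ->; rewrite mul0r eq_sym oner_eq0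
    |rewrite U1 mulfV //; apply: contra_eq_neq U1 => ->; rewrite mul0r eq_sym oner_eq0].
rewrite -prodf_div; apply: eq_bigr => i _; exact: esym (prodf_div _ _ _ _).
Qed.

(** * The top row and the count of unrestricted arrays *)

Definition top_row (N n : nat) : {set 'I_(n + 2 * N)} :=
  [set c : 'I_(n + 2 * N) | (c < N)%N || (n + N <= c)%N].

Lemma entries_top_row N n : entries (top_row N n) = iota 0 N ++ iota (n + N) N.
Proof.
apply: (irr_sorted_eq ltn_trans ltnn); first exact: sorted_entries.
  rewrite (sorted_pairwise ltn_trans) pairwise_cat -!(sorted_pairwise ltn_trans).
  rewrite !iota_ltn_sorted !andbT; apply/allrelP => x y.
  by rewrite !mem_iota; lia.
move=> c; rewrite mem_cat !mem_iota; apply/mapP/idP => [[i]|h].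
  by rewrite mem_enum inE => hi ->; have := ltn_ord i; rewrite /=; lia.
have cw : (c < n + 2 * N)%N by lia.
by exists (Ordinal cw) => //; rewrite mem_enum inE /=; lia.
Qed.

Lemma card_top_row N n : #|top_row N n| = (2 * N)%N.
Proof. by rewrite -size_entries entries_top_row size_cat !size_iota mul2n addnn. Qed.

Lemma entry_top_row N n a : (a < 2 * N)%N ->
  entry (top_row N n) a = if (a < N)%N then a else (n + a)%N.
Proof.
move=> a2; rewrite /entry entries_top_row nth_cat size_iota.
by case: ifP => h; rewrite nth_iota; lia.
Qed.

(** MacMahon's product for the hexagon, with the innermost product telescoped. *)
Definition hexagon_count (N n : nat) : rat :=
  \prod_(i < N) \prod_(j < N) ((n + i + j).+1%:R / (i + j).+1%:R).

(** Two entries of the same block are as far apart as their indices and contribute [1]. Only pairs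
    from different blocks remain, and the left block is read backwards. *)
Lemma rowdet_top N n : rowdet (2 * N) binom (top_row N n) = hexagon_count N n.
Proof.
rewrite /rowdet (det_binom _ (entry (top_row N n))).
rewrite -(big_mkord xpredT (fun i => \prod_(j < 2 * N | (i < j)%N)
   (((entry (top_row N n) j)%:R - (entry (top_row N n) i)%:R) / (j%:R - i%:R)))).
have ratio1 (i j : nat) (d : nat) : (i < j)%N -> ((d + j)%:R - (d + i)%:R) / (j%:R - i%:R) = 1 :> rat.
  move=> ij; rewrite !natrD opprD addrACA subrr add0r divff //.
  by rewrite subr_eq0 eqr_nat; lia.
rewrite (big_cat_nat _ (n := N)) //=; last by lia.
rewrite [X in _ * X]big_nat_cond [X in _ * X]big1 ?mulr1 => [|i /andP[/andP[Ni i2] _]]; last first.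
  apply: big1 => j ij; rewrite !entry_top_row // ?(ltnNge j) ?(ltnNge i) ?Ni ?(leq_trans Ni (ltnW ij)) /=.
  exact: ratio1.
rewrite big_mkord (reindex_inj rev_ord_inj) /=; apply: eq_bigr => i _.
rewrite -(big_mkord (fun j => N - i.+1 < j)%N (fun j =>
   ((entry (top_row N n) j)%:R - (entry (top_row N n) (N - i.+1))%:R) / (j%:R - (N - i.+1)%:R))).
rewrite (big_cat_nat _ (n := N)) //=; last by lia.
have iN := ltn_ord i.
have rE : (N - i.+1)%:R = N%:R - i%:R - 1 :> rat by rewrite natrB // -natr1; ring.
rewrite big_nat_cond big1 ?mul1r => [|j /andP[/andP[_ jN] ij]]; last first.
  rewrite !entry_top_row; [|lia|lia].
  rewrite jN (_ : (N - i.+1 < N)%N); last by lia.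
  exact: (ratio1 _ _ 0%N).
rewrite -{1}[N in \big[_/_]_(N <= _ < _ | _) _]add0n big_addn.
rewrite (_ : (2 * N - N = N)%N); last by lia.
rewrite big_mkord; apply: eq_big => [j|j _]; first by lia.
have jN := ltn_ord j; rewrite !entry_top_row; [|lia|lia].
rewrite (_ : (j + N < N)%N = false); last by lia.
rewrite (_ : (N - i.+1 < N)%N); last by lia.
rewrite rE; congr (_ / _); rewrite -!natr1 !natrD; ring.
Qed.

Lemma hexagon_countE N m : hexagon_count N (2 * m) =
  \prod_(1 <= i < N.+1) \prod_(1 <= j < N.+1) \prod_(1 <= k < (2 * m).+1)
        ((i%:R + j%:R + k%:R - 1) / (i%:R + j%:R + k%:R - 2)).
Proof.
rewrite big_add1 big_mkord; apply: eq_bigr => i _.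
rewrite big_add1 big_mkord; apply: eq_bigr => j _.
rewrite big_add1 /=; elim: (2 * m)%N => [|k IH].
  by rewrite big_geq // !add0n divff // pnatr_eq0.
rewrite big_nat_recr //= -IH.
have h1 : (i + j).+1%:R != 0 :> rat by rewrite pnatr_eq0.
have h2 : (k + i + j).+1%:R != 0 :> rat by rewrite pnatr_eq0.
have -> : i.+1%:R + j.+1%:R + k.+1%:R - 1 = (k.+1 + i + j).+1%:R :> rat.
  by rewrite -!natr1 !natrD; ring.
have -> : i.+1%:R + j.+1%:R + k.+1%:R - 2 = (k + i + j).+1%:R :> rat.
  by rewrite -!natr1 !natrD; ring.
by rewrite [RHS]mulrC mulrA mulfVK.
Qed.

Section Pinned.
Variables (N l m : nat).
Hypotheses (l0 : (0 < l)%N) (lN : (l < N)%N).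

Lemma pin_bound : (m + N - l < 2 * m + 2 * N)%N.
Proof. by lia. Qed.

(** The [l]-th lozenge has the left endpoint [(m + l - N, 2 N - 2 l)] of its horizontal diagonal;
    positions in a row are measured by the sum of both coordinates, here [m + N - l]. *)
Definition pin : 'I_(2 * m + 2 * N) := Ordinal pin_bound.

(** The difference operator acts at [pin], [pin + 1], ..., [pin + 2 l], with midpoint [m + N].
    Subtracting this midpoint from nodes and evaluation points yields the centred factors that
    define [rho]. *)
Lemma weight_pinned_rho :
  (weight (pinned_row (2 * N - 2 * l) pin) (2 * N) (top_row N (2 * m)))%:R =
  rho N l m%:R * hexagon_count N (2 * m).
Proof.
pose t (i : 'I_N + 'I_N) : rat :=
  match i with inl a => (N + 2 * m + a)%:R | inr b => (N - b.+1)%:R end.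
have t_inj : injective t.
  move=> [a|a] [b|b] /= /eqP; rewrite eqr_nat => /eqP h.
  - by congr inl; apply: val_inj => /=; lia.
  - by have := ltn_ord b; lia.
  - by have := ltn_ord a; lia.
  - by congr inr; apply: val_inj => /=; have := ltn_ord a; have := ltn_ord b; lia.
pose u (i : 'I_N + 'I_N) : rat :=
  match i with inl a => binom (2 * l).-1 (m + a + l).-1 | inr b => 0 end.
pose P := lagrange_poly t u.
have szP : (size P <= 2 * N)%N.
  by have := size_lagrange_poly t u; rewrite card_sum card_ord mul2n addnn.
have [beta hb] := newton_expansion szP.
pose k := (2 * N - 2 * l)%N; have kr : (2 * N = k + 2 * l)%N by rewrite /k; lia.
have hB a : (a < k + 2 * l)%N -> bump_sum pin (2 * l) (entry (top_row N (2 * m)) a) =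
    \sum_(b < k + 2 * l) beta b * binom b (entry (top_row N (2 * m)) a).
  rewrite -kr => a2; rewrite -hb entry_top_row //; case: ifP => aN.
    have ha : (N - a.+1 < N)%N by lia.
    have -> : a%:R = t (inr (Ordinal ha)) by rewrite /t /=; congr _%:R; lia.
    rewrite lagrange_poly_node // /u /bump_sum /=; case: ifP => // h.
    (* A left entry may lie beyond [pin], but by fewer than [2 l] positions, where the binomial
       coefficient still vanishes. *)
    by rewrite bin_small //; lia.
  have ha : (a - N < N)%N by lia.
  have -> : (2 * m + a)%:R = t (inl (Ordinal ha)) by rewrite /t /=; congr _%:R; lia.
  rewrite lagrange_poly_node // /u /bump_sum /= ifT; last by lia.
  by rewrite /binom; congr ('C(_, _)%:R); lia.
have cS : #|top_row N (2 * m)| = (k + 2 * l)%N by rewrite card_top_row.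
have l20 : (0 < 2 * l)%N by lia.
have := weight_pinned_interpolation l20 cS hB.
rewrite -!kr rowdet_top => ->; congr (_ * _).
rewrite (@diff_sum_expansion k (2 * l) beta (fun x => P.[x%:R])); last first.
  by move=> x; rewrite hb kr.
rewrite /rho exchange_big; apply: eq_bigr => s _.
rewrite exprD exprM sqrrN !expr1n mul1r horner_lagrange_poly mulr_sumr.
rewrite big_sumType /= [X in _ + X]big1 ?addr0 => [|b _]; last by rewrite mul0r mulr0.
apply: eq_bigr => a _; rewrite big_sumType /= !prodf_div /rho_term.
have pE : (m + N - l + s)%:R = m%:R + N%:R - l%:R + s%:R :> rat.
  by rewrite natrD natrB ?natrD //; lia.
have nE (b : nat) : (N + 2 * m + b)%:R = N%:R + 2 * m%:R + b%:R :> rat.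
  by rewrite natrD natrD natrM.
have -> : binom (2 * l).-1 (m + a + l).-1 = qnum l a m%:R / (2 * l).-1`!%:R.
  rewrite binom_prod /qnum; congr (_ / _); apply: eq_bigr => i _.
  by rewrite -subn1 natrB ?natrD //; lia.
have -> : \prod_(j < N | inl j != inl a :> 'I_N + 'I_N)
    ((m + N - l + s)%:R - (N + 2 * m + j)%:R) = rnum N l a s m%:R.
  by apply: eq_big => // b _; rewrite pE nE; ring.
have -> : \prod_(j < N | inl j != inl a :> 'I_N + 'I_N)
    ((N + 2 * m + a)%:R - (N + 2 * m + j)%:R) = rden N a.
  by apply: eq_big => // b _; rewrite !nE; ring.
have -> : \prod_(j < N) ((m + N - l + s)%:R - (N - j.+1)%:R) = lnum N l s m%:R.
  by apply: eq_bigr => b _; rewrite pE natrB // -natr1; ring.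
have -> : \prod_(j < N) ((N + 2 * m + a)%:R - (N - j.+1)%:R) = lden N a m%:R.
  by apply: eq_bigr => b _; rewrite natrB // -natr1 nE; ring.
by rewrite invfM; ring.
Qed.

(** [rho] is the proportion of arrays that contain the prescribed lozenge. *)
Lemma rho_bounded : `|rho N l m%:R| <= 1.
Proof.
have c0 : 0 < hexagon_count N (2 * m).
  by apply: prodr_gt0 => i _; apply: prodr_gt0 => j _; rewrite divr_gt0 ?ltr0n.
have le : (weight (pinned_row (2 * N - 2 * l) pin) (2 * N) (top_row N (2 * m)) <=
           weight (@free_row _) (2 * N) (top_row N (2 * m)))%N.
  by apply: leq_weight => i S /andP[].
rewrite -(ler_nat rat) weight_pinned_rho weight_free ?card_top_row // rowdet_top in le.
have ge0 : 0 <= rho N l m%:R * hexagon_count N (2 * m) by rewrite -weight_pinned_rho ler0n.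
rewrite pmulr_lge0 // in ge0; rewrite ger0_norm //.
by rewrite -(ler_pM2r c0) mul1r.
Qed.

End Pinned.

Lemma weight_closed_form N l m : (0 < m)%N -> (2 * l <= N)%N ->
  forall (l0 : (0 < l)%N) (lN : (l < N)%N),
  (weight (pinned_row (2 * N - 2 * l) (pin m l0 lN)) (2 * N) (top_row N (2 * m)))%:R =
    poch (m%:R + 1) N * poch m%:R N * poch N%:R (N - 1) /
      (poch (2 * m%:R + 1) N * poch (2 * m%:R + N%:R) N * ((N - 1)`!)%:R)
    * sigma1 N m l
    * \prod_(1 <= i < N.+1) \prod_(1 <= j < N.+1) \prod_(1 <= k < (2 * m).+1)
        ((i%:R + j%:R + k%:R - 1) / (i%:R + j%:R + k%:R - 2)).
Proof.
move=> m0 l2N l0 lN; rewrite weight_pinned_rho hexagon_countE; congr (_ * _).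
have bound (i : nat) : (0 < i)%N -> `|rho N l i%:R| <= 1 by move=> _; apply: rho_bounded.
have := rho_closed_form l0 l2N bound m0.
rewrite sigmaE /sigma_fun /centbin /pochden.
have N1 : ((2 * N).-1 = N + (N - 1))%N by lia.
(* The factor [2 m + N] occurs in both Pochhammer symbols of the denominator; with one copy split
   off, the remaining factors form [pochden]. *)
have E1 : poch (2 * m%:R + N%:R) N =
    (2 * m%:R + N%:R) * poch (2 * m%:R + 1 + N%:R) (N - 1) :> rat.
  rewrite -{2}[N](subnKC (n := N) (m := 1)) ?pochD; last by lia.
  by rewrite pochS poch0 mul1r addr0; congr (_ * poch _ _); ring.
rewrite N1 pochD E1.
have p1 : poch (2 * m%:R + 1) N != 0 :> rat.
  rewrite pochE; apply/prodf_neq0 => i _; rewrite -natrM natr1 -natrD pnatr_eq0 //.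
have p2 : poch (2 * m%:R + 1 + N%:R) (N - 1) != 0 :> rat.
  rewrite pochE; apply/prodf_neq0 => i _; rewrite -natrM natr1 -!natrD pnatr_eq0 //.
have p3 : 2 * m%:R + N%:R != 0 :> rat by rewrite -natrM -natrD pnatr_eq0; lia.
have p4 : (N - 1)`!%:R != 0 :> rat := fact_neq0 _.
move=> H; apply: (mulfI (mulf_neq0 (mulf_neq0 p1 p2) p3)).
rewrite -[LHS]mulrA H; field; rewrite p1 p2 p3 p4; done.
Qed.

Local Open Scope fset_scope.
Local Open Scope ring_scope.

(** * Tilings and perfect matchings *)

Lemma share_side_sym t u : share_side t u = share_side u t.
Proof.
rewrite /share_side.
have E (s1 s2 : seq point) : uniq s1 -> uniq s2 -> count (mem s1) s2 = count (mem s2) s1.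
  move=> u1 u2; rewrite -!size_filter; apply/perm_size/uniq_perm; rewrite ?filter_uniq //.
  by move=> x; rewrite !mem_filter andbC.
rewrite E //.
- by case: u => [[i j] []]; rewrite /= !inE !xpair_eqE; lia.
- by case: t => [[i j] []]; rewrite /= !inE !xpair_eqE; lia.
Qed.

Ltac split_eq x k :=
  let E := fresh "E" in
  case: (eqVneq x k) => [E|E] //=; try rewrite ?E //=; clear E.

(** All comparisons between vertices become comparisons of a coordinate difference with [-1], [0] or
    [1], so adjacency is settled by a finite case distinction. *)
Lemma shift_eqs (i i' : int) :
  [/\ (i == i') = (i' - i == 0), (i == i' + 1) = (i' - i == -1),
      (i + 1 == i') = (i' - i == 1) & (i + 1 == i' + 1) = (i' - i == 0)].
Proof. by split; lia. Qed.

Lemma share_side_up (p : point) (u : triangle) : share_side (up p) u =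
  [|| u == down p, u == down (p.1 - 1, p.2) | u == down (p.1, p.2 - 1)].
Proof.
case: p u => [i j] [[i' j'] s].
have [a1 a2 a3 a4] := shift_eqs i i'; have [b1 b2 b3 b4] := shift_eqs j j'.
have -> : [|| (i', j', s) == down (i, j), (i', j', s) == down (i - 1, j)
    | (i', j', s) == down (i, j - 1)] =
  ~~ s && [|| (i' - i == 0) && (j' - j == 0), (i' - i == -1) && (j' - j == 0)
            | (i' - i == 0) && (j' - j == -1)].
  by rewrite /down /= !xpair_eqE; case: s; rewrite ?andbF //= ?andbT; lia.
rewrite /share_side; case: s; rewrite /= !inE !xpair_eqE /=;
  rewrite ?a1 ?a2 ?a3 ?a4 ?b1 ?b2 ?b3 ?b4 {a1 a2 a3 a4 b1 b2 b3 b4}.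
  move: (i' - i) (j' - j) => a b;
  split_eq a (0 : int); split_eq b (0 : int); split_eq a (- 1 : int); split_eq b (- 1 : int);
  split_eq a (1 : int); split_eq b (1 : int).
move: (i' - i) (j' - j) => a b;
  split_eq a (0 : int); split_eq b (0 : int); split_eq a (- 1 : int); split_eq b (- 1 : int);
  split_eq a (1 : int); split_eq b (1 : int).
Qed.

Lemma share_side_same p q s : share_side (p, s) (q, s) = false.
Proof.
case: s; first by rewrite share_side_up /down !xpair_eqE !andbF.
have := share_side_up (p.1 + 1, p.2 + 1) (q.1 + 1, q.2 + 1, true).
rewrite /down !xpair_eqE !andbF /share_side /= => <-.
case: p q => [i j] [i' j']; rewrite /= !inE !xpair_eqE.
have [a1 a2 a3 a4] := shift_eqs i i'; have [b1 b2 b3 b4] := shift_eqs j j'.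
have [c1 c2 c3 c4] := shift_eqs (i + 1) (i' + 1).
have [d1 d2 d3 d4] := shift_eqs (j + 1) (j' + 1).
have ei : i' + 1 - (i + 1) = i' - i by lia.
have ej : j' + 1 - (j + 1) = j' - j by lia.
rewrite ?c2 ?c3 ?c4 ?d2 ?d3 ?d4 ?ei ?ej ?a1 ?a2 ?a3 ?a4 ?b1 ?b2 ?b3 ?b4.
clear.
move: (i' - i) (j' - j) => a b;
  split_eq a (0 : int); split_eq b (0 : int); split_eq a (- 1 : int); split_eq b (- 1 : int);
  split_eq a (1 : int); split_eq b (1 : int).
Qed.

Lemma share_side_down (p : point) (t : triangle) : share_side t (down p) =
  [|| t == up p, t == up (p.1 + 1, p.2) | t == up (p.1, p.2 + 1)].
Proof.
case: t => [[i j] []]; last by rewrite share_side_same /up !xpair_eqE !andbF.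
case: p => [i' j']; rewrite share_side_up /down /up !xpair_eqE /= !andbT.
have -> : (i == i' + 1) = (i' == i - 1) by lia.
have -> : (j == j' + 1) = (j' == j - 1) by lia.
by rewrite (eq_sym i) (eq_sym j).
Qed.

Section Tilings.
Variable R : {fset triangle}.
Implicit Types P : {set {set R}}.

(** Defined on all triangles, not only on those of [R], so that it can be compared with relations
    given by coordinates. *)
Definition edge P (t u : triangle) : bool :=
  [exists p : R * R, [&& val p.1 == t, val p.2 == u & [set p.1; p.2] \in P]].

Lemma edgeP P t u : reflect (exists t' u' : R, [/\ val t' = t, val u' = u &
  [set t'; u'] \in P]) (edge P t u).
Proof.
apply: (iffP existsP) => [[[t' u'] /= /and3P[/eqP h1 /eqP h2 h3]]|[t' [u' [h1 h2 h3]]]].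
  by exists t', u'.
by exists (t', u'); rewrite /= h1 h2 h3 !eqxx.
Qed.

Lemma edge_sym P t u : edge P t u = edge P u t.
Proof.
by apply/edgeP/edgeP => -[t' [u' [h1 h2 h3]]]; exists u', t'; split=> //; rewrite setUC.
Qed.

Section OfTiling.
Variable P : {set {set R}}.
Hypothesis tP : is_tiling P.

Lemma edge_mem t u : edge P t u -> t \in R /\ u \in R.
Proof. by case/edgeP => t' [u' [<- <- _]]; split; apply: valP. Qed.

Lemma edge_share t u : edge P t u -> share_side t u.
Proof.
case/edgeP => t' [u' [<- <- tuP]].
move: tP => /andP[_ /forall_inP /(_ _ tuP)].
case/existsP => a /existsP[b /andP[sab /eqP ab]].
have nab : a != b.
  apply/eqP => E; move: sab; rewrite E; case: (val b) => p s.
  by rewrite share_side_same.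
have tab : t' \in [set a; b] by rewrite -ab !inE eqxx.
have uab : u' \in [set a; b] by rewrite -ab !inE eqxx orbT.
have ntu : t' != u'.
  apply/eqP => E; have := cards2 a b; rewrite nab -ab E setUid cards1; lia.
move: tab uab ntu; rewrite !inE => /orP[] /eqP-> /orP[] /eqP->; rewrite ?eqxx //.
by rewrite share_side_sym.
Qed.

Lemma edge_ex t : t \in R -> exists u, edge P t u.
Proof.
move=> tR; pose t' : R := [` tR].
have /and3P[/eqP cov _ _] : partition P setT by case/andP: tP.
have : t' \in cover P by rewrite cov inE.
case/bigcupP => L LP tL.
move: tP => /andP[_ /forall_inP /(_ _ LP)].
case/existsP => a /existsP[b /andP[_ /eqP ab]].
move: tL; rewrite ab !inE => /orP[] /eqP E.
  by exists (val b); apply/edgeP; exists t', b; split=> //; rewrite E -ab.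
by exists (val a); apply/edgeP; exists t', a; split=> //; rewrite E setUC -ab.
Qed.

Lemma edge_uniq t u u' : edge P t u -> edge P t u' -> u = u'.
Proof.
move=> e1 e2; have s1 := edge_share e1; have s2 := edge_share e2.
case/edgeP: e1 => a [b [ha hb abP]]; case/edgeP: e2 => a' [b' [ha' hb' abP']].
have aE : a = a' by apply: val_inj; rewrite /= ha ha'.
subst a'; have /and3P[_ /trivIsetP tri _] : partition P setT by case/andP: tP.
have [E|/(tri _ _ abP abP')] := eqVneq [set a; b] [set a; b'].
  have : b \in [set a; b'] by rewrite -E !inE eqxx orbT.
  rewrite !inE => /orP[/eqP ba|/eqP bb]; last by rewrite -hb -hb' bb.
  move: s1; rewrite -ha -hb ba; case: (val a) => p s.
  by rewrite share_side_same.
by rewrite -setI_eq0 => /eqP/setP/(_ a); rewrite !inE eqxx.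
Qed.

End OfTiling.

Definition tiling_of (E : triangle -> triangle -> bool) : {set {set R}} :=
  [set [set p.1; p.2] | p in [set p : R * R | E (val p.1) (val p.2)]].

(** A perfect matching of the bipartite adjacency graph, oriented from up-pointing to down-pointing
    triangles. *)
Record matching (E : triangle -> triangle -> bool) : Prop := Matching {
  matching_up : forall t u, E t u -> t.2 && ~~ u.2;
  matching_share : forall t u, E t u -> share_side t u;
  matching_fst_ex : forall t, t \in R -> t.2 -> exists2 u, u \in R & E t u;
  matching_snd_ex : forall u, u \in R -> ~~ u.2 -> exists2 t, t \in R & E t u;
  matching_fst_uniq : forall t u u', E t u -> E t u' -> u = u';
  matching_snd_uniq : forall t t' u, E t u -> E t' u -> t = t' }.

Lemma tiling_of_matching E : matching E -> is_tiling (tiling_of E).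
Proof.
move=> mE; have [mup msh mf ms mfu msu] := mE.
apply/andP; split; last first.
  apply/forall_inP => L /imsetP[[t u]]; rewrite inE /= => Etu ->.
  by apply/existsP; exists t; apply/existsP; exists u; rewrite msh //=.
apply/and3P; split.
- apply/eqP/setP => t; rewrite [RHS]inE; apply/bigcupP.
  have tR : val t \in R by apply: valP.
  case ts : (val t).2.
    have [u uR Etu] := mf _ tR ts.
    exists [set t; [` uR]]; last by rewrite !inE eqxx.
    by apply/imsetP; exists (t, [` uR]) => //; rewrite inE /=.
  have [u uR Etu] := ms _ tR (negbT ts).
  exists [set [` uR]; t]; last by rewrite !inE eqxx orbT.
  by apply/imsetP; exists ([` uR], t) => //; rewrite inE /=.
- apply/trivIsetP => L1 L2 /imsetP[[t u]]; rewrite inE /= => E1 ->.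
  case/imsetP => [[t' u']]; rewrite inE /= => E2 -> neq.
  have /andP[tu uu] := mup _ _ E1; have /andP[tu' uu'] := mup _ _ E2.
  rewrite -setI_eq0; apply/eqP/setP => x; rewrite !inE; apply/negbTE/negP.
  case/andP => /orP[] /eqP-> /orP[] /eqP Ex; move: neq; rewrite ?Ex ?eqxx //.
  + subst t'; have -> : u' = u by apply: val_inj; apply: mfu E2 E1.
    by rewrite eqxx.
  + by move: tu; rewrite Ex (negbTE uu').
  + by move: uu; rewrite Ex tu'.
  + subst u'; have -> : t' = t by apply: val_inj; apply: msu E2 E1.
    by rewrite eqxx.
- apply/negP => /imsetP[[t u] _ /setP/(_ t)].
  by rewrite !inE eqxx.
Qed.

Lemma edge_tiling_of E (t u : triangle) : matching E -> t.2 -> t \in R -> u \in R ->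
  edge (tiling_of E) t u = E t u.
Proof.
move=> mE t2 tR uR; have [mup _ _ _ _ _] := mE.
apply/edgeP/idP => [[t' [u' [ht hu /imsetP[[a b]]]]]|Etu].
  rewrite inE /= => Eab E2; have /andP[au bu] := mup _ _ Eab.
  have : t' \in [set a; b] by rewrite -E2 !inE eqxx.
  rewrite !inE => /orP[/eqP ta|/eqP tb]; last by move: t2; rewrite -ht tb (negbTE bu).
  have : b \in [set t'; u'] by rewrite E2 !inE eqxx orbT.
  rewrite !inE => /orP[/eqP bt|/eqP bu'].
    by move: bu; rewrite bt ht t2.
  by rewrite -ht -hu ta -bu'.
exists [` tR], [` uR]; split=> //.
by apply/imsetP; exists ([` tR], [` uR]) => //; rewrite inE /=.
Qed.

(** Orienting the pairs loses nothing: triangles that share a side point in opposite directions, so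
    every lozenge contains exactly one up-pointing triangle. *)
Lemma tiling_of_edge P : is_tiling P ->
  P = tiling_of (fun t u => t.2 && edge P t u).
Proof.
move=> tP; apply/setP => L; apply/idP/imsetP => [LP|[[t u]]].
  have LP' := LP; move: tP => /andP[_ /forall_inP /(_ _ LP)].
  case/existsP => a /existsP[b /andP[sab /eqP ab]].
  case au : (val a).2.
    by exists (a, b) => //; rewrite inE /= au; apply/edgeP; exists a, b; rewrite -ab.
  exists (b, a); last by rewrite ab setUC.
  rewrite inE /=; apply/andP; split; last first.
    by apply/edgeP; exists b, a; rewrite setUC -ab.
  case b2 : (val b).2 => //; move: sab.
  by rewrite [val a]surjective_pairing [val b]surjective_pairing au b2 share_side_same.
rewrite inE /= => /andP[_ /edgeP[t' [u' [ht hu tuP]]]] ->.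
by rewrite -(val_inj ht) -(val_inj hu).
Qed.

End Tilings.

Lemma leq_M (R1 R2 : {fset triangle}) (f : R1 -> R2) (g : R2 -> R1) :
  cancel f g -> cancel g f ->
  (forall t u, share_side (val (f t)) (val (f u)) = share_side (val t) (val u)) ->
  (M R1 <= M R2)%N.
Proof.
move=> fK gK fs; have f_inj := can_inj fK.
pose F (P : {set {set R1}}) : {set {set R2}} := [set f @: (L : {set R1}) | L in P].
have F_inj : injective F by apply: imset_inj; apply: imset_inj.
rewrite /M -(card_imset _ F_inj); apply: subset_leq_card; apply/subsetP => Q.
case/imsetP => P; rewrite !inE => /andP[pP lP] ->; apply/andP; split.
  have -> : [set: R2] = f @: setT.
    by apply/setP => y; rewrite inE; apply/esym/imsetP; exists (g y).
  by rewrite imset_partition.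
apply/forall_inP => L' /imsetP[L LP ->].
move/forall_inP: lP => /(_ _ LP) /existsP[t /existsP[u /andP[s /eqP->]]].
apply/existsP; exists (f t); apply/existsP; exists (f u).
by rewrite fs s /= imsetU !imset_set1.
Qed.

(** * Tilings and arrays of interlacing rows *)

Section NatPatterns.
Local Open Scope nat_scope.

Section Count.
Variable w : nat.
Local Notation T := {set 'I_w}.
Variable ok : nat -> T -> bool.

Definition pattern_ok J (g : {ffun 'I_J.+1 -> T}) : bool :=
  [forall i : 'I_J.+1, ok i (g i)] &&
  [forall i : 'I_J, interlaces (g (inord i)) (g (inord i.+1))].

Definition patterns J (S : T) : {set {ffun 'I_J.+1 -> T}} :=
  [set g | pattern_ok g && (g ord_max == S)].

(** Deleting the last row of a pattern is inverse to [ext], and the patterns of the lower height are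
    sorted by their last row. *)
Lemma weight_patterns J S : weight ok J S = #|patterns J S|.
Proof.
elim: J S => [|J IH] S.
  rewrite /= muln1; have [okS|nok] := boolP (ok 0 S).
    rewrite (_ : patterns 0 S = [set [ffun=> S]]) ?cards1 //.
    apply/setP => g; rewrite !inE; apply/idP/eqP => [/andP[_ /eqP gS]|->].
      by apply/ffunP => i; rewrite ffunE -gS; congr (g _); apply/val_inj; rewrite /= ord1.
    rewrite ffunE eqxx andbT; apply/andP; split; last by apply/forallP => -[].
    by apply/forallP => i; rewrite ffunE ord1.
  rewrite (_ : patterns 0 S = set0) ?cards0 //.
  apply/setP => g; rewrite !inE; apply/negbTE; apply: contra nok.
  by case/andP => /andP[/forallP/(_ ord_max) h _] /eqP <-.
rewrite /=; have [okS|nok] := boolP (ok J.+1 S); last first.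
  rewrite mul0n; apply/esym/eqP; rewrite cards_eq0; apply/eqP/setP => g.
  rewrite !inE; apply/negbTE; apply: contra nok.
  by case/andP => /andP[/forallP/(_ ord_max) h _] /eqP <-.
rewrite mul1n.
pose B := [set g : {ffun 'I_J.+1 -> T} | pattern_ok g && interlaces (g ord_max) S].
pose ext (g : {ffun 'I_J.+1 -> T}) : {ffun 'I_J.+2 -> T} :=
  [ffun i : 'I_J.+2 => if (i < J.+1)%N then g (inord i) else S].
have extE g j : (j < J.+1)%N -> ext g (inord j) = g (inord j).
  by move=> jJ; rewrite ffunE inordK ?jJ // ltnW.
have extM g : ext g ord_max = S by rewrite ffunE ltnn.
have ext_inj : injective ext.
  move=> g h E; apply/ffunP => i; have := congr1 (fun f : {ffun 'I_J.+2 -> T} => f (inord i)) E.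
  by rewrite !extE // inord_val.
have -> : patterns J.+1 S = ext @: B.
  apply/setP => g; apply/idP/imsetP => [|[h]].
    rewrite inE => /andP[/andP[/forallP g1 /forallP g2] /eqP gS].
    pose h : {ffun 'I_J.+1 -> T} := [ffun i : 'I_J.+1 => g (inord i)].
    exists h; last first.
      apply/ffunP => i; rewrite ffunE; case: ifP => iJ; first by rewrite ffunE inordK ?inord_val.
      rewrite -gS; congr (g _); apply: val_inj => /=; have := ltn_ord i; lia.
    rewrite inE; apply/andP; split; first (apply/andP; split).
    + apply/forallP => i; rewrite ffunE; have := g1 (inord i).
      by rewrite inordK //; have := ltn_ord i; lia.
    + apply/forallP => i; have iJ : i < J.+1 by have := ltn_ord i; lia.
      have iJ' : i.+1 < J.+1 by have := ltn_ord i; lia.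
      by rewrite !ffunE !inordK //; have := g2 (Ordinal iJ).
    + rewrite ffunE /= -gS; have := g2 ord_max => /=.
      by rewrite (_ : inord J.+1 = ord_max) //; apply: val_inj; rewrite /= inordK.
  rewrite !inE => /andP[/andP[/forallP h1 /forallP h2] h3] ->.
  rewrite extM eqxx andbT; apply/andP; split; apply/forallP => i.
    rewrite ffunE; case: ifP => iJ; first by have := h1 (inord i); rewrite inordK.
    by have -> : (i : nat) = J.+1 by have := ltn_ord i; lia.
  have [iJ|iJ] := ltnP i J.
    by rewrite !extE //; first exact: (h2 (Ordinal iJ)); rewrite ltnW.
  have iE : (i : nat) = J by have := ltn_ord i; lia.
  rewrite iE extE // (_ : inord J.+1 = ord_max) ?extM; last by apply: val_inj; rewrite /= inordK.
  by rewrite (_ : inord J = ord_max) //; apply: val_inj; rewrite /= inordK.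
rewrite card_imset // -sum1_card.
rewrite (partition_big (fun g : {ffun 'I_J.+1 -> T} => g ord_max) (fun S' => interlaces S' S)) /=; last first.
  by move=> g; rewrite inE => /andP[].
apply: eq_bigr => S' iS'; rewrite IH -sum1_card; apply: eq_bigl => g.
by rewrite !inE; case: eqP => [->|]; rewrite ?andbF // iS' !andbT.
Qed.

End Count.

Section Count2.
Variable w : nat.
Implicit Types S : {set 'I_w}.

Lemma cnt0 S : cnt S 0 = (0 \in entries S).
Proof.
rewrite cntE -count_uniq_mem ?entries_uniq //; apply: eq_count => x /=.
by rewrite leqn0.
Qed.

Lemma cntS S c : cnt S c.+1 = cnt S c + (c.+1 \in entries S).
Proof.
rewrite !cntE -count_uniq_mem ?entries_uniq // -count_predUI.
rewrite [X in _ + X](@eq_count _ _ pred0) ?count_pred0 ?addn0; last first.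
  by move=> x /=; lia.
by apply: eq_count => x /=; lia.
Qed.

Lemma cnt_full S c : w <= c.+1 -> cnt S c = #|S|.
Proof.
move=> wc; congr #|pred_of_set _|; apply/setP => x; rewrite inE.
by have := ltn_ord x; case: (x \in S) => //=; lia.
Qed.

Lemma interlaces_cnt S' S c : interlaces S' S -> c < w ->
  [/\ cnt S' c <= cnt S c, cnt S c <= (cnt S' c).+1
    & (c \in entries S') -> cnt S c = cnt S' c].
Proof.
move=> /forallP h cw; have /and3P[h1 h2 /implyP h3] := h (Ordinal cw); split=> //.
by rewrite -[c]/(val (Ordinal cw)) mem_entries => /h3/eqP.
Qed.

Lemma entries_set (s : pred nat) c : (c \in entries [set x : 'I_w | s x]) = (c < w) && s c.
Proof.
apply/mapP/andP => [[i]|[cw sc]].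
  by rewrite mem_enum inE => si ->; split=> //; apply: ltn_ord.
by exists (Ordinal cw); rewrite // mem_enum inE.
Qed.

End Count2.

Section System.
Variables (N n k0 x0 : nat).
Let w := n + 2 * N.

(** The unit segments at height [j] inside the hexagon, where [c] names the segment with left
    endpoint [(c - j, j)]. Truncated subtraction yields the left border [0] for [j <= N]. *)
Definition in_line (j c : nat) : bool := (j - N <= c) && (c < n + minn j N).

(** [V j c] stands for a vertical lozenge across segment [c] of line [j]. [L j c] and [R j c] say
    that the up-pointing triangle on this segment is paired with the down-pointing triangle hanging
    from segment [c], respectively [c + 1], of line [j + 1]. [sysU] and [sysD] state that each
    triangle is covered exactly once. *)
Record system (V L R : nat -> nat -> bool) : Prop := System {
  sysU : forall j c, j < 2 * N -> in_line j c -> V j c + L j c + R j c = 1;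
  sysD : forall j c, j < 2 * N -> in_line j.+1 c ->
    V j.+1 c + L j c + (if c is c'.+1 then R j c' else false) = 1;
  sysV : forall j c, V j c -> in_line j c && (0 < j < 2 * N);
  sysL : forall j c, L j c -> [&& j < 2 * N, in_line j c & in_line j.+1 c];
  sysR : forall j c, R j c -> [&& j < 2 * N, in_line j c & in_line j.+1 c.+1] }.

(** Outside the hexagon virtual lozenges fill the positions [c < n + j]. All rows then live in the
    same width, row [j] gets exactly [j] entries, and the last row becomes the two blocks of
    [top_row]. *)
Definition filled (V : nat -> nat -> bool) (j c : nat) : bool :=
  if in_line j c then V j c else c < n + j.

Definition row_of V j : {set 'I_w} := [set c : 'I_w | filled V j c].

Definition pattern_of V : {ffun 'I_(2 * N).+1 -> {set 'I_w}} :=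
  [ffun j : 'I_(2 * N).+1 => row_of V j].

Section ToPattern.
Variables V L R : nat -> nat -> bool.
Hypothesis sys : system V L R.

Definition right_of (j c : nat) : bool := if in_line j c then R j c else n + j <= c.

(** Inside the hexagon, [sysD] and [sysU] both express [1 - L j c], which is thereby eliminated. The
    other cases check that the virtual values continue this conservation law across the borders. *)
Lemma filled_step j c : j < 2 * N ->
  filled V j.+1 c + (if c is c'.+1 then right_of j c' else false)
  = filled V j c + right_of j c.
Proof.
move=> jN; have [sU sD sV sL sR] := sys.
rewrite /filled /right_of.
have hD := sD j c jN; have hU := sU j c jN; have hL := sL j c; have hR := sR j c.
case i1 : (in_line j c) hU hL hR => hU hL hR; case i2 : (in_line j.+1 c) hD hL => hD hL.
- have {}hD := hD isT; have {}hU := hU isT.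
  case: c i1 i2 hD hU hL hR => [|c] i1 i2 hD hU hL hR; first by lia.
  case i3 : (in_line j c); first by lia.
  have hR' := sR j c; rewrite i3 /= andbF in hR'.
  have : R j c = false by apply/negbTE/negP => /hR'.
  move: i1 i2 i3; rewrite /in_line; lia.
- have {}hU := hU isT; have nL : L j c = false.
    by apply/negbTE/negP => /hL; rewrite /= andbF.
  case: c i1 i2 hU nL {hD hL hR} => [|c] i1 i2 hU nL; first by move: i1 i2; rewrite /in_line; lia.
  case i3 : (in_line j c).
    have hR' := sR j c; rewrite i2 !andbF in hR'.
    have : R j c = false by apply/negbTE/negP => /hR'.
    move: i1 i2 i3; rewrite /in_line; lia.
  move: i1 i2 i3; rewrite /in_line; lia.
- have {}hD := hD isT; have nL : L j c = false.
    by apply/negbTE/negP => /hL; rewrite /= andbF.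
  case: c i1 i2 hD nL {hU hL hR} => [|c] i1 i2 hD nL; first by move: i1 i2; rewrite /in_line; lia.
  have i3 : in_line j c by move: i1 i2; rewrite /in_line; lia.
  rewrite i3; move: i1 i2; rewrite /in_line; lia.
- case: c i1 i2 {hD hU hL hR} => [|c] i1 i2; first by move: i1 i2; rewrite /in_line; lia.
  case i3 : (in_line j c).
    have hR' := sR j c; rewrite i2 !andbF in hR'.
    have : R j c = false by apply/negbTE/negP => /hR'.
    move: i1 i2 i3; rewrite /in_line; lia.
  move: i1 i2 i3; rewrite /in_line; lia.
Qed.

(** The relation of [filled_step] telescopes over the positions up to [c]. *)
Lemma cnt_row_step j c : j < 2 * N -> c < w ->
  cnt (row_of V j.+1) c = cnt (row_of V j) c + right_of j c.
Proof.
move=> jN; elim: c => [|c IH] cw.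
  by rewrite !cnt0 !entries_set cw /=; have := filled_step 0 jN; lia.
rewrite !cntS IH; last exact: ltnW.
by rewrite !entries_set cw /=; have := filled_step c.+1 jN; lia.
Qed.

Lemma card_row j : 0 < n -> j <= 2 * N -> #|row_of V j| = j.
Proof.
move=> n0; elim: j => [|j IH] jN.
  apply/eqP; rewrite cards_eq0; apply/eqP/setP => c; rewrite !inE /filled.
  have := sysV sys (j := 0) (c := c); rewrite andbF.
  by case: ifP => h1 h2; [apply/negbTE/negP => /h2|move: h1; rewrite /in_line; lia].
have w0 : w.-1 < w by rewrite /w; lia.
have := cnt_row_step jN w0; rewrite !cnt_full ?IH; [|lia|lia|lia].
(* The last position lies outside the hexagon and is paired to the right, so each row has one entry
   more than the row below. *)
move=> ->; rewrite /right_of; have -> : in_line j w.-1 = false by rewrite /in_line /w; lia.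
have -> : n + j <= w.-1 by rewrite /w; lia.
by rewrite addn1.
Qed.

Lemma row_interlaces j : j < 2 * N -> interlaces (row_of V j) (row_of V j.+1).
Proof.
move=> jN; apply/forallP => c; have cw := ltn_ord c.
rewrite cnt_row_step //; apply/and3P; split; [lia|by case: (right_of _ _); lia|].
apply/implyP; rewrite inE /filled /right_of => h.
case: ifP h => i1 h; last first.
  have -> : (n + j <= c) = false by lia.
  by rewrite addn0.
by have := sysU sys jN i1; rewrite h; case: (R j c); rewrite ?addn0 //; lia.
Qed.

End ToPattern.

Section OfPattern.
Variable g : {ffun 'I_(2 * N).+1 -> {set 'I_w}}.
Hypothesis g_card : forall j, j <= 2 * N -> #|g (inord j)| = j.
Hypothesis g_int : forall j, j < 2 * N -> interlaces (g (inord j)) (g (inord j.+1)).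
Hypothesis g_top : forall c, (c \in entries (g (inord (2 * N)))) =
  (c < N) || (n + N <= c < w).
Hypothesis n0 : 0 < n.

Definition spot j c := c \in entries (g (inord j)).
Definition jump j c := cnt (g (inord j.+1)) c - cnt (g (inord j)) c.

Lemma jump_facts j c : j < 2 * N -> c < w ->
  [/\ jump j c <= 1, spot j c -> jump j c = 0
    & spot j.+1 c + (if c is c'.+1 then jump j c' else 0) = spot j c + jump j c].
Proof.
move=> jN cw; have [h1 h2 h3] := interlaces_cnt (g_int jN) cw.
rewrite /jump /spot; split; [lia|by move=> /h3 ->; rewrite subnn|].
case: c cw h1 h2 h3 => [|c] cw h1 h2 h3.
  by move: h1; rewrite !cnt0 /=; lia.
have [k1 k2 _] := interlaces_cnt (g_int jN) (ltnW cw).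
by move: h1; rewrite !cntS /=; lia.
Qed.

(** Only the last row is prescribed, so the induction descends from it. The jumps from [n + j] on
    equal one, starting at the right end, where the counts are the cardinalities; further left, two
    adjacent entries in the row above force an entry in row [j]. *)
Lemma virtual j : j <= 2 * N ->
  (forall c, c < w -> ~~ in_line j c -> spot j c = (c < n + j)) /\
  (j < 2 * N -> forall c, n + j <= c -> c < w -> jump j c = 1).
Proof.
move=> jN; rewrite -(subKn jN); move: (2 * N - j) (leq_subr j (2 * N)) => i {j jN}.
elim: i => [|i IH] iN.
  rewrite subn0 ltnn; split=> // c cw; rewrite /spot g_top /in_line /w; lia.
have {IH} [IH _] := IH (ltnW iN).
have jE : 2 * N - i = (2 * N - i.+1).+1 by lia.
move: IH; rewrite jE; set j := 2 * N - i.+1 => IH.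
have jN : j < 2 * N by rewrite /j; lia.
have J1 c : n + j <= c -> c < w -> jump j c = 1.
  move=> njc cw; have [d dE] : exists d, c + d = w.-1 by exists (w.-1 - c); lia.
  elim: d c njc cw dE => [|d IHd] c njc cw cd.
    rewrite /jump !cnt_full ?g_card; lia.
  have c1w : c.+1 < w by lia.
  have /= [q1 q2 q3] := jump_facts jN c1w.
  have nl : ~~ in_line j.+1 c.+1 by rewrite /in_line; lia.
  have := IH _ c1w nl; have := IHd c.+1 ltac:(lia) c1w ltac:(lia); lia.
split=> // c cw nin; have [q1 q2 q3] := jump_facts jN cw.
have [njc|cnj] := leqP (n + j) c.
  by have := J1 c njc cw; case: (spot j c) q2 => // /(_ isT) -> .
have c1w : c.+1 < w by rewrite /w; lia.
have /= [p1 p2 p3] := jump_facts jN c1w.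
have nl1 : ~~ in_line j.+1 c by move: nin; rewrite /in_line; lia.
have nl2 : ~~ in_line j.+1 c.+1 by move: nin; rewrite /in_line; lia.
have s1 := IH _ cw nl1; have s2 := IH _ c1w nl2.
have v1 : spot j.+1 c by rewrite s1; lia.
have v2 : spot j.+1 c.+1 by rewrite s2; lia.
have jc : jump j c = 0.
  by move: p2 p3; rewrite v2; case: (spot j c.+1) => [/(_ isT)|_]; lia.
by move: q3; rewrite v1 jc; case: (spot j c) => //; lia.
Qed.

Definition patV j c := [&& j <= 2 * N, in_line j c & spot j c].
Definition patL j c := [&& j < 2 * N, in_line j c, ~~ spot j c & jump j c == 0].
Definition patR j c := [&& j < 2 * N, in_line j c, ~~ spot j c & jump j c == 1].

Lemma in_line_lt j c : j <= 2 * N -> in_line j c -> c < w.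
Proof. by rewrite /in_line /w; lia. Qed.

Lemma system_of_pattern : system patV patL patR.
Proof.
split.
- move=> j c jN i1; rewrite /patV /patL /patR jN (ltnW jN) i1 /=.
  have [q1 _ _] := jump_facts jN (in_line_lt (ltnW jN) i1).
  by case: (spot j c) => //=; case: (jump j c) q1 => [|[|?]].
- move=> j c jN i2; have cw := in_line_lt jN i2.
  have [q1 q2 q3] := jump_facts jN cw; have [vj Jj] := virtual (ltnW jN).
  rewrite /patV jN i2 /=.
  have Rc : (if c is c'.+1 then patR j c' else false) =
            (if c is c'.+1 then jump j c' else 0) :> nat.
    case: c i2 cw {q1 q2 q3} => [|c] i2 cw //.
    have [p1 p2 _] := jump_facts jN (ltnW cw).
    rewrite /patR jN /=; case i3 : (in_line j c) => /=.
      by case: (spot j c) p2 => [/(_ isT) ->|_] //=; case: (jump j c) p1 => [|[|?]].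
    have cn : c < n + j by move: i2 i3; rewrite /in_line; lia.
    have sc : spot j c by rewrite (vj _ (ltnW cw)) ?i3.
    by rewrite p2.
  rewrite Rc /patL jN /=; case i1 : (in_line j c) => /=.
    by case: (spot j c) q2 q3 => [/(_ isT) ->|_] /=; case: (jump j c) q1 => [|[|?]] //=; lia.
  have nc : n + j <= c by move: i2 i1; rewrite /in_line; lia.
  have := vj _ cw (negbT i1); have := Jj jN _ nc cw; lia.
- move=> j c /and3P[jN i1 s1]; rewrite i1 /=.
  have [j0|j0] := posnP j.
    move: s1; rewrite /spot j0; have /eqP := g_card (leq0n (2 * N)).
    by rewrite cards_eq0 => /eqP->; rewrite /entries enum_set0.
  move: jN; rewrite leq_eqVlt => /orP[/eqP jE|//].
  by move: s1 i1; rewrite jE /spot g_top /in_line /w; lia.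
- move=> j c /and4P[jN i1 s1 /eqP r0]; rewrite jN i1 /=.
  have cw := in_line_lt (ltnW jN) i1; have [q1 q2 q3] := jump_facts jN cw.
  apply/negPn/negP => i2; have [vj _] := virtual (j := j.+1) jN.
  have := vj _ cw i2; move: q3; rewrite r0 (negbTE s1).
  by move: i1 i2; rewrite /in_line; lia.
- move=> j c /and4P[jN i1 s1 /eqP r1]; rewrite jN i1 /=.
  have cw := in_line_lt (ltnW jN) i1; apply/negPn/negP => i2.
  have c1w : c.+1 < w by move: i1; rewrite /in_line /w; lia.
  have /= [q1 q2 q3] := jump_facts jN c1w; have [vj _] := virtual (j := j.+1) jN.
  have := vj _ c1w i2; move: q3; rewrite r1.
  case: (spot j c.+1) q2 => [/(_ isT)->|_]; move: i1 i2; rewrite /in_line; lia.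
Qed.

Lemma pattern_of_patV : pattern_of patV = g.
Proof.
apply/ffunP => j; rewrite ffunE; apply/setP => c; rewrite inE /filled /patV.
have jN : (j : nat) <= 2 * N by rewrite -ltnS.
have gE : (c \in g j) = spot j c by rewrite /spot inord_val mem_entries.
rewrite gE; case: ifP => i1; first by rewrite jN i1.
by rewrite ((virtual jN).1 c (ltn_ord c) (negbT i1)).
Qed.

End OfPattern.

End System.

End NatPatterns.

(** * Sheared coordinates and the hexagon with one lozenge removed *)

Definition upt (j c : nat) : triangle := up (c%:Z - j%:Z, j%:Z).
Definition dnt (j c : nat) : triangle := down (c%:Z - j%:Z, j%:Z - 1).

Lemma upt_inj j c j' c' : upt j c = upt j' c' -> j = j' /\ c = c'.
Proof. by move=> [h1 h2]; split; lia. Qed.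

Lemma dnt_inj j c j' c' : dnt j c = dnt j' c' -> j = j' /\ c = c'.
Proof. by move=> [h1 h2]; split; lia. Qed.

Section Hexagon.
Variables (N n k0 x0 : nat).
Local Notation H := (hexagon n N N).

Lemma upt_hexagon j c : (upt j c \in H) = (j < 2 * N)%N && in_line N n j c.
Proof. by rewrite mem_hexagon /upt /in_hexagon /in_line /=; lia. Qed.

Lemma dnt_hexagon j c : (dnt j c \in H) = (0 < j <= 2 * N)%N && in_line N n j c.
Proof. by rewrite mem_hexagon /dnt /in_hexagon /in_line /=; lia. Qed.

Lemma hexagon_upt t : t \in H -> t.2 -> exists j c : nat, t = upt j c.
Proof.
case: t => [[i j] []] //; rewrite mem_hexagon /in_hexagon /= => h _.
exists (absz j), (absz (i + j)); rewrite /upt /up; congr ((_, _), _); lia.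
Qed.

Lemma hexagon_dnt t : t \in H -> ~~ t.2 -> exists j c : nat, t = dnt j c.
Proof.
case: t => [[i j] []] //; rewrite mem_hexagon /in_hexagon /= => h _.
exists (absz (j + 1)), (absz (i + j + 1)); rewrite /dnt /down; congr ((_, _), _); lia.
Qed.

Lemma share_side_upt j c u : share_side (upt j c) u =
  [|| u == dnt j c, u == dnt j.+1 c | u == dnt j.+1 c.+1].
Proof.
rewrite share_side_up /= /dnt.
have -> : (c%:Z - j%:Z - 1, j%:Z) = (c%:Z - j.+1%:Z, j.+1%:Z - 1) by congr (_, _); lia.
have -> : (c%:Z - j%:Z, j%:Z) = (c.+1%:Z - j.+1%:Z, j.+1%:Z - 1) by congr (_, _); lia.
by case: (u == _); case: (u == _); case: (u == _).
Qed.

Definition hole (j c : nat) := (j == k0) && (c == x0).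

(** The coordinates [j], [c] are read off from [t]; the test [t == upt j c] rejects down-pointing
    triangles and negative coordinates, which [absz] would confuse with others. The vertical pair at
    the hole is left out. *)
Definition sys_edge (V L Rt : nat -> nat -> bool) (t u : triangle) : bool :=
  let j := absz t.1.2 in let c := absz (t.1.1 + t.1.2) in
  (t == upt j c) && [|| (u == dnt j c) && (V j c && ~~ hole j c),
                        (u == dnt j.+1 c) && L j c | (u == dnt j.+1 c.+1) && Rt j c].

Lemma sys_edge_upt V L Rt j c u : sys_edge V L Rt (upt j c) u =
  [|| (u == dnt j c) && (V j c && ~~ hole j c),
      (u == dnt j.+1 c) && L j c | (u == dnt j.+1 c.+1) && Rt j c].
Proof.
rewrite /sys_edge /=; have -> : absz (c%:Z - j%:Z + j%:Z) = c by lia.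
by rewrite eqxx.
Qed.

Lemma sys_edge_up V L Rt t u : sys_edge V L Rt t u -> exists j c : nat, t = upt j c.
Proof. by case/andP => /eqP h _; eexists; eexists; exact: h. Qed.

Hypothesis n0 : (0 < n)%N.
Hypothesis k0N : (0 < k0 < 2 * N)%N.
Hypothesis x0_line : in_line N n k0 x0.

Let R := H `\` [fset upt k0 x0; dnt k0 x0].

Lemma in_region t : (t \in R) = [&& t != upt k0 x0, t != dnt k0 x0 & t \in H].
Proof. by rewrite in_fsetD in_fset2 negb_or -andbA. Qed.

Lemma upt_region j c : (upt j c \in R) = [&& (j < 2 * N)%N, in_line N n j c & ~~ hole j c].
Proof.
rewrite in_region upt_hexagon /hole; have -> : (upt j c != dnt k0 x0) by apply/eqP.
rewrite /= andbC -andbA; congr (_ && (_ && ~~ _)).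
apply/eqP/andP => [/upt_inj[-> ->]|[/eqP-> /eqP->]] //; by rewrite !eqxx.
Qed.

Lemma dnt_region j c : (dnt j c \in R) = [&& (0 < j <= 2 * N)%N, in_line N n j c & ~~ hole j c].
Proof.
rewrite in_region dnt_hexagon /hole; have -> : (dnt j c != upt k0 x0) by apply/eqP.
rewrite /= andbC -andbA; congr (_ && (_ && ~~ _)).
apply/eqP/andP => [/dnt_inj[-> ->]|[/eqP-> /eqP->]] //; by rewrite !eqxx.
Qed.

Section FromTiling.
Variable P : {set {set R}}.
Hypothesis tP : is_tiling P.

(** The removed lozenge is put back, so the rows describe a tiling of the whole hexagon with that
    lozenge prescribed. *)
Definition tilV j c := edge P (upt j c) (dnt j c) || hole j c.
Definition tilL j c := edge P (upt j c) (dnt j.+1 c).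
Definition tilR j c := edge P (upt j c) (dnt j.+1 c.+1).

Lemma edge_not_hole j c u : edge P (upt j c) u -> ~~ hole j c.
Proof. by move/(edge_mem (P := P)) => [] //; rewrite upt_region => /and3P[]. Qed.

Lemma edge_not_hole' j c t : edge P t (dnt j c) -> ~~ hole j c.
Proof. by move/(edge_mem (P := P)) => [] // _; rewrite dnt_region => /and3P[]. Qed.

Lemma system_of_tiling : system N n tilV tilL tilR.
Proof.
have nd1 j c : (dnt j c == dnt j.+1 c) = false by apply/eqP => /dnt_inj[]; lia.
have nd2 j c : (dnt j c == dnt j.+1 c.+1) = false by apply/eqP => /dnt_inj[]; lia.
have nd3 j c : (dnt j.+1 c == dnt j.+1 c.+1) = false by apply/eqP => /dnt_inj[]; lia.
have nd4 j c : (dnt j.+1 c == dnt j c) = false by rewrite eq_sym.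
have nd5 j c : (dnt j.+1 c.+1 == dnt j c) = false by rewrite eq_sym.
have nd6 j c : (dnt j.+1 c.+1 == dnt j.+1 c) = false by rewrite eq_sym.
split.
- move=> j c jN i1; rewrite /tilV /tilL /tilR.
  have [h|nh] := boolP (hole j c).
    have e u : edge P (upt j c) u = false by apply/negbTE/negP => /edge_not_hole; rewrite h.
    by rewrite !e.
  have uR : upt j c \in R by rewrite upt_region jN i1.
  rewrite orbF; have [u e] := edge_ex tP uR.
  have eE u' : edge P (upt j c) u' = (u' == u).
    apply/idP/eqP => [e'|->] //; apply: (edge_uniq tP e' e).
  have := edge_share tP e; rewrite share_side_upt !eE.
  by case/or3P => /eqP ->; rewrite eqxx ?nd1 ?nd2 ?nd3 ?nd4 ?nd5 ?nd6.
- move=> j c jN i2; rewrite /tilV /tilL /tilR.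
  have [h|nh] := boolP (hole j.+1 c).
    have e t : edge P t (dnt j.+1 c) = false by apply/negbTE/negP => /edge_not_hole'; rewrite h.
    by rewrite !e; case: c {h i2} e => [|c] e //; rewrite e.
  have uR : dnt j.+1 c \in R by rewrite dnt_region jN i2 nh.
  rewrite orbF; have [t] := edge_ex tP uR; rewrite edge_sym => e.
  have eE t' : edge P t' (dnt j.+1 c) = (t' == t).
    apply/idP/eqP => [|->] //; rewrite edge_sym => e'.
    by apply: (edge_uniq tP e'); rewrite edge_sym.
  have := edge_share tP e; have [tR _] := edge_mem e.
  have nu1 : upt j.+1 c != upt j c by apply/eqP => /upt_inj[]; lia.
  rewrite share_side_down /= => h.
  have {h} : (t == upt j.+1 c) || (t == upt j c) || (if c is c'.+1 then t == upt j c' else false).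
    case/or3P: h => /eqP E; last 2 first.
    - by rewrite [t == upt j c](_ : _ = true) ?orbT //; apply/eqP; rewrite E /upt;
        congr (up (_, _)); lia.
    - by rewrite [t == upt j.+1 c](_ : _ = true) //; apply/eqP; rewrite E /upt;
        congr (up (_, _)); lia.
    case: c {i2 nh uR e eE nu1} E => [|c] E.
      (* For [c = 0] this neighbour would be at position [-1], outside the hexagon. *)
      by move: tR; rewrite in_region => /and3P[_ _]; rewrite E mem_hexagon /in_hexagon /=; lia.
    rewrite [t == upt j c](_ : _ = true) ?orbT //; apply/eqP; rewrite E /upt.
    by congr (up (_, _)); lia.
  rewrite !eE; case: c i2 nh uR e eE nu1 => [|c] i2 nh uR e eE nu1.
    by rewrite orbF => /orP[] /eqP->; rewrite eqxx ?(negbTE nu1) // eq_sym (negbTE nu1).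
  rewrite eE.
  have nu2 : upt j.+1 c.+1 != upt j c by apply/eqP => /upt_inj[]; lia.
  have nu3 : upt j c.+1 != upt j c by apply/eqP => /upt_inj[]; lia.
  case/orP => [/orP[]|] /eqP->; rewrite !eqxx.
  + by rewrite ![_ == upt j.+1 _]eq_sym (negbTE nu1) (negbTE nu2).
  + by rewrite (negbTE nu1) [_ == upt j c.+1]eq_sym (negbTE nu3).
  + by rewrite (negbTE nu2) (negbTE nu3).
- move=> j c; rewrite /tilV => /orP[e|/andP[/eqP-> /eqP->]]; last by rewrite x0_line.
  have [] := edge_mem e; rewrite upt_region dnt_region => /and3P[h1 h2 _] /and3P[h3 _ _].
  by rewrite h2 h1 andbT; lia.
- move=> j c e; have [] := edge_mem e.
  by rewrite upt_region dnt_region => /and3P[h1 h2 _] /and3P[_ h3 _]; rewrite h1 h2 h3.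
- move=> j c e; have [] := edge_mem e.
  by rewrite upt_region dnt_region => /and3P[h1 h2 _] /and3P[_ h3 _]; rewrite h1 h2 h3.
Qed.

End FromTiling.

Section ToTiling.
Variables V L Rt : nat -> nat -> bool.
Hypothesis sys : system N n V L Rt.
Hypothesis V0 : V k0 x0.

Lemma sys_excl j c : ((V j c && ~~ hole j c) + L j c + Rt j c <= 1)%N.
Proof.
have [sU sD sV sL sR] := sys.
have [i1|i1] := boolP (in_line N n j c); last first.
  have -> : V j c = false by apply/negbTE/negP => /sV; rewrite (negbTE i1).
  have -> : L j c = false by apply/negbTE/negP => /sL; rewrite (negbTE i1) andbF.
  by have -> : Rt j c = false by apply/negbTE/negP => /sR; rewrite (negbTE i1) andbF.
have [jN|jN] := ltnP j (2 * N); first by have := sU j c jN i1; case: (hole j c); lia.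
have -> : V j c = false by apply/negbTE/negP => /sV; lia.
have -> : L j c = false by apply/negbTE/negP => /sL; lia.
by have -> : Rt j c = false by apply/negbTE/negP => /sR; lia.
Qed.

Lemma hole_excl j c : hole j c -> L j c = false /\ Rt j c = false.
Proof.
case/andP => /eqP-> /eqP->; have := sysU sys (j := k0) (c := x0) ltac:(lia) x0_line.
by rewrite V0; case: (L _ _); case: (Rt _ _).
Qed.

Lemma hole_excl' j c : hole j.+1 c ->
  L j c = false /\ (if c is c'.+1 then Rt j c' else false) = false.
Proof.
case/andP => /eqP jk /eqP cx; have := sysD sys (j := j) (c := c) ltac:(lia).
rewrite jk cx x0_line V0 => /(_ isT); case: (L _ _) => //.
by case: x0 => [|y] //; case: (Rt _ _).
Qed.

Lemma excl_L j c : L j c ->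
  V j.+1 c = false /\ (if c is c'.+1 then Rt j c' else false) = false.
Proof.
move=> h; have /and3P[jN _ i2] := sysL sys h.
have := sysD sys jN i2; rewrite h; case: (V _ _) => //.
by case: c {h i2} => [|c] //; case: (Rt _ _).
Qed.

Lemma excl_R j c : Rt j c -> V j.+1 c.+1 = false /\ L j c.+1 = false.
Proof.
move=> h; have /and3P[jN _ i2] := sysR sys h.
by have := sysD sys jN i2; rewrite h; case: (V _ _); case: (L _ _).
Qed.

Lemma sys_matching : matching R (sys_edge V L Rt).
Proof.
have [sU sD sV sL sR] := sys.
split.
- by move=> t u /[dup] /sys_edge_up [j [c ->]]; rewrite sys_edge_upt => /or3P[] /andP[/eqP->].
- move=> t u /[dup] /sys_edge_up [j [c ->]]; rewrite sys_edge_upt share_side_upt.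
  by case/or3P => /andP[-> _]; rewrite ?orbT.
- move=> t tR t2; have tH : t \in H by move: tR; rewrite in_region => /and3P[].
  have [j [c tE]] := hexagon_upt tH t2; move: tR; rewrite tE upt_region => /and3P[jN i1 nh].
  have := sU j c jN i1; case v : (V j c).
    exists (dnt j c); last by rewrite sys_edge_upt eqxx v nh.
    by rewrite dnt_region i1 nh andbT; have := sV _ _ v; lia.
  case lc : (L j c).
    exists (dnt j.+1 c); last by rewrite sys_edge_upt eqxx lc orbT.
    have /and3P[_ _ i2] := sL _ _ lc; rewrite dnt_region i2 /= jN /=.
    by apply/negP => /hole_excl'[]; rewrite lc.
  case rc : (Rt j c) => // _.
  exists (dnt j.+1 c.+1); last by rewrite sys_edge_upt eqxx rc !orbT.
  have /and3P[_ _ i2] := sR _ _ rc; rewrite dnt_region i2 /= jN /=.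
  by apply/negP => /hole_excl'[]; rewrite rc.
- move=> u uR u2; have uH : u \in H by move: uR; rewrite in_region => /and3P[].
  have [[|j] [c uE]] := hexagon_dnt uH u2; move: uR; rewrite uE dnt_region // => /and3P[jN i1 nh].
  have := sD j c jN i1; case v : (V j.+1 c).
    exists (upt j.+1 c); last by rewrite sys_edge_upt eqxx v nh.
    by rewrite upt_region i1 nh andbT; have := sV _ _ v; lia.
  case lc : (L j c).
    exists (upt j c); last by rewrite sys_edge_upt eqxx lc orbT.
    have /and3P[h1 h2 _] := sL _ _ lc; rewrite upt_region h1 h2 /=.
    by apply/negP => /hole_excl[]; rewrite lc.
  case: c i1 nh v lc {uE} => [|c] i1 nh v lc //; case rc : (Rt j c) => // _.
  exists (upt j c); last by rewrite sys_edge_upt eqxx rc !orbT.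
  have /and3P[h1 h2 _] := sR _ _ rc; rewrite upt_region h1 h2 /=.
  by apply/negP => /hole_excl[_]; rewrite rc.
- move=> t u u' /[dup] /sys_edge_up [j [c ->]]; rewrite !sys_edge_upt.
  have := sys_excl j c.
  by case: (V j c && _); case: (L j c); case: (Rt j c); rewrite ?andbT ?andbF ?orbF //= => _ /eqP-> /eqP->.
- move=> t t' u /[dup] /sys_edge_up [j [c ->]] e /[dup] /sys_edge_up [j' [c' ->]] e'.
  move: e e'; rewrite !sys_edge_upt.
  case/or3P => /andP[/eqP-> h] /or3P[] /andP[/eqP/dnt_inj[ej ec] h'].
  + by rewrite ej ec.
  + by subst j c; have [vf _] := excl_L h'; rewrite vf in h.
  + by subst j c; have [vf _] := excl_R h'; rewrite vf in h.
  + by subst j' c'; have [vf _] := excl_L h; rewrite vf in h'.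
  + by case: ej => ->; rewrite ec.
  + by case: ej => ej; subst j' c; have [_ vf] := excl_R h'; rewrite vf in h.
  + by subst j' c'; have [vf _] := excl_R h; rewrite vf in h'.
  + by case: ej => ej; subst j' c'; have [_ vf] := excl_R h; rewrite vf in h'.
  + by case: ej ec => -> [->].
Qed.

End ToTiling.
End Hexagon.

(** The rows give [V]; the counting functions of consecutive rows give [R] by [cnt_row_step]; [L] is
    what [sysU] leaves over. *)
Lemma system_determined N n V L R V' L' R' :
  system N n V L R -> system N n V' L' R' -> pattern_of N n V = pattern_of N n V' ->
  [/\ V =2 V', L =2 L' & R =2 R'].
Proof.
move=> s1 s2 E.
have rE j : (j <= 2 * N)%N -> row_of N n V j = row_of N n V' j.
  move=> jN; have jN' : (j < (2 * N).+1)%N by [].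
  by have := congr1 (fun g : {ffun _} => g (Ordinal jN')) E; rewrite !ffunE.
have VE : V =2 V'.
  move=> j c; case i1 : (in_line N n j c); last first.
    transitivity false; last apply/esym.
      by apply/negbTE/negP => /(sysV s1); rewrite i1.
    by apply/negbTE/negP => /(sysV s2); rewrite i1.
  have [jN|jN] := leqP j (2 * N); last first.
    transitivity false; last apply/esym.
      by apply/negbTE/negP => /(sysV s1); lia.
    by apply/negbTE/negP => /(sysV s2); lia.
  have cw : (c < n + 2 * N)%N by move: i1; rewrite /in_line; lia.
  by have /setP/(_ (Ordinal cw)) := rE j jN; rewrite !inE /filled /= i1.
have RE : R =2 R'.
  move=> j c; case i1 : (in_line N n j c); last first.
    transitivity false; last apply/esym.
      by apply/negbTE/negP => /(sysR s1); rewrite i1 andbF.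
    by apply/negbTE/negP => /(sysR s2); rewrite i1 andbF.
  have [jN|jN] := ltnP j (2 * N); last first.
    transitivity false; last apply/esym.
      by apply/negbTE/negP => /(sysR s1); lia.
    by apply/negbTE/negP => /(sysR s2); lia.
  have cw : (c < n + 2 * N)%N by move: i1; rewrite /in_line; lia.
  have := cnt_row_step s1 jN cw; rewrite !rE ?(ltnW jN) //.
  rewrite (cnt_row_step s2 jN cw) /right_of i1.
  by case: (R j c); case: (R' j c); lia.
split=> // j c; case i1 : (in_line N n j c); last first.
  transitivity false; last apply/esym.
    by apply/negbTE/negP => /(sysL s1); rewrite i1 andbF.
  by apply/negbTE/negP => /(sysL s2); rewrite i1 andbF.
have [jN|jN] := ltnP j (2 * N); last first.
  transitivity false; last apply/esym.
    by apply/negbTE/negP => /(sysL s1); lia.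
  by apply/negbTE/negP => /(sysL s2); lia.
have := sysU s1 jN i1; have := sysU s2 jN i1; rewrite VE RE.
by case: (L j c); case: (L' j c); lia.
Qed.

Section CountTilings.
Variables (N n k0 : nat) (X0 : 'I_(n + 2 * N)).
Local Notation x0 := (nat_of_ord X0).
Hypotheses (n0 : (0 < n)%N) (k0N : (0 < k0 < 2 * N)%N) (x0_line : in_line N n k0 x0).
Local Notation R := (hexagon n N N `\` [fset upt k0 x0; dnt k0 x0]).

Lemma eq_tiling_of E E' : (forall t u, t \in R -> u \in R -> E t u = E' t u) ->
  tiling_of R E = tiling_of R E'.
Proof.
move=> EE; apply/setP => L; apply/imsetP/imsetP => -[[t u]]; rewrite inE /= => h ->;
  exists (t, u) => //; rewrite inE /=.
  by rewrite -(EE _ _ (valP t) (valP u)).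
by rewrite (EE _ _ (valP t) (valP u)).
Qed.

Lemma edge_sys_edge (P : {set {set R}}) t u : is_tiling P -> t \in R ->
  t.2 && edge P t u = sys_edge k0 x0 (tilV P) (tilL P) (tilR P) t u.
Proof.
move=> tP tR; case t2 : t.2 => /=; last first.
  by apply/esym/negbTE/negP => /sys_edge_up [j [c tE]]; rewrite tE in t2.
have tH : t \in hexagon n N N by move: tR; rewrite in_region => /and3P[].
have [j [c tE]] := hexagon_upt tH t2; subst t.
rewrite sys_edge_upt /tilV /tilL /tilR.
apply/idP/or3P => [e|[]/andP[/eqP->]] //.
  have nh := edge_not_hole e.
  have := edge_share tP e; rewrite share_side_upt => /or3P[] /eqP uE; subst u.
  - by apply: Or31; rewrite eqxx e nh.
  - by apply: Or32; rewrite eqxx e.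
  - by apply: Or33; rewrite eqxx e.
by case/andP => /orP[//|->].
Qed.

Lemma tiling_of_system (P : {set {set R}}) : is_tiling P ->
  P = tiling_of R (sys_edge k0 x0 (tilV P) (tilL P) (tilR P)).
Proof.
move=> tP; rewrite {1}(tiling_of_edge tP); apply: eq_tiling_of => t u tR uR.
exact: edge_sys_edge.
Qed.

Definition pattern_of_tiling (P : {set {set R}}) := pattern_of N n (tilV P).

Lemma pattern_of_tiling_inj :
  {in [set P : {set {set R}} | is_tiling P] &, injective pattern_of_tiling}.
Proof.
move=> P P'; rewrite !inE => tP tP' E.
have [VE LE RE] := system_determined (system_of_tiling n0 k0N x0_line tP)
                                     (system_of_tiling n0 k0N x0_line tP') E.
rewrite (tiling_of_system tP) (tiling_of_system tP'); apply: eq_tiling_of => t u _ _.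
by rewrite /sys_edge VE LE RE.
Qed.

Lemma pattern_of_tiling_ok (P : {set {set R}}) : is_tiling P ->
  pattern_of_tiling P \in patterns (pinned_row k0 X0) (2 * N) (top_row N n).
Proof.
move=> tP; have s := system_of_tiling n0 k0N x0_line tP.
rewrite inE; apply/andP; split; last first.
  rewrite ffunE; apply/eqP/setP => c; rewrite !inE /filled /=.
  have cw := ltn_ord c; have sv := sysV s (j := (2 * N)%N) (c := c).
  case: ifP => i1; last by move: i1; rewrite /in_line; lia.
  have -> : tilV P (2 * N) c = false by apply/negbTE/negP => /sv; lia.
  by move: i1; rewrite /in_line; lia.
apply/andP; split; apply/forallP => j.
  rewrite ffunE /pinned_row (card_row s) // ?eqxx /=; last by rewrite -ltnS.
  by apply/implyP => /eqP->; rewrite inE /filled x0_line /tilV /hole !eqxx orbT.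
have jN := ltn_ord j; have jN1 : (j < (2 * N).+1)%N by apply: ltnW.
by rewrite !ffunE !inordK //; apply: (row_interlaces s).
Qed.

Lemma tiling_of_pattern g : g \in patterns (pinned_row k0 X0) (2 * N) (top_row N n) ->
  exists2 P : {set {set R}}, is_tiling P & pattern_of_tiling P = g.
Proof.
rewrite inE => /andP[/andP[/forallP g1 /forallP g2] /eqP g3].
have g_card j : (j <= 2 * N)%N -> #|g (inord j)| = j.
  by move=> jN; have /andP[/eqP] := g1 (inord j); rewrite inordK.
have g_int j : (j < 2 * N)%N -> interlaces (g (inord j)) (g (inord j.+1)).
  by move=> jN; have := g2 (Ordinal jN).
have g_top c : (c \in entries (g (inord (2 * N)))) = ((c < N) || (n + N <= c < n + 2 * N))%N.
  have -> : inord (2 * N) = ord_max :> 'I_(2 * N).+1 by apply: val_inj; rewrite /= inordK.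
  by rewrite g3 (entries_set _ (fun c => (c < N) || (n + N <= c))%N); lia.
have s := system_of_pattern g_card g_int g_top n0.
have V0 : patV g k0 x0.
  rewrite /patV x0_line /spot mem_entries; have k0N' : (k0 <= 2 * N)%N by lia.
  have /andP[_ /implyP h] := g1 (inord k0); rewrite inordK // in h.
  by rewrite k0N' h.
have mE := sys_matching n0 k0N x0_line s V0.
exists (tiling_of R (sys_edge k0 x0 (patV g) (patL g) (patR g))).
  exact: tiling_of_matching.
rewrite -[RHS](pattern_of_patV g_card g_int g_top n0).
apply/ffunP => j; rewrite !ffunE; apply/setP => c; rewrite !inE /filled; case: ifP => // i1.
set P := tiling_of R _.
have jN : (j <= 2 * N)%N by rewrite -ltnS.
rewrite /tilV; have [h|nh] := boolP (hole k0 x0 j c).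
  by rewrite orbT; case/andP: h => /eqP-> /eqP->.
rewrite orbF.
have [hin|hout] := boolP ((upt j c \in R) && (dnt j c \in R)).
  case/andP: hin => h1 h2; rewrite edge_tiling_of // sys_edge_upt eqxx nh andbT /=.
  have -> : (dnt j c == dnt j.+1 c) = false by apply/eqP => /dnt_inj[]; lia.
  have -> : (dnt j c == dnt j.+1 c.+1) = false by apply/eqP => /dnt_inj[]; lia.
  by rewrite /= orbF.
have -> : edge P (upt j c) (dnt j c) = false.
  by apply/negbTE/negP => /edge_mem[h1 h2]; rewrite h1 h2 in hout.
apply/esym/negbTE/negP => /(sysV s) /andP[_ h].
by move: hout; rewrite upt_region dnt_region i1 nh; lia.
Qed.

Lemma M_weight : M R = weight (pinned_row k0 X0) (2 * N) (top_row N n).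
Proof.
rewrite weight_patterns /M -(card_in_imset pattern_of_tiling_inj).
congr #|pred_of_set _|; apply/setP => g; apply/imsetP/idP => [[P]|].
  by rewrite inE => tP ->; apply: pattern_of_tiling_ok.
by case/tiling_of_pattern => P tP <-; exists P; rewrite ?inE.
Qed.

End CountTilings.

(** * Reflection *)

Lemma vlozengeE (k x : nat) :
  vlozenge (x%:Z - k%:Z, k%:Z) = [fset upt k x; dnt k x].
Proof. by []. Qed.

(** Both ends of the vertical diagonal have double abscissa [2 i + j + 1], so the axis condition
    reads [2 i + j = 2 m] and the height [j] is even. *)
Definition axis_points (N m : nat) : seq point :=
  [seq (m%:Z + l%:Z - N%:Z, 2 * N%:Z - 2 * l%:Z) | l <- iota 1 N.-1].

(** Both lists have the same elements and strictly decreasing heights. Sorting gives weak decrease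
    only; it is strict because on the axis the height determines the point. *)
Lemma shifted_axis_lozengesE N m : (0 < m)%N -> (1 < N)%N ->
  shifted_axis_lozenges N (2 * m) = axis_points N m.
Proof.
move=> m0 N1; pose gt2 (p q : point) := q.2 < p.2.
have tr : transitive gt2 by move=> q p r; rewrite /gt2 => h1 h2; exact: lt_trans h2 h1.
have memE p : (p \in shifted_axis_lozenges N (2 * m)) = (p \in axis_points N m).
  rewrite mem_sort mem_filter mem_hexagon_box /vlozenge fsubUset !fsub1set !mem_hexagon.
  case: p => i j; rewrite /on_shifted_axis /double_abscissa /in_hexagon /=.
  apply/idP/mapP => [|[l]]; last first.
    rewrite mem_iota => h [-> ->]; repeat (apply/andP; split) => //; lia.
  case/andP => /andP[/andP[/and4P[_ _ /and3P[_ hA _] _] /and4P[/and3P[_ hB _] _ _ _]]].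
  case/andP => /eqP e1 _ _.
  exists (absz (i + N%:Z - m%:Z)%R); first by rewrite mem_iota; lia.
  by congr (_, _); lia.
apply: (irr_sorted_eq tr) => [p|||p]; first exact: ltxx.
- have srt : sorted (fun p q : point => q.2 <= p.2) (shifted_axis_lozenges N (2 * m)).
    by apply: sort_sorted => p q; apply: le_total.
  have uq : uniq (shifted_axis_lozenges N (2 * m)).
    rewrite sort_uniq filter_uniq //; apply: allpairs_uniq; last by move=> [? ?] [? ?] _ _ [-> ->].
      by rewrite map_inj_uniq ?iota_uniq // => a b; lia.
    by rewrite map_inj_uniq ?iota_uniq // => a b; lia.
  have inj2 : {in shifted_axis_lozenges N (2 * m) &, injective (fun p : point => p.2)}.
    move=> p q; rewrite !memE => /mapP[a _ ->] /mapP[b _ ->] /= h; congr (_, _); lia.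
  have le_tr : transitive (fun p q : point => q.2 <= p.2).
    by move=> q p r /= h1 h2; exact: le_trans h2 h1.
  rewrite (sorted_pairwise le_tr) in srt; rewrite (sorted_pairwise tr).
  apply: (@sub_in_pairwise _ (mem (shifted_axis_lozenges N (2 * m)))
     (fun p q : point => (q.2 <= p.2) && (p != q))).
  + move=> p q pin qin /andP[h1 h2]; rewrite /gt2 lt_neqAle h1 andbT.
    by apply: contra h2 => /eqP h; apply/eqP; apply: inj2.
  + by apply/allP.
  + by rewrite pairwise_relI srt -uniq_pairwise.
- rewrite /axis_points (sorted_pairwise tr) pairwise_map.
  have := iota_ltn_sorted 1 N.-1; rewrite (sorted_pairwise ltn_trans).
  by apply: sub_pairwise => a b /=; rewrite /gt2 /=; lia.
- exact: memE.
Qed.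

(** Induced by [(i, j) |-> (i + j - N, 2 N - j)], the reflection of lattice points in the horizontal
    symmetry axis. The corrections by [1] occur because the point naming a down-pointing triangle
    lies one unit below its upper left vertex in the lattice coordinate [j]. *)
Definition reflect_triangle (N : nat) (t : triangle) : triangle :=
  ((t.1.1 + t.1.2 - N%:Z + (if t.2 then 0 else 1), 2 * N%:Z - 1 - t.1.2), ~~ t.2).

Lemma reflect_triangleK N : involutive (reflect_triangle N).
Proof.
by move=> [[i j] []]; rewrite /reflect_triangle /=; congr ((_, _), _); lia.
Qed.

Lemma share_side_reflect N t u :
  share_side (reflect_triangle N t) (reflect_triangle N u) = share_side t u.
Proof.
have up_case p v : share_side (reflect_triangle N (up p)) (reflect_triangle N v) = share_side (up p) v.
  rewrite share_side_sym -[reflect_triangle N (up p)]/(down _) share_side_down share_side_up /=.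
  case: p v => i j [[i' j'] s]; rewrite /reflect_triangle /up /down /= !xpair_eqE.
  case: s => /=; rewrite ?andbF // !andbT.
  apply/idP/idP; case/or3P => /andP[/eqP h1 /eqP h2]; lia.
case: t => p [] //; first exact: up_case.
case: u => q []; first by rewrite share_side_sym up_case share_side_sym.
by rewrite !share_side_same.
Qed.

Lemma M_reflect N (R1 R2 : {fset triangle}) :
  (forall t, (reflect_triangle N t \in R2) = (t \in R1)) -> M R1 = M R2.
Proof.
move=> RR; have R12 (t : R1) : reflect_triangle N (val t) \in R2 by rewrite RR; apply: valP.
have R21 (t : R2) : reflect_triangle N (val t) \in R1.
  by rewrite -RR reflect_triangleK; apply: valP.
pose f (t : R1) : R2 := [` R12 t]; pose g (t : R2) : R1 := [` R21 t].
have fK : cancel f g by move=> t; apply: val_inj; rewrite /= reflect_triangleK.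
have gK : cancel g f by move=> t; apply: val_inj; rewrite /= reflect_triangleK.
by apply/eqP; rewrite eqn_leq (leq_M fK gK) ?(leq_M gK fK) // => t u; apply: share_side_reflect.
Qed.

Lemma V'E N m l : (0 < m)%N -> (0 < l < N)%N ->
  V' N (2 * m) l = hexagon (2 * m) N N `\`
    [fset upt (2 * N - 2 * l) (m + N - l); dnt (2 * N - 2 * l) (m + N - l)].
Proof.
move=> m0 lN; have N1 : (1 < N)%N by lia.
rewrite -vlozengeE /V' (shifted_axis_lozengesE m0 N1).
have -> : nth (0, 0) (axis_points N m) l.-1 =
    ((m + N - l)%N%:Z - (2 * N - 2 * l)%N%:Z, (2 * N - 2 * l)%N%:Z); last by reflexivity.
rewrite (nth_map 0%N) ?size_iota; last by lia.
rewrite nth_iota; last by lia.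
by congr (_, _); lia.
Qed.

Lemma hexagon_reflect N n t :
  (reflect_triangle N t \in hexagon n N N) = (t \in hexagon n N N).
Proof.
have imp u : u \in hexagon n N N -> reflect_triangle N u \in hexagon n N N.
  case: u => [[i j] s]; rewrite !mem_hexagon /reflect_triangle /in_hexagon.
  case: s => /= /and4P[/and3P[/andP[a1 a2] /andP[a3 a4] /andP[a5 a6]]
    /and3P[/andP[b1 b2] /andP[b3 b4] /andP[b5 b6]]
    /and3P[/andP[c1 c2] /andP[c3 c4] /andP[c5 c6]] _];
    repeat (apply/andP; split) => //; lia.
by apply/idP/idP => /imp //; rewrite reflect_triangleK.
Qed.

Lemma reflect_upt N k x k' x' : (k + k' = 2 * N)%N -> (x + N = x' + k)%N ->
  reflect_triangle N (upt k x) = dnt k' x'.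
Proof.
by move=> h1 h2; rewrite /reflect_triangle /upt /dnt /up /down /=; congr ((_, _), _); lia.
Qed.

(** The axis carries [N - 1] lozenges, so the [l]-th from the top is reflected to the one that is
    [N - l]-th from the top. *)
Lemma M_V'_reflect N m l : (0 < m)%N -> (0 < l < N)%N ->
  M (V' N (2 * m) l) = M (V' N (2 * m) (N - l)).
Proof.
move=> m0 lN; have lN' : (0 < N - l < N)%N by lia.
rewrite (V'E m0 lN) (V'E m0 lN').
set k := (2 * N - 2 * l)%N; set x := (m + N - l)%N.
set k' := (2 * N - 2 * (N - l))%N; set x' := (m + N - (N - l))%N.
have E1 : reflect_triangle N (upt k x) = dnt k' x'.
  by apply: reflect_upt; rewrite /k /k' /x /x'; lia.
have E2 : reflect_triangle N (dnt k x) = upt k' x'.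
  rewrite -(@reflect_upt N k' x') ?reflect_triangleK //; rewrite /k /k' /x /x'; lia.
have r_inj := inv_inj (@reflect_triangleK N).
apply: (@M_reflect N) => t; rewrite !in_fsetD !in_fset2 hexagon_reflect -E1 -E2.
by rewrite !(inj_eq r_inj) orbC.
Qed.

(** The sum over all [e < N] vanishes, hence the first [N - l] terms are balanced by the last [l],
    which are the negatives of the first [l]. *)
Lemma antisymmetric_sum (N l : nat) (F : nat -> rat) : (l <= N)%N ->
  (forall e, (e < N)%N -> F (N - e.+1)%N = - F e) ->
  \sum_(e < l) F e = \sum_(e < N - l) F e.
Proof.
move=> lN anti.
have rev k : (k <= N)%N -> \sum_(N - k <= e < N) F e = - \sum_(e < k) F e.
  move=> kN; rewrite -{1}[(N - k)%N]add0n big_addn subKn // big_mkord.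
  rewrite (reindex_inj rev_ord_inj) -sumrN; apply: eq_bigr => e _ /=.
  by rewrite -anti; [congr F|]; have := ltn_ord e; lia.
have total : \sum_(0 <= e < N) F e = 0.
  have := rev N (leqnn N); rewrite subnn -(big_mkord xpredT F) => /eqP.
  by rewrite -addr_eq0 -mulr2n mulrn_eq0 => /eqP.
have := rev (N - l)%N (leq_subr _ _); rewrite subKn // => E.
apply/eqP; rewrite -subr_eq0 -E -(big_mkord xpredT F) -big_cat_nat //.
by rewrite total.
Qed.

Lemma centbin_neq0 N : (0 < N)%N -> centbin N != 0.
Proof.
by move=> N0; rewrite centbinE // mulf_neq0 ?invr_eq0 ?expf_neq0 ?fact_neq0.
Qed.

Lemma halfbin_sym N e : (e < N)%N -> halfbin N (N - e.+1) = halfbin N e.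
Proof.
move=> eN; have N0 : (0 < N)%N by lia.
apply: (mulIf (centbin_neq0 N0)); rewrite !halfbinE; [|lia|lia].
have -> : (N - (N - e.+1).+1 = e)%N by lia.
by congr (_ / _); rewrite mulrC.
Qed.

(** Under [e |-> N - 1 - e] both [halfbin] and the denominators are invariant, while [N - 2 e - 1]
    changes sign. *)
Lemma sigma1_sym N m l : (0 < m)%N -> (l <= N)%N -> sigma1 N m (N - l) = sigma1 N m l.
Proof.
move=> m0 lN; rewrite !sigmaE /sigma.
have rE e : (e < N)%N -> (N - e.+1)%:R = N%:R - e%:R - 1 :> rat.
  by move=> eN; rewrite natrB // -natr1; ring.
congr (_ * _ + _ * _); apply/esym.
  apply: (@antisymmetric_sum N l (fun e => halfbin N e *
    ((N%:R - 2 * e%:R - 1) / ((m%:R + e%:R) * (m%:R + N%:R - e%:R - 1))))) => // e eN.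
  rewrite halfbin_sym // rE // -[RHS]mulrN -[X in _ = _ * X]mulNr.
  by congr (_ * (_ / _)); ring.
apply: (@antisymmetric_sum N l (fun e => halfbin N e *
  ((N%:R - 2 * e%:R - 1) / ((m%:R + e%:R + 1) * (m%:R + N%:R - e%:R))))) => // e eN.
rewrite halfbin_sym // rE // -[RHS]mulrN -[X in _ = _ * X]mulNr.
by congr (_ * (_ / _)); ring.
Qed.

Unset Implicit Arguments.

Theorem theorem6p5 (m N l : nat) (hm : (0 < m)%N) (hN : (1 < N)%N)
  (hl : (0 < l <= size (shifted_axis_lozenges N (2 * m)))%N) :
  (M (V' N (2 * m) l))%:R =
    poch (m%:R + 1) N * poch m%:R N * poch N%:R (N - 1) /
      (poch (2 * m%:R + 1) N * poch (2 * m%:R + N%:R) N * ((N - 1)`!)%:R)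
    * sigma1 N m l
    * \prod_(1 <= i < N.+1) \prod_(1 <= j < N.+1) \prod_(1 <= k < (2 * m).+1)
        ((i%:R + j%:R + k%:R - 1) / (i%:R + j%:R + k%:R - 2)) :> rat.
Proof.
move: hl; rewrite (shifted_axis_lozengesE hm hN) size_map size_iota => hl.
have small (k : nat) : (0 < k < N)%N -> (2 * k <= N)%N -> (M (V' N (2 * m) k))%:R =
    poch (m%:R + 1) N * poch m%:R N * poch N%:R (N - 1) /
      (poch (2 * m%:R + 1) N * poch (2 * m%:R + N%:R) N * ((N - 1)`!)%:R)
    * sigma1 N m k
    * \prod_(1 <= i < N.+1) \prod_(1 <= j < N.+1) \prod_(1 <= k < (2 * m).+1)
        ((i%:R + j%:R + k%:R - 1) / (i%:R + j%:R + k%:R - 2)) :> rat.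
  move=> kN k2N; have /andP[k_gt0 kltN] := kN.
  rewrite (V'E hm kN) -(weight_closed_form hm k2N k_gt0 kltN); congr _%:R.
  apply: (@M_weight N (2 * m) (2 * N - 2 * k) (pin m k_gt0 kltN)); [lia|lia|].
  by rewrite /in_line /=; lia.
have [l2N|l2N] := leqP (2 * l) N; first by apply: small; lia.
have lN : (0 < l < N)%N by lia.
have lN' : (0 < N - l < N)%N by lia.
rewrite (M_V'_reflect hm lN) (small _ lN') ?sigma1_sym //; lia.
Qed.
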